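(* Let $K$ be a field of characteristic zero and let $(M,S)$ be the $\mathbb{Z}_2$-graded pair associated with the adjoint representation of $\mathfrak{sl}_2(K)$, where $M=M_3(K)$, $S=\mathrm{ad}(\mathfrak{sl}_2(K))\subset M_3(K)$ carries the nontrivial $\mathbb{Z}_2$-grading of $\mathfrak{sl}_2(K)$, and $M$ carries the induced $\mathbb{Z}_2$-grading (all given explicitly in the context). Then the following polynomials form a basis of the weak $\mathbb{Z}_2$-graded identities of the pair $(M,S)$, i.e. they generate $T_2(M,S)$ as a weak $T_2$-ideal of $K\langle X\rangle$: $$[y_1,y_2],\qquad y_1zy_2,\qquad z_1yz_2+z_2yz_1,\qquad s_3(z_1,z_2,z_3),$$ $$y_1z_1z_2y_2-y_2z_1z_2y_1,\qquad z_1y_1y_2z_2-z_2y_1y_2z_1,\qquad s_3(z_1,z_2,y)\,x-x\,s_3(z_1,z_2,y),$$ where in the last expression $x$ is any variable, even ($x=y_i$) or odd ($x=z_i$).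
   Context: $X=Y\cup Z$, where $Y=\{y_1,y_2,\dots\}$ (even variables) and $Z=\{z_1,z_2,\dots\}$ (odd variables) are disjoint countable sets; letters $y,y_i$ denote even variables and $z,z_i$ odd variables. $K\langle X\rangle$ is the free associative algebra on $X$, $\mathbb{Z}_2$-graded by the parity of the degree in the variables of $Z$: $K\langle X\rangle=K\langle X\rangle_0\oplus K\langle X\rangle_1$. With $[a,b]=ab-ba$, $L\langle X\rangle$ is the Lie subalgebra of $K\langle X\rangle^{(-)}$ generated by $X$, with the inherited grading $L\langle X\rangle=L\langle X\rangle_0\oplus L\langle X\rangle_1$. A $\mathbb{Z}_2$-graded pair $(A,L)$ consists of a $\mathbb{Z}_2$-graded associative algebra $A=A_0\oplus A_1$ and a Lie subalgebra $L$ of $A^{(-)}$ with $L=L_0\oplus L_1$, $L_i=A_i\cap L$. A polynomial $f(y_1,\dots,y_m,z_1,\dots,z_n)\in K\langle X\rangle$ is a weak graded identity of $(A,L)$ if $f(a_1,\dots,a_m,b_1,\dots,b_n)=0$ for all $a_i\in L_0$, $b_j\in L_1$. $T_2(A,L)$ is the set of all weak graded identities of $(A,L)$. A weak $T_2$-ideal is a two-sided ideal of $K\langle X\rangle$ invariant under all algebra endomorphisms $\phi$ of $K\langle X\rangle$ with $\phi(y_i)\in L\langle X\rangle_0$ and $\phi(z_i)\in L\langle X\rangle_1$ for all $i$. The weak $T_2$-ideal generated by a set is the smallest weak $T_2$-ideal containing it. $s_3(x_1,x_2,x_3)=\sum_{\sigma\in S_3}(-1)^\sigma x_{\sigma(1)}x_{\sigma(2)}x_{\sigma(3)}$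 is the standard polynomial of degree 3. The pair $(M,S)$: $M=M_3(K)$ with $M_0$ the set of matrices whose $(1,2),(1,3),(2,1),(3,1)$ entries vanish, and $M_1$ the set of matrices all of whose entries other than the $(1,2),(1,3),(2,1),(3,1)$ ones vanish. In the basis $h,x,y$ of $\mathfrak{sl}_2(K)$ ($[h,x]=2x$, $[h,y]=-2y$, $[x,y]=h$), the image of the adjoint representation is $$S=\left\{\begin{pmatrix}0&-n&m\\-2m&2a&0\\2n&0&-2a\end{pmatrix}: a,m,n\in K\right\}=S_0\oplus S_1,$$ with $S_0=S\cap M_0$ (the diagonal matrices $\mathrm{diag}(0,2a,-2a)$) and $S_1=S\cap M_1$ (those with $a=0$). *)

(* Defs.v *)
From HB Require Import structures.
From mathcomp Require Import all_boot all_fingroup all_algebra.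
From mathcomp Require Import finmap ring.
From mathcomp.multinomials Require Export monalg.

Set Implicit Arguments.
Unset Strict Implicit.
Unset Printing Implicit Defensive.

Import GRing.Theory.
Local Open Scope ring_scope.

Definition brk (R : pzRingType) (a b : R) : R := a * b - b * a.

Definition is_subspace (K : fieldType) (V : lmodType K) (P : V -> Prop) : Prop :=
  P 0 /\ forall (c : K) (u v : V), P u -> P v -> P (c *: u + v).

Definition is_lie_subalgebra (K : fieldType) (A : lalgType K) (P : A -> Prop) : Prop :=
  is_subspace P /\ forall a b : A, P a -> P b -> P (brk a b).

(* Components of a Z_2-grading are indexed by bool, false being the even one,
   so that addition in Z_2 is (+) *)
Record graded_pair (K : fieldType) : Type := GradedPair {
  gp_alg :> algType K;
  gp_comp : bool -> gp_alg -> Prop;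
  gp_lie : gp_alg -> Prop;
  gp_comp_subspace : forall d, is_subspace (gp_comp d);
  gp_comp_sum : forall a : gp_alg, exists a0 a1 : gp_alg,
    [/\ gp_comp false a0, gp_comp true a1 & a = a0 + a1];
  gp_comp_direct : forall a : gp_alg,
    gp_comp false a -> gp_comp true a -> a = 0;
  gp_comp_mul : forall (d e : bool) (a b : gp_alg),
    gp_comp d a -> gp_comp e b -> gp_comp (d (+) e) (a * b);
  gp_lie_subalgebra : is_lie_subalgebra gp_lie;
  gp_lie_graded : forall a : gp_alg, gp_lie a -> exists a0 a1 : gp_alg,
    [/\ gp_comp false a0 /\ gp_lie a0, gp_comp true a1 /\ gp_lie a1 & a = a0 + a1]
}.

Definition gp_lie_comp (K : fieldType) (P : graded_pair K) (d : bool) (a : P) : Prop :=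
  gp_comp d a /\ gp_lie a.

(* inl i is the even variable y_i and inr i the odd variable z_i *)
Definition variable : Type := (nat + nat)%type.
HB.instance Definition _ := Choice.on variable.

Definition odd_variable (x : variable) : bool := if x is inr _ then true else false.

(* The unital free associative algebra K<X> *)
Notation free_algebra K := {malg K[{fmonom variable}]}.

Definition gen (K : fieldType) (x : variable) : free_algebra K := << fmu x >>.

Section Free.
Variable K : fieldType.
Local Notation F := (free_algebra K).

Definition free_comp (d : bool) (f : F) : Prop :=
  forall w : {fmonom variable}, w \in msupp f -> odd (count odd_variable w) = d.

Definition free_lie (f : F) : Prop :=
  forall P : F -> Prop, is_lie_subalgebra P -> (forall x, P (gen K x)) -> P f.

Definition free_lie_comp (d : bool) (f : F) : Prop := free_comp d f /\ free_lie f.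

Definition is_ideal (I : F -> Prop) : Prop :=
  is_subspace I /\ forall f g : F, I f -> I (g * f) /\ I (f * g).

Definition is_weak_T2_ideal (I : F -> Prop) : Prop :=
  is_ideal I /\
  forall phi : {lrmorphism F -> F},
    (forall x, free_lie_comp (odd_variable x) (phi (gen K x))) ->
    forall f, I f -> I (phi f).

Definition weak_T2_ideal_generated (G : F -> Prop) (f : F) : Prop :=
  forall I : F -> Prop, is_weak_T2_ideal I -> (forall g, G g -> I g) -> I f.

Definition eval (A : algType K) (v : variable -> A) (f : F) : A :=
  mmap (in_alg A) (fun w : {fmonom variable} => \prod_(x <- w) v x) f.

(* A polynomial involves finitely many variables, so assigning values to all
   the variables at once amounts to assigning them to those occurring in f *)
Definition T2 (P : graded_pair K) (f : F) : Prop :=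
  forall v : variable -> P,
    (forall x, gp_lie_comp (odd_variable x) (v x)) -> eval v f = 0.

End Free.

Definition s3 (R : pzRingType) (x1 x2 x3 : R) : R :=
  \sum_(s : 'S_3) (-1) ^+ s * \prod_(i < 3) nth 0 [:: x1; x2; x3] (s i).

Section AdjointPair.
Variable K : fieldType.
Local Notation M := 'M[K]_3.

(* i == 0 and j == 0 disagree exactly at the positions (1,2), (1,3), (2,1) and
   (3,1) of the usual 1-based numbering *)
Definition M_comp (d : bool) (A : M) : Prop :=
  forall i j : 'I_3, (i == 0) (+) (j == 0) != d -> A i j = 0.

(* Matrix of ad(a h + m x + n y) in the basis h, x, y of sl_2, where
   [h,x] = 2x, [h,y] = -2y and [x,y] = h *)
Definition ad_sl2 (a m n : K) : M :=
  \matrix_(i < 3, j < 3) nth 0 (nth [::]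
    [:: [:: 0;          - n;       m          ];
        [:: - (2 * m);  2 * a;     0          ];
        [:: 2 * n;      0;         - (2 * a)  ]] i) j.

Definition S_lie (A : M) : Prop := exists a m n : K, A = ad_sl2 a m n.

Lemma M_comp_subspace d : is_subspace (M_comp d).
Proof.
split=> [i j _|c u v Hu Hv i j Hij]; first by rewrite mxE.
by rewrite !mxE Hu // Hv // mulr0 addr0.
Qed.

Lemma M_comp_sum (A : M) : exists a0 a1 : M,
  [/\ M_comp false a0, M_comp true a1 & A = a0 + a1].
Proof.
exists (\matrix_(i, j) if (i == 0) (+) (j == 0) then 0 else A i j).
exists (\matrix_(i, j) if (i == 0) (+) (j == 0) then A i j else 0).
split.
- by move=> i j; rewrite mxE; case: (_ (+) _).
- by move=> i j; rewrite mxE; case: (_ (+) _).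
by apply/matrixP=> i j; rewrite !mxE; case: (_ (+) _); rewrite ?add0r ?addr0.
Qed.

Lemma M_comp_direct (A : M) : M_comp false A -> M_comp true A -> A = 0.
Proof.
move=> H0 H1; apply/matrixP=> i j; rewrite mxE.
by case: (boolP ((i == 0) (+) (j == 0))) => [h|/negbTE h];
  [apply: H0 | apply: H1]; rewrite h.
Qed.

Lemma M_comp_mul d e (A B : M) :
  M_comp d A -> M_comp e B -> M_comp (d (+) e) (A * B).
Proof.
move=> HA HB i j Hij; rewrite -mulmxE mxE big1 // => k _.
have [/eqP hA|hA] := boolP ((i == 0) (+) (k == 0) == d); last by rewrite HA // mul0r.
have [/eqP hB|hB] := boolP ((k == 0) (+) (j == 0) == e); last by rewrite HB // mulr0.
by move: Hij; rewrite -hA -hB; case: (i == 0); case: (k == 0); case: (j == 0).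
Qed.

Lemma S_lie_subalgebra : is_lie_subalgebra S_lie.
Proof.
split; first split.
- exists 0, 0, 0; apply/matrixP=> i j; rewrite !mxE.
  by case: i => [[|[|[|//]]] ?]; case: j => [[|[|[|//]]] ?] //=; rewrite ?mulr0 ?oppr0.
- move=> c _ _ [a [m [n ->]]] [a' [m' [n' ->]]].
  exists (c * a + a'), (c * m + m'), (c * n + n').
  apply/matrixP=> i j; rewrite !mxE.
  case: i => [[|[|[|//]]] ?]; case: j => [[|[|[|//]]] ?] //=;
    by rewrite ?mulr0 ?addr0 // ?mulrN -?opprD ?mulrDr ?(mulrCA c).
- move=> _ _ [a [m [n ->]]] [a' [m' [n' ->]]].
  exists (m * n' - n * m'), (2 * (a * m' - m * a')), (2 * (n * a' - a * n')).
  apply/matrixP=> i j; rewrite /brk -!mulmxE !mxE !big_ord_recl !big_ord0 !mxE.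
  by case: i => [[|[|[|//]]] ?]; case: j => [[|[|[|//]]] ?] //=; ring.
Qed.

Lemma S_lie_graded (A : M) : S_lie A -> exists a0 a1 : M,
  [/\ M_comp false a0 /\ S_lie a0, M_comp true a1 /\ S_lie a1 & A = a0 + a1].
Proof.
move=> [a [m [n ->]]]; exists (ad_sl2 a 0 0), (ad_sl2 0 m n); split.
- split; last by exists a, 0, 0.
  by move=> i j; rewrite mxE; case: i => [[|[|[|//]]] ?]; case: j => [[|[|[|//]]] ?] //=;
    rewrite ?mulr0 ?oppr0.
- split; last by exists 0, m, n.
  by move=> i j; rewrite mxE; case: i => [[|[|[|//]]] ?]; case: j => [[|[|[|//]]] ?] //=;
    rewrite ?mulr0 ?oppr0.
apply/matrixP=> i j; rewrite !mxE.
by case: i => [[|[|[|//]]] ?]; case: j => [[|[|[|//]]] ?] //=;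
  rewrite ?mulr0 ?oppr0 ?add0r ?addr0.
Qed.

Definition pair_MS : graded_pair K :=
  @GradedPair K M M_comp S_lie M_comp_subspace M_comp_sum M_comp_direct
    M_comp_mul S_lie_subalgebra S_lie_graded.

End AdjointPair.

Section Basis.
Variable K : fieldType.
Local Notation y i := (gen K (inl i%N)).
Local Notation z i := (gen K (inr i%N)).

(* The letters y and z without an index are taken to be y_1 and z_1 *)
Inductive MS_basis : free_algebra K -> Prop :=
| MS_basis1 : MS_basis (brk (y 1) (y 2))
| MS_basis2 : MS_basis (y 1 * z 1 * y 2)
| MS_basis3 : MS_basis (z 1 * y 1 * z 2 + z 2 * y 1 * z 1)
| MS_basis4 : MS_basis (s3 (z 1) (z 2) (z 3))
| MS_basis5 : MS_basis (y 1 * z 1 * z 2 * y 2 - y 2 * z 1 * z 2 * y 1)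
| MS_basis6 : MS_basis (z 1 * y 1 * y 2 * z 2 - z 2 * y 1 * y 2 * z 1)
| MS_basis7 (x : variable) :
    MS_basis (s3 (z 1) (z 2) (y 1) * gen K x - gen K x * s3 (z 1) (z 2) (y 1)).

End Basis.

(* Main.v *)
(* Let I be the weak T_2-ideal generated by the seven polynomials. Each of them
   vanishes on (M,S) and the identities of (M,S) form a weak T_2-ideal, so every
   element of I is an identity. Conversely, in K<X>/I every word is a combination
   of sorted words in the odd variables and of products of letters y_i,
   commutators c_ab = [z_a,z_b], pairs s_ab = z_a z_b and at most two further odd
   letters, whose shape tells where the product sits relative to the idempotents
   diag(1,0,0) and diag(0,1,1). Evaluate at the generic elements
   y_i = diag(0,t_i,-t_i) and z_i with first row (0,p_i,q_i): up to constants, each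
   product takes in one matrix entry the value given by y_i -> t_i,
   c_ab -> 2(p_a q_b - p_b q_a), s_ab -> -2(p_a q_b + p_b q_a) and by p or q for the
   remaining letters. The relations in K<X>/I are exactly strong enough to make the
   product depend linearly on this value: 4 p_a q_b = c_ab - s_ab allows one to
   attach to a monomial in t, p, q an element of the quotient, and the exchange,
   Pluecker and Pfaffian relations show that it is well defined. As distinct
   monomials are linearly independent functions, a combination of products that
   vanishes on all generic matrices is zero in K<X>/I. *)
From Stdlib Require Import Ncring Ncring_tac ClassicalEpsilon.
From HB Require Import structures.
Require Import Defs.
From mathcomp Require Import all_boot all_fingroup all_algebra finmap.
From mathcomp Require Import zify ring generic_quotient ring_quotient.

Set Implicit Arguments.
Unset Strict Implicit.
Unset Printing Implicit Defensive.

Import GRing.Theory.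
Local Open Scope ring_scope.

(** * Consequences of the basis relations *)

(** Three obstacles shape the argument (matrix entries are indexed from 0). The two shapes of
    products that begin and end in rows 1, 2 agree in entry (1,1) and are opposite in entry (1,2),
    so entries separate only their half-sum and half-difference, and two families are built from
    these. Next, 4 p_a q_b = c_ab - s_ab trades letters for pairs, but pairs may be permuted only
    next to an even factor. If no y_i occurs, one commutator has to survive, so a monomial in p, q
    has no element directly: only differences under the exchange of two letters are given, and they
    are integrated, closedness being the Pluecker relation. Finally, words in odd variables alone
    are separated beforehand at t = 0, p = q, where all even factors vanish and every z_i is a
    multiple of one matrix that is not nilpotent. The relations are derived in an abstract ring with
    predicates [E] and [O], so that they apply to commutators as well as to letters, and mirror
    images can be taken in the opposite ring. *)

Section NoncommutativeRing.
Variable R : pzRingType.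

(** Most relations below are proved by a noncommutative polynomial identity that writes the wanted
    difference as a combination of known zeros. These instances let [ncr] check such identities. *)
#[global] Instance nc_ring_ops : @Ring_ops R 0 1 (fun x y => x + y)
  (fun x y => x * y) (fun x y => x - y) (fun x => - x) (@eq R) := {}.

#[global] Instance nc_ring : Ring (Ro := nc_ring_ops).
Proof.
constructor; try (by move=> *; subst).
- exact: eq_equivalence.
- by move=> a b -> c d ->.
- by move=> a b -> c d ->.
- by move=> a b -> c d ->.
- by move=> a b ->.
- exact: add0r.
- exact: addrC.
- exact: addrA.
- exact: mul1r.
- exact: mulr1.
- exact: mulrA.
- exact: mulrDl.
- by move=> x y z; exact: mulrDr.
- exact: subrr.
Qed.
End NoncommutativeRing.

Ltac ncr := rewrite /brk; intros; non_commutative_ring.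

(* E and O stand for the images of the even and the odd Lie elements; rel1, ...,
   rel5 come from the first five polynomials of the basis. *)
Record weak_rel (R : pzRingType) (E O : R -> Prop) : Prop := WeakRel {
  relOO : forall a b, O a -> O b -> E (brk a b);
  relEO : forall y a, E y -> O a -> O (brk y a);
  relOE : forall a y, O a -> E y -> O (brk a y);
  relEN : forall y, E y -> E (- y);
  relON : forall a, O a -> O (- a);
  rel1 : forall x y, E x -> E y -> x * y = y * x;
  rel2 : forall x a y, E x -> O a -> E y -> x * a * y = 0;
  rel3 : forall a y b, O a -> E y -> O b -> a * y * b + b * y * a = 0;
  rel4 : forall a b c, O a -> O b -> O c ->
    brk a b * c + brk b c * a + brk c a * b = 0;
  rel5 : forall x a b y, E x -> O a -> O b -> E y ->
    x * a * b * y = y * a * b * x;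
  rel_two : forall x : R, x + x = 0 -> x = 0
}.

Definition ad2 (R : pzRingType) (a b y : R) : R := a * b * y + y * b * a.

(* Left-right symmetry: every relation has a mirror image for free. *)
Lemma weak_rel_conv (R : pzRingType) (E O : R -> Prop) :
  @weak_rel R E O -> @weak_rel R^c E O.
Proof.
move=> H; have brkc (a b : R) : @brk R^c a b = - @brk R a b.
  by rewrite /brk opprB.
have s3c (a b c : R) : brk a b * c + brk b c * a + brk c a * b = 0 ->
    c * - brk a b + a * - brk b c + b * - brk c a = 0.
  by move=> h; rewrite -[RHS]oppr0 -h; ncr.
split.
- by move=> a b Oa Ob; rewrite brkc; apply/(relEN H)/(relOO H).
- by move=> y a Ey Oa; rewrite brkc; apply/(relON H)/(relEO H).
- by move=> a y Oa Ey; rewrite brkc; apply/(relON H)/(relOE H).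
- exact: (relEN H).
- exact: (relON H).
- by move=> x y Ex Ey; exact: (rel1 H Ey Ex).
- by move=> x a y Ex Oa Ey; have := rel2 H Ey Oa Ex; rewrite -(@mulrA R) => h; exact: h.
- by move=> a y b Oa Ey Ob; have := rel3 H Ob Ey Oa; rewrite -!(@mulrA R) => h; exact: h.
- move=> a b c Oa Ob Oc; rewrite !brkc; exact: s3c (rel4 H Oa Ob Oc).
- by move=> x a b y Ex Oa Ob Ey; have := rel5 H Ey Ob Oa Ex; rewrite -!(@mulrA R) => h; exact: h.
- exact: (rel_two H).
Qed.

(** An induction principle for equalities that travel with side conditions, such as evenness of all
    factors. *)
Lemma perm_eq_rel (T : eqType) (r : seq T -> seq T -> Prop) :
  (forall s, r s s) -> (forall s t u, r s t -> r t u -> r s u) ->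
  (forall x y s, r [:: x, y & s] [:: y, x & s]) ->
  (forall x s t, r s t -> r (x :: s) (x :: t)) ->
  forall s t, perm_eq s t -> r s t.
Proof.
move=> rr rt rsw rc s; have [n] := ubnP (size s); elim: n s => // n IH [|x s].
  by move=> _ t; rewrite perm_sym => /perm_nilP ->.
rewrite ltnS => lt_n [|y t]; first by move/perm_size.
have [<-|neq_xy] := eqVneq x y; first by rewrite perm_cons => /(IH _ lt_n); exact: rc.
move=> p_st; have xt : x \in t.
  by have := perm_mem p_st x; rewrite !inE eqxx (negbTE neq_xy) /= => <-.
have p_t := perm_to_rem xt.
have p_s : perm_eq s (y :: rem x t).
  rewrite -(perm_cons x); apply: perm_trans p_st _.
  by apply/seq.permP => a /=; rewrite (seq.permP p_t) /= addnCA.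
apply: (rt _ _ _ (rc x _ _ (IH _ lt_n _ p_s))).
apply: (rt _ _ _ (rsw _ _ _)); apply: rc.
apply: IH; last by rewrite perm_sym.
by have := perm_size p_st; rewrite /= (perm_size p_t) => -[<-].
Qed.

Section Relations.
Variables (R : pzRingType) (E O : R -> Prop) (H : @weak_rel R E O).

(** By [rel3], [ad2 a b y] is the double commutator [a,[b,y]], hence again an even Lie element. This
    is what allows an even factor to absorb pairs of odd letters. *)
Lemma E_ad2 a b y : O a -> O b -> E y -> E (ad2 a b y).
Proof.
move=> Oa Ob Ey; have -> : ad2 a b y = brk a (brk b y).
  apply/eqP; rewrite -subr_eq0; apply/eqP.
  have -> : ad2 a b y - brk a (brk b y) = a * y * b + b * y * a by rewrite /ad2; ncr.
  exact: (rel3 H).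
exact: (relOO H Oa (relOE H Ob Ey)).
Qed.

(** One even factor does not commute with a pair in general, but two do: [rel5] carries x to the
    other side of the pair, and the errors are commutators of even elements such as y and
    [ad2 b a x]. *)
Lemma comm_pair x a b y : E x -> O a -> O b -> E y -> x * y * a * b = a * b * x * y.
Proof.
move=> Ex Oa Ob Ey; have Ec := relOO H Oa Ob.
have := rel1 H Ey (E_ad2 Ob Oa Ex); have := rel5 H Ex Ob Oa Ey.
have := rel1 H Ex Ec; have := rel1 H Ex Ey.
move=> e1 e2 e3 e4; apply/subr0_eq.
have -> : x * y * a * b - a * b * x * y =
  (x * y - y * x) * a * b + (x * b * a * y - y * b * a * x)
  + (x * brk a b - brk a b * x) * y + (y * ad2 b a x - ad2 b a x * y)
  by rewrite /ad2; ncr.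
by rewrite e1 e2 e3 e4 !subrr !mul0r !addr0.
Qed.

Lemma even_pair0 a b c y : O a -> O b -> O c -> E y -> brk a b * c * y = 0.
Proof. by move=> Oa Ob Oc Ey; apply: (rel2 H) => //; exact: (relOO H). Qed.

Lemma comm_brk y a b : E y -> O a -> O b -> y * brk a b - brk a b * y = 0.
Proof. by move=> Ey Oa Ob; rewrite (rel1 H Ey (relOO H Oa Ob)) subrr. Qed.

(** The even factor moves to the end of the word at the cost of a commutator. The available zeros
    combine to twice the difference, hence [rel_two]. *)
Lemma move_y a b y c : O a -> O b -> O c -> E y -> b * y * c * a = a * brk c b * y.
Proof.
move=> Oa Ob Oc Ey; apply/eqP; rewrite -subr_eq0; apply/eqP; apply: (rel_two H).
have -> : (b * y * c * a - a * brk c b * y) + (b * y * c * a - a * brk c b * y) =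
  brk a b * c * y - brk a c * b * y + brk b c * a * y
  + c * (y * brk a b - brk a b * y) - b * (y * brk a c - brk a c * y)
  - a * (y * brk b c - brk b c * y)
  + (a * y * b + b * y * a) * c - (a * y * c + c * y * a) * b
  + (b * y * c + c * y * b) * a by ncr.
by rewrite !even_pair0 // !comm_brk // !(rel3 H) // !(mul0r, mulr0, subr0, addr0).
Qed.

(** A pair standing before [l * y] is hidden in the even factor: up to [move_y], the two sides
    differ by a commutator followed by an odd and an even element, which [rel2] kills. *)
Lemma absorb_right l a b y : O l -> O a -> O b -> E y -> l * ad2 a b y = a * b * l * y.
Proof.
move=> Ol Oa Ob Ey.
have -> : l * ad2 a b y = (l * y * b * a - a * brk b l * y) + brk l a * b * y + a * b * l * y.
  by rewrite /ad2; ncr.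
by rewrite move_y // subrr even_pair0 // !add0r.
Qed.

(** On the row of index 0 pairs act as scalars. Twice the difference is a sum of three kinds of
    zeros: [S1], where all that follows the commutator is absorbed into an even element; [S2], a
    commutator directly before [l * y]; [A], an instance of [rel3] whose even factor is a
    commutator. *)
Lemma comm_pairs_right a b c d l y : O a -> O b -> O c -> O d -> O l -> E y ->
  a * b * c * d * l * y = c * d * a * b * l * y.
Proof.
move=> Oa Ob Oc Od Ol Ey.
have S1 p q r s : O p -> O q -> O r -> O s -> brk p q * r * s * l * y = 0.
  move=> Op Oq Or Os; have := absorb_right Ol Or Os Ey; rewrite -!mulrA => <-.
  by rewrite mulrA even_pair0 //; exact: E_ad2.
have S2 p q r s : O p -> O q -> O r -> O s -> p * q * brk r s * l * y = 0.
  by move=> *; rewrite -!mulrA (mulrA (brk _ _)) even_pair0 ?mulr0.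
have A p q r s : O p -> O q -> O r -> O s ->
    (p * brk q r * s + s * brk q r * p) * l * y = 0.
  by move=> *; rewrite (rel3 H) ?mul0r //; exact: (relOO H).
apply/subr0_eq/(rel_two H).
set D := _ - _.
have -> : D + D =
  (a * b * brk c d * l * y + a * b * brk c d * l * y) - b * c * brk a d * l * y
  + ((b * brk a d * c + c * brk a d * b) * l * y + (b * brk a d * c + c * brk a d * b) * l * y)
  + (brk a b * d * c * l * y + brk a b * d * c * l * y)
  + (brk a c * d * b * l * y + brk a c * d * b * l * y)
  + a * c * brk b d * l * y + b * d * brk a c * l * y
  - (a * brk c d * b + b * brk c d * a) * l * y - (c * brk a b * d + d * brk a b * c) * l * y
  - brk a c * b * d * l * y - brk a d * b * c * l * y + brk b c * a * d * l * y
  + a * d * brk b c * l * y + brk b d * a * c * l * y by rewrite /D; ncr.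
by rewrite !S1 ?S2 ?A // !(addr0, subr0).
Qed.

End Relations.

Section LeftRelations.
Variables (R : pzRingType) (E O : R -> Prop) (H : @weak_rel R E O).

Lemma absorb_left k a b y : O k -> O a -> O b -> E y -> ad2 a b y * k = y * k * b * a.
Proof.
move=> Ok Oa Ob Ey; have := absorb_right (weak_rel_conv H) Ok Oa Ob Ey.
rewrite -!(@mulrA R^c) => h; refine (@etrans R _ _ _ _ h).
(* Products in [R^c] are convertible to reversed products in [R]. *)
change ((a * b * y + y * b * a) * k = (y * (b * a) + a * (b * y)) * k).
by rewrite addrC -!mulrA.
Qed.

Lemma comm_pairs_left a b c d l y : O a -> O b -> O c -> O d -> O l -> E y ->
  y * l * a * b * c * d = y * l * c * d * a * b.
Proof.
move=> Oa Ob Oc Od Ol Ey; have := comm_pairs_right (weak_rel_conv H) Od Oc Ob Oa Ol Ey.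
by rewrite -!(@mulrA R) => h; exact: h.
Qed.

Lemma odd_pair0 a b c y : O a -> O b -> O c -> E y -> y * c * brk a b = 0.
Proof. by move=> Oa Ob Oc Ey; apply: (rel2 H) => //; exact: (relOO H). Qed.

(** The antisymmetrization of a b c d vanishes, being an alternating sum of multiples of [s3].
    Grouped by commutators, which commute, it is twice the Pfaffian. *)
Lemma pfaffian0 a b c d : O a -> O b -> O c -> O d ->
  brk a b * brk c d + brk a c * brk d b + brk a d * brk b c = 0.
Proof.
move=> Oa Ob Oc Od; apply: (rel_two H); set D := _ + _ + _.
have r4 p q r := @rel4 _ _ _ H p q r.
have C p q r s : O p -> O q -> O r -> O s ->
    brk p q * brk r s - brk r s * brk p q = 0.
  by move=> *; rewrite (comm_brk H) //; exact: (relOO H).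
pose s3 p q r : R := brk p q * r + brk q r * p + brk r p * q.
have -> : D + D =
  a * s3 b c d - b * s3 a c d + c * s3 a b d - d * s3 a b c
  + (brk a d * brk b c - brk b c * brk a d) - (brk a c * brk b d - brk b d * brk a c)
  + (brk a b * brk c d - brk c d * brk a b) by rewrite /D /s3; ncr.
by rewrite /s3 !r4 ?C // !(mulr0, addr0, subr0).
Qed.

Variable z : nat -> R.
Hypothesis Oz : forall i, O (z i).

Definition pairs (ss : seq (nat * nat)) : R := \prod_(p <- ss) (z p.1 * z p.2).
(* Moving a product of pairs past the even element y turns y into adl ss y. *)
Definition adl (ss : seq (nat * nat)) (y : R) : R :=
  foldr (fun p => ad2 (z p.1) (z p.2)) y ss.

Lemma pairs_cons p ss : pairs (p :: ss) = z p.1 * z p.2 * pairs ss.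
Proof. by rewrite /pairs big_cons. Qed.

Lemma pairs_nil : pairs [::] = 1.
Proof. by rewrite /pairs big_nil. Qed.

Lemma E_adl ss y : E y -> E (adl ss y).
Proof. by move=> Ey; elim: ss => //= p ss IH; exact: (E_ad2 H). Qed.

Lemma adl_right ss l y : O l -> E y -> l * adl ss y = pairs ss * l * y.
Proof.
move=> Ol Ey; elim: ss => [|p ss IH] /=; first by rewrite pairs_nil mul1r.
rewrite (absorb_right H) //; last exact: E_adl.
by rewrite -mulrA IH pairs_cons !mulrA.
Qed.

Lemma pairs_right_swap a b ss l y : O l -> E y ->
  pairs ((a, b) :: ss) * l * y = pairs ((b, a) :: ss) * l * y.
Proof.
move=> Ol Ey; rewrite -!adl_right //=; apply/subr0_eq.
rewrite !(absorb_right H) //; try exact: E_adl.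
by rewrite -!mulrBl (even_pair0 H (Oz a) (Oz b) Ol) //; exact: E_adl.
Qed.

Lemma pairs_right_perm ss ss' l y : perm_eq ss ss' -> O l -> E y ->
  pairs ss * l * y = pairs ss' * l * y.
Proof.
move=> pss Ol Ey; elim/perm_eq_rel: pss => {ss ss'}.
- by [].
- by move=> s t u -> ->.
- move=> p q s; rewrite !pairs_cons -!mulrA.
  rewrite (mulrA (pairs s)) -adl_right // !mulrA.
  by apply: (comm_pairs_right H) => //; exact: E_adl.
- by move=> p s t e; rewrite !pairs_cons -!mulrA !(mulrA (pairs _)) e.
Qed.

Lemma pairs_left_swap a b ss k y : O k -> E y ->
  y * k * pairs ((a, b) :: ss) = y * k * pairs ((b, a) :: ss).
Proof.
move=> Ok Ey; apply/subr0_eq; rewrite !pairs_cons /=.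
have -> : y * k * (z a * z b * pairs ss) - y * k * (z b * z a * pairs ss) =
  y * k * brk (z a) (z b) * pairs ss by ncr.
by rewrite odd_pair0 // mul0r.
Qed.

Lemma pairs_left_perm ss ss' k y : perm_eq ss ss' -> O k -> E y ->
  y * k * pairs ss = y * k * pairs ss'.
Proof.
move=> pss Ok; move: y; elim/perm_eq_rel: pss => {ss ss'}.
- by [].
- by move=> s t u st tu y Ey; rewrite st ?tu.
- move=> p q s y Ey; rewrite !pairs_cons !mulrA.
  by rewrite (comm_pairs_left (Oz p.1) (Oz p.2) (Oz q.1) (Oz q.2)).
- move=> p s t e y Ey; rewrite !pairs_cons !mulrA.
  (* The first pair is absorbed into the even factor, so the induction hypothesis must hold for
     every even y. *)
  rewrite -(absorb_left Ok (Oz p.2) (Oz p.1) Ey).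
  by apply: e; exact: (E_ad2 H).
Qed.

Lemma adl_left ss k y : O k -> E y -> adl ss y * k = y * k * pairs ss.
Proof.
move=> Ok; elim: ss y => [|[a b] ss IH] y Ey /=; first by rewrite pairs_nil mulr1.
rewrite absorb_left //; last exact: E_adl.
rewrite IH // pairs_left_swap // -!mulrA.
have -> : pairs ss * (z b * z a) = pairs (rcons ss (b, a)).
  by rewrite /pairs -cats1 big_cat big_seq1.
by rewrite !mulrA; apply: pairs_left_perm => //; rewrite perm_rcons.
Qed.

(** Extends [rel2] to odd words of any length: the even factor on the right absorbs the pairs. *)
Lemma even_pairs_even0 x ss k y : E x -> O k -> E y -> x * pairs ss * k * y = 0.
Proof.
by move=> Ex Ok Ey; rewrite -2!mulrA mulrA -mulrA (mulrA (pairs _)) -adl_right // mulrA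
  (rel2 H) //; exact: E_adl.
Qed.

Lemma comm_middle x y k ss l : E x -> E y -> O k -> O l ->
  x * y * (k * pairs ss * l) = k * pairs ss * l * x * y.
Proof.
move=> Ex Ey Ok Ol; rewrite !mulrA -(mulrA x) -(mulrA x) -adl_left //.
have Ea := E_adl ss Ey; rewrite mulrA (comm_pair H) // -!mulrA (rel1 H Ex Ea).
by rewrite (mulrA l) adl_right // (rel1 H Ex Ey) !mulrA.
Qed.

Lemma swap_middle x y k ss l : E x -> E y -> O k -> O l ->
  x * (k * pairs ss * l) * y = y * (k * pairs ss * l) * x.
Proof.
move=> Ex Ey Ok Ol; rewrite !mulrA -adl_left // (rel5 H) //; last exact: E_adl.
by rewrite -!mulrA adl_right // !mulrA.
Qed.

End LeftRelations.

Section EvenLists.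
Variables (R : pzRingType) (E O : R -> Prop) (H : @weak_rel R E O).

Definition allE (Z : seq R) : Prop := forall x, x \in Z -> E x.

Local Notation P Z := (\prod_(x <- Z) x).

Lemma allE_cons x Z : allE (x :: Z) <-> E x /\ allE Z.
Proof.
split=> [h|[Ex h] y]; last by rewrite inE => /predU1P[->|/h].
by split=> [|y yZ]; apply: h; rewrite inE ?eqxx // yZ orbT.
Qed.

Lemma prod_perm Z Z' : perm_eq Z Z' -> allE Z -> P Z = P Z'.
Proof.
move=> p aZ; suff [] : allE Z' /\ P Z = P Z' by [].
move: aZ; elim/perm_eq_rel: p => {Z Z'} //.
- by move=> s t u st tu /st[/tu[? <-] ->].
- move=> x y s; rewrite !allE_cons => -[Ex [Ey As]]; split=> //.
  by rewrite !big_cons !mulrA (rel1 H Ex Ey).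
- move=> x s t st; rewrite !allE_cons => -[Ex /st[At e]]; split=> //.
  by rewrite !big_cons e.
Qed.

Lemma prod_comm y Z : E y -> allE Z -> y * P Z = P Z * y.
Proof.
move=> Ey; elim: Z => [|x Z IH]; first by rewrite big_nil mulr1 mul1r.
by rewrite allE_cons big_cons => -[Ex /IH e]; rewrite mulrA (rel1 H Ey Ex) -mulrA e mulrA.
Qed.

(** By [comm_middle] two even factors cross a word of even length together, so only the parity of
    the number of factors on its left matters; one factor on the left represents odd parity. Which
    one is immaterial by [swap_middle]. The value on the empty list is a default. *)
Definition sandwich (Z : seq R) (w : R) : R :=
  if Z is x :: Z' then x * w * P Z' else w.

Variable z : nat -> R.
Hypothesis Oz : forall i, O (z i).
Local Notation pairs := (pairs z).

Lemma sandwich_perm Z Z' k ss l : perm_eq Z Z' -> allE Z -> O k -> O l ->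
  sandwich Z (k * pairs ss * l) = sandwich Z' (k * pairs ss * l).
Proof.
move=> p aZ Ok Ol; set w := k * _ * l.
suff [? []] : allE Z' /\ P Z = P Z' /\ sandwich Z w = sandwich Z' w by [].
move: aZ; elim/perm_eq_rel: p => {Z Z'} //.
- by move=> s t u st tu /st[/tu[? [<- <-]] [-> ->]].
- move=> x y s; rewrite !allE_cons => -[Ex [Ey As]]; do 2!split=> //.
    by rewrite !big_cons !mulrA (rel1 H Ex Ey).
  rewrite /sandwich !big_cons !(mulrA (_ * w)).
  by rewrite (swap_middle H Oz _ Ex Ey Ok Ol).
- move=> x s t st; rewrite !allE_cons => -[Ex /st[At [e _]]]; do 2!split=> //.
    by rewrite !big_cons e.
  by rewrite /sandwich e.
Qed.

Lemma pairs_typed_perm ss ss' l Z : perm_eq ss ss' -> O l -> Z != [::] -> allE Z ->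
  pairs ss * l * P Z = pairs ss' * l * P Z.
Proof.
case: Z => // y Z p Ol _ /allE_cons[Ey _].
by rewrite big_cons !(mulrA (_ * l)) (pairs_right_perm H Oz p Ol Ey).
Qed.

Lemma pairs_typed_swap a b ss l Z : O l -> Z != [::] -> allE Z ->
  pairs ((a, b) :: ss) * l * P Z = pairs ((b, a) :: ss) * l * P Z.
Proof.
case: Z => // y Z Ol _ /allE_cons[Ey _].
by rewrite big_cons !(mulrA (_ * l)) (pairs_right_swap H Oz _ _ _ Ol Ey).
Qed.

Lemma typed_brk0 a b l Z : O a -> O b -> O l -> Z != [::] -> allE Z ->
  brk a b * l * P Z = 0.
Proof.
case: Z => // y Z Oa Ob Ol _ /allE_cons[Ey _].
by rewrite big_cons mulrA (even_pair0 H) ?mul0r.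
Qed.

(** For one even factor this is [rel3]. For more, [y * b] is replaced by the odd element [y,b]: the
    missing term has b between two even factors and vanishes by [rel2]. Each even factor contributes
    one sign. *)
Lemma odd_even_odd a b Z : O a -> O b -> Z != [::] -> allE Z ->
  a * P Z * b = (-1) ^+ size Z * (b * P Z * a).
Proof.
elim: Z b => // y Z IH b Oa Ob _ /allE_cons[Ey aZ].
have [Z0|Z0] := eqVneq Z [::].
  rewrite Z0 !big_seq1 expr1 mulN1r; apply/subr0_eq; rewrite opprK.
  exact: (rel3 H).
have Oc := relEO H Ey Ob.
have e0 : y * b * P Z = 0.
  case: Z Z0 aZ {IH} => // x Z _ /allE_cons[Ex aZ].
  by rewrite big_cons mulrA (rel2 H Ey Ob Ex) mul0r.
have e1 : P Z * b * y = 0.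
  case/lastP: Z Z0 aZ {IH e0} => // Z x _ aZ.
  have Ex : E x by apply: aZ; rewrite mem_rcons inE eqxx.
  by rewrite -cats1 big_cat big_seq1 /= -!mulrA (mulrA x) (rel2 H Ex Ob Ey) mulr0.
have comm := prod_comm Ey aZ.
rewrite big_cons exprS mulN1r {1}comm.
have -> : a * (P Z * y) * b = a * P Z * brk y b + a * (P Z * b * y) by ncr.
rewrite e1 mulr0 addr0 IH // /brk.
have -> : (y * b - b * y) * P Z * a = y * b * P Z * a - b * (y * P Z) * a by ncr.
by rewrite e0 mul0r sub0r mulrN mulNr.
Qed.

(** On the generic matrices an even number of even factors is scalar on rows 1, 2 and moves freely,
    while an odd number is a multiple of diag(1,-1) there; hence the two cases. The induction starts
    from [move_y] and again trades b for [y,b]. *)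
Lemma move_list a b c Z : O a -> O b -> O c -> Z != [::] -> allE Z ->
  a * P Z * b * c = (if odd (size Z) then c * brk b a else a * b * c) * P Z.
Proof.
elim: Z b => // y Z IH b Oa Ob Oc _ /allE_cons[Ey aZ].
have [Z0|Z0] := eqVneq Z [::].
  by rewrite Z0 !big_seq1 /= (move_y H Oc Oa Ob Ey).
have Od := relEO H Ey Ob.
have eN d : O d -> y * d * P Z = 0.
  case: Z Z0 aZ {IH} => // t Z _ /allE_cons[Et aZ] Od'.
  by rewrite big_cons mulrA (rel2 H Ey Od' Et) mul0r.
have e1 : P Z * b * y = 0.
  case/lastP: Z Z0 aZ {IH eN} => // Z x _ aZ.
  have Ex : E x by apply: aZ; rewrite mem_rcons inE eqxx.
  by rewrite -cats1 big_cat big_seq1 /= -!mulrA (mulrA x) (rel2 H Ex Ob Ey) mulr0.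
have comm := prod_comm Ey aZ.
rewrite big_cons comm.
have -> : a * (P Z * y) * b * c = a * P Z * brk y b * c + a * (P Z * b * y) * c by ncr.
rewrite e1 mulr0 mul0r addr0 IH //= -comm.
case: (odd (size Z)) => /=.
  have -> : c * brk (brk y b) a * P Z = a * b * c * (y * P Z)
    + (c * y * b * a - a * brk b c * y) * P Z + brk c a * b * (y * P Z)
    - c * b * (y * a * P Z) - c * a * (y * b * P Z) by ncr.
  rewrite (move_y H Oa Oc Ob Ey) subrr mul0r !eN // !mulr0 !subr0 addr0.
  have -> : y * P Z = P (y :: Z) by rewrite big_cons.
  by rewrite (typed_brk0 Oc Oa Ob) ?addr0 //; apply/allE_cons.
have -> : a * brk y b * c * P Z = a * y * b * c * P Z - a * b * (y * c * P Z) by ncr.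
by rewrite eN // mulr0 subr0 (move_y H Oc Oa Ob Ey) !mulrA.
Qed.

(** Formally the left side has the value 4 p_i q_j p_l q_k, and the claim is its symmetry in j and
    k. The parity of the list fixes the signs in [h2] and [h3], and each parity has its own
    combination of zeros. *)
Lemma uu_exchange i j k l Z : O i -> O j -> O k -> O l -> Z != [::] -> allE Z ->
  l * brk i j * P Z * k - i * j * l * P Z * k =
  l * brk i k * P Z * j - i * k * l * P Z * j.
Proof.
move=> Oi Oj Ok Ol Z0 aZ.
set X := P Z.
have h1 p q r : O p -> O q -> O r -> brk p q * r * X = 0.
  by move=> *; apply: typed_brk0.
have h2 p q : O p -> O q -> p * X * q = (-1) ^+ size Z * (q * X * p).
  by move=> *; apply: odd_even_odd.
have h3 p q r s : O p -> O q -> O r -> O s ->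
    p * brk q r * X * s = - ((-1) ^+ size Z * (s * brk q r * X * p)).
  move=> Op Oq Or Os; have := @odd_even_odd p s (brk q r :: Z) Op Os isT.
  rewrite big_cons -/X /= exprS mulN1r mulNr !mulrA; apply.
  by apply/allE_cons; split=> //; exact: (relOO H).
have [sZ|sZ] := boolP (odd (size Z)).
  have e : (-1) ^+ size Z = -1 :> R by rewrite -signr_odd sZ.
  have {}h2 p q : O p -> O q -> p * X * q + q * X * p = 0.
    by move=> Op Oq; rewrite (h2 p q) // e mulN1r addNr.
  have {}h3 p q r s : O p -> O q -> O r -> O s ->
      p * brk q r * X * s - s * brk q r * X * p = 0.
    by move=> Op Oq Or Os; rewrite (h3 p q r s) // e mulN1r opprK subrr.
  apply/subr0_eq; set D := _ - _.
  have -> : D = - (i * j * (k * X * l + l * X * k)) + i * l * (j * X * k + k * X * j)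
    - brk i l * j * X * k - j * l * (i * X * k + k * X * i) + j * k * (i * X * l + l * X * i)
    + (j * brk i k * X * l - l * brk i k * X * j) + brk i j * k * X * l
    + (i * brk k l * X * j - j * brk k l * X * i) + brk j l * i * X * k by rewrite /D; ncr.
  by rewrite !h1 ?h2 ?h3 // !(mulr0, mul0r, addr0, subr0, oppr0).
have e : (-1) ^+ size Z = 1 :> R by rewrite -signr_odd (negbTE sZ).
have {}h2 p q : O p -> O q -> p * X * q - q * X * p = 0.
  by move=> Op Oq; rewrite (h2 p q) // e mul1r subrr.
have {}h3 p q r s : O p -> O q -> O r -> O s ->
    p * brk q r * X * s + s * brk q r * X * p = 0.
  by move=> Op Oq Or Os; rewrite (h3 p q r s) // e mul1r addNr.
apply/subr0_eq; set D := _ - _.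
have -> : D = i * j * (k * X * l - l * X * k) - i * k * (j * X * l - l * X * j)
  + (k * brk i j * X * l + l * brk i j * X * k) + brk i k * j * X * l
  - brk j k * i * X * l - (j * brk i k * X * l + l * brk i k * X * j)
  - brk i j * k * X * l by rewrite /D; ncr.
by rewrite !h1 ?h2 ?h3 // !(mulr0, mul0r, addr0, subr0, oppr0).
Qed.

(** The Pluecker relation between the minors c_ij and a letter, with pairs in between. Without pairs
    it comes from [pfaffian0] and [rel4]. A pair (a,b) is removed with the operator t = ad a ad b:
    on [p,q] it acts as a derivation up to vanishing terms ([step]), on the last letter it
    reproduces the pair ([step2]), and with the induction hypothesis this gives S = -S. *)
Lemma cyclic_left i j l k ss : O i -> O j -> O l -> O k ->
  brk i j * k * pairs ss * l + brk j l * k * pairs ss * i + brk l i * k * pairs ss * j = 0.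
Proof.
move=> Oi Oj Ol Ok; elim: ss i j l Oi Oj Ol => [|[a' b'] ss IH] i j l Oi Oj Ol.
  rewrite pairs_nil !mulr1.
  have -> : brk i j * k * l + brk j l * k * i + brk l i * k * j =
    - (brk k l * brk j i + brk k j * brk i l + brk k i * brk l j)
    + (brk i j * brk k l - brk k l * brk i j) + (brk j l * brk k i - brk k i * brk j l)
    + (brk l i * brk k j - brk k j * brk l i)
    + (brk i j * l + brk j l * i + brk l i * j) * k by ncr.
  rewrite !(comm_brk H) //; try exact: (relOO H).
  by rewrite (rel4 H) // (pfaffian0 H) // mul0r oppr0 !addr0.
pose a := z a'; pose b := z b'; have Oa : O a := Oz a'; have Ob : O b := Oz b'.
pose t x := brk a (brk b x).
have Ot x : O x -> O (t x) by move=> Ox; apply: (relOE H) => //; exact: (relOO H).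
pose F i j l := brk i j * k * pairs ss * l.
have IH' i' j' l' : O i' -> O j' -> O l' -> F i' j' l' + F j' l' i' + F l' i' j' = 0.
  exact: IH.
pose G i j l := brk i j * k * pairs ((a', b') :: ss) * l.
rewrite -/(G i j l) -/(G j l i) -/(G l i j).
have step p q r : O p -> O q -> O r -> G p q r = F (t p) q r + F p (t q) r.
  move=> Op Oq Or; have Ec := relOO H Op Oq.
  rewrite /G (pairs_left_swap H Oz a' b' ss Ok Ec) pairs_cons /= -/a -/b !mulrA.
  rewrite -(absorb_left H Ok Oa Ob Ec) /F -!mulrDl; congr (_ * _ * _ * _).
  have -> : ad2 a b (brk p q) = brk (brk a (brk b p)) q + brk p (brk a (brk b q))
   + (brk (brk b p) (brk a q) + brk (brk a p) (brk b q))
   + (a * brk p q * b + b * brk p q * a) by rewrite /ad2; ncr.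
  have C x y u v : O x -> O y -> O u -> O v -> brk (brk x y) (brk u v) = 0.
    by move=> *; rewrite /brk (comm_brk H) //; exact: (relOO H).
  by rewrite (rel3 H Oa Ec Ob) !C // !addr0.
have step2 p q r : O p -> O q -> O r -> F p q (t r) = G p q r - F p q r * (a * b).
  move=> Op Oq Or; have Ec := relOO H Op Oq.
  have e x : O x -> brk p q * k * pairs ss * brk x r = 0.
    by move=> Ox; rewrite -(adl_left H Oz ss Ok Ec) (odd_pair0 H) //; exact: (E_adl H).
  have -> : G p q r = brk p q * k * pairs ss * a * b * r.
    rewrite /G; have -> : brk p q * k * pairs ss * a * b = brk p q * k * pairs (rcons ss (a', b')).
      by rewrite /pairs -cats1 big_cat big_seq1 !mulrA.
    by congr (_ * _); apply: (pairs_left_perm H) => //; rewrite perm_sym perm_rcons.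
  apply/subr0_eq; set D := _ - _.
  have -> : D = - (brk p q * k * pairs ss * brk a r * b) - brk p q * k * pairs ss * brk b r * a.
    by rewrite /D /F /t; ncr.
  by rewrite !e // !mul0r subr0 oppr0.
apply: (rel_two H); set S := _ + _ + _; suff eS : S = - S by rewrite {1}eS addNr.
rewrite {1}/S !step //.
have -> : F (t i) j l + F i (t j) l + (F (t j) l i + F j (t l) i) + (F (t l) i j + F l (t i) j)
  = (F (t i) j l + F j l (t i) + F l (t i) j) + (F (t j) l i + F l i (t j) + F i (t j) l)
  + (F (t l) i j + F i j (t l) + F j (t l) i) - (F j l (t i) + F l i (t j) + F i j (t l)) by ncr.
rewrite !IH' //; try exact: Ot.
rewrite !add0r !step2 //.
have -> : G j l i - F j l i * (a * b) + (G l i j - F l i j * (a * b)) + (G i j l - F i j l * (a * b))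
  = S - (F i j l + F j l i + F l i j) * (a * b) by rewrite /S; ncr.
by rewrite IH' // mul0r subr0.
Qed.

End EvenLists.

Section Mirror.
Variables (R : pzRingType) (E O : R -> Prop) (H : @weak_rel R E O).
Variable z : nat -> R.
Hypothesis Oz : forall i, O (z i).

Lemma pairs_conv ss :
  @pairs R^c z ss = pairs z (rev [seq (p.2, p.1) | p <- ss]).
Proof.
elim: ss => [|p ss IH]; first by rewrite !pairs_nil.
rewrite pairs_cons IH /= rev_cons /pairs -cats1 big_cat big_seq1 /=.
by [].
Qed.

Lemma cyclic_right i j l k ss : O i -> O j -> O l -> O k ->
  l * pairs z ss * k * brk i j + i * pairs z ss * k * brk j l + j * pairs z ss * k * brk l i = 0.
Proof.
move=> Oi Oj Ol Ok.
pose ss' := [seq (p.2, p.1) | p <- rev ss].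
have := @cyclic_left R^c E O (weak_rel_conv H) z Oz i j l k ss' Oi Oj Ol Ok.
have -> : @pairs R^c z ss' = pairs z ss.
  rewrite pairs_conv /ss' -map_comp map_rev revK.
  by rewrite (@eq_map _ _ _ id) ?map_id // => -[].
rewrite -!(@mulrA R^c) => h.
apply/eqP; rewrite -oppr_eq0; apply/eqP; rewrite -[RHS]h.
change (- (l * pairs z ss * k * brk i j + i * pairs z ss * k * brk j l + j * pairs z ss * k * brk l i) =
  l * pairs z ss * k * (j * i - i * j) + i * pairs z ss * k * (l * j - j * l)
   + j * pairs z ss * k * (i * l - l * i)).
by ncr.
Qed.

End Mirror.

(** Variant for elements whose first entry plays a special role: permutations behind it come from an
    induction on the length, and only swaps of the first two entries remain. *)
Lemma perm_eq_head (T : eqType) (r : seq T -> seq T -> Prop) n :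
  (forall s t u, r s t -> r t u -> r s u) ->
  (forall x s t, size s = n -> perm_eq s t -> r (x :: s) (x :: t)) ->
  (forall x y s, (size s).+1 = n -> r [:: x, y & s] [:: y, x & s]) ->
  forall s t, size s = n.+1 -> perm_eq s t -> r s t.
Proof.
move=> rt rc rsw [|x s] // [|y t] [sz]; first by move/perm_size.
have [<-|neq_xy] := eqVneq x y; first by rewrite perm_cons => /(rc _ _ _ sz).
move=> p_st; have xt : x \in t.
  by have := perm_mem p_st x; rewrite !inE eqxx (negbTE neq_xy) /= => <-.
have p_t := perm_to_rem xt.
have sz_t : (size (rem x t)).+1 = n.
  by have := perm_size p_st; rewrite /= (perm_size p_t) sz => -[<-].
have p_s : perm_eq s (y :: rem x t).
  rewrite -(perm_cons x); apply: perm_trans p_st _.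
  by apply/seq.permP => a /=; rewrite (seq.permP p_t) /= addnCA.
apply: (rt _ _ _ (rc x _ _ sz p_s)); apply: (rt _ _ _ (rsw _ _ _ sz_t)).
by apply: rc => //; rewrite perm_sym.
Qed.

(** * Elements attached to monomials *)

(** At least one even factor is present; the relations of a [family] that permute or reverse pairs
    ask for it. *)
Definition typed (T : seq nat) (cs : seq (nat * nat)) : bool :=
  (T != [::]) || (cs != [::]).

(* e T cs ss I J abstracts a product of the letters y_i (i in T), the commutators
   [z_a,z_b] (cs) and the pairs z_a z_b (ss) whose a0 + b0 remaining odd letters
   contribute p_i (i in I) and q_j (j in J) to its value on generic matrices. *)
Record family (V : zmodType) (a0 b0 : nat)
  (e : seq nat -> seq (nat * nat) -> seq (nat * nat) -> seq nat -> seq nat -> V) : Prop := Family {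
  fam_pos : (0 < a0 + b0)%N;
  fam_perm : forall T T' cs cs' ss ss' I I' J J', typed T cs -> size I = a0 -> size J = b0 ->
    perm_eq T T' -> perm_eq cs cs' -> perm_eq ss ss' -> perm_eq I I' -> perm_eq J J' ->
    e T cs ss I J = e T' cs' ss' I' J';
  fam_ss : forall T cs ss a b I J, typed T cs -> size I = a0 -> size J = b0 ->
    e T cs ((a, b) :: ss) I J = e T cs ((b, a) :: ss) I J;
  fam_cs : forall T cs ss a b I J, size I = a0 -> size J = b0 ->
    e T ((a, b) :: cs) ss I J = - e T ((b, a) :: cs) ss I J;
  fam_exI : forall T cs ss i j k I J, typed T cs -> (size I).+1 = a0 -> size J = b0 ->
    e T ((i, j) :: cs) ss (k :: I) J - e T cs ((i, j) :: ss) (k :: I) J =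
    e T ((k, j) :: cs) ss (i :: I) J - e T cs ((k, j) :: ss) (i :: I) J;
  fam_exJ : forall T cs ss i j k I J, typed T cs -> size I = a0 -> (size J).+1 = b0 ->
    e T ((i, j) :: cs) ss I (k :: J) - e T cs ((i, j) :: ss) I (k :: J) =
    e T ((i, k) :: cs) ss I (j :: J) - e T cs ((i, k) :: ss) I (j :: J);
  fam_plI : forall T cs ss i j k I J, (size I).+1 = a0 -> size J = b0 ->
    e T ((i, j) :: cs) ss (k :: I) J + e T ((j, k) :: cs) ss (i :: I) J
    + e T ((k, i) :: cs) ss (j :: I) J = 0;
  fam_plJ : forall T cs ss i j k I J, size I = a0 -> (size J).+1 = b0 ->
    e T ((i, j) :: cs) ss I (k :: J) + e T ((j, k) :: cs) ss I (i :: J)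
    + e T ((k, i) :: cs) ss I (j :: J) = 0;
  fam_pf : forall T cs ss i j k l I J, size I = a0 -> size J = b0 ->
    e T [:: (i, j), (l, k) & cs] ss I J + e T [:: (j, k), (l, i) & cs] ss I J
    + e T [:: (k, i), (l, j) & cs] ss I J = 0
}.

Section Psi.
Variables (K : fieldType) (V : lmodType K) (a0 b0 : nat).
Variable e : seq nat -> seq (nat * nat) -> seq (nat * nat) -> seq nat -> seq nat -> V.
Hypothesis two_neq0 : 2%:R != 0 :> K.
Hypothesis F : family a0 b0 e.

(* Since 4 p_i q_j = c_ij - s_ij, this is the element whose value has r further
   factors p and q, taken from the heads of I and J. *)
Fixpoint psi (r : nat) T cs ss (I J : seq nat) : V :=
  match r, I, J with
  | 0, _, _ => e T cs ss I J
  | r.+1, i :: I', j :: J' =>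
    4%:R^-1 *: (psi r T ((i, j) :: cs) ss I' J' - psi r T cs ((i, j) :: ss) I' J')
  | _, _, _ => 0
  end.

Lemma typed_cons T p cs : typed T (p :: cs).
Proof. by rewrite /typed orbT. Qed.

Lemma psi_perm_state r T T' cs cs' ss ss' I J : typed T cs ->
  size I = (r + a0)%N -> size J = (r + b0)%N ->
  perm_eq T T' -> perm_eq cs cs' -> perm_eq ss ss' -> psi r T cs ss I J = psi r T' cs' ss' I J.
Proof.
move=> t sI sJ pT pc ps; elim: r cs cs' ss ss' I J t sI sJ pc ps => [|r IH] cs cs' ss ss' I J t sI sJ pc ps.
  exact: (fam_perm F).
case: I sI => [|i I] //= [sI]; case: J sJ => [|j J] //= [sJ].
congr (_ *: (_ - _)); apply: IH; rewrite ?typed_cons ?perm_cons //.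
Qed.

Lemma psi_ss r T cs ss a b I J : typed T cs -> size I = (r + a0)%N -> size J = (r + b0)%N ->
  psi r T cs ((a, b) :: ss) I J = psi r T cs ((b, a) :: ss) I J.
Proof.
elim: r cs ss I J => [|r IH] cs ss I J t sI sJ; first exact: (fam_ss F).
case: I sI => [|i I] //= [sI]; case: J sJ => [|j J] //= [sJ].
rewrite IH ?typed_cons //; congr (_ *: (_ - _)).
have sw p q : perm_eq [:: p, q & ss] [:: q, p & ss].
  by apply/seq.permP => x /=; rewrite addnCA.
by rewrite (psi_perm_state t sI sJ (perm_refl T) (perm_refl cs) (sw _ _)) IH //
  (psi_perm_state t sI sJ (perm_refl T) (perm_refl cs) (sw _ _)).
Qed.

Lemma perm_swap2 (X : eqType) (p q : X) s : perm_eq [:: p, q & s] [:: q, p & s].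
Proof. by apply/seq.permP => x /=; rewrite addnCA. Qed.

Lemma psi_cs r T cs ss a b I J : size I = (r + a0)%N -> size J = (r + b0)%N ->
  psi r T ((a, b) :: cs) ss I J = - psi r T ((b, a) :: cs) ss I J.
Proof.
elim: r cs ss I J => [|r IH] cs ss I J sI sJ; first exact: (fam_cs F).
case: I sI => [|i I] //= [sI]; case: J sJ => [|j J] //= [sJ].
rewrite IH // -scalerN opprB opprK addrC; congr (_ *: (_ + _)).
rewrite !(psi_perm_state (typed_cons _ _ _) sI sJ (perm_refl T) (perm_swap2 (i, j) _ cs) (perm_refl ss)).
by rewrite IH.
Qed.

(** Immediate from the definition: the factors c_ij - s_ij and c_i'j' - s_i'j' merely change places
    in [cs] and [ss]. *)
Lemma psi_sim r T cs ss i i' j j' I J : typed T cs ->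
  size I = (r + a0)%N -> size J = (r + b0)%N ->
  psi r.+2 T cs ss [:: i, i' & I] [:: j, j' & J] =
  psi r.+2 T cs ss [:: i', i & I] [:: j', j & J].
Proof.
move=> t sI sJ /=; congr (_ *: _); rewrite -!scalerBr; congr (_ *: _).
rewrite !opprB !addrA.
rewrite (psi_perm_state (typed_cons _ _ _) sI sJ (perm_refl T) (perm_swap2 (i, j) _ cs) (perm_refl ss)).
rewrite (psi_perm_state t sI sJ (perm_refl T) (perm_refl cs) (perm_swap2 (i, j) _ ss)).
rewrite addrAC [in RHS]addrAC; congr (_ + _); exact: addrAC.
Qed.

(** Tails are permuted by induction, so only swapping the first two entries of one list remains.
    With one factor to consume this is an exchange axiom of the family; with more, [psi_sim] swaps
    the heads of both lists at once and the effect on the other list has to be undone. *)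
Lemma psi_perm r T cs ss I I' J J' : typed T cs -> size I = (r + a0)%N -> size J = (r + b0)%N ->
  perm_eq I I' -> perm_eq J J' -> psi r T cs ss I J = psi r T cs ss I' J'.
Proof.
elim: r T cs ss I I' J J' => [|r IH] T cs ss I I' J J' t sI sJ pI pJ.
  exact: (fam_perm F).
have tailI i s s' J1 : size s = (r + a0)%N -> size J1 = (r.+1 + b0)%N -> perm_eq s s' ->
    psi r.+1 T cs ss (i :: s) J1 = psi r.+1 T cs ss (i :: s') J1.
  case: J1 => [|j J1] //= ss' [sJ1] p.
  by congr (_ *: (_ - _)); apply: IH; rewrite ?typed_cons.
have tailJ j s s' I1 : size s = (r + b0)%N -> size I1 = (r.+1 + a0)%N -> perm_eq s s' ->
    psi r.+1 T cs ss I1 (j :: s) = psi r.+1 T cs ss I1 (j :: s').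
  case: I1 => [|i I1] //= ss' [sI1] p.
  by congr (_ *: (_ - _)); apply: IH; rewrite ?typed_cons.
have swI i i' s J1 : (size s).+1 = (r + a0)%N -> size J1 = (r.+1 + b0)%N ->
    psi r.+1 T cs ss [:: i, i' & s] J1 = psi r.+1 T cs ss [:: i', i & s] J1.
  case: r IH tailI tailJ {sI sJ} => [|r] IH tailI tailJ.
    case: J1 => [|j J1] // ss' [sJ1]; rewrite /=; congr (_ *: _); exact: (fam_exI F).
  case: J1 => [|j [|j' J1]] // [ss'] [sJ1].
  set f := psi r.+2 T cs ss in tailI tailJ *.
  have sim i1 i2 s1 j1 j2 s2 : size s1 = (r + a0)%N -> size s2 = (r + b0)%N ->
      f [:: i1, i2 & s1] [:: j1, j2 & s2] = f [:: i2, i1 & s1] [:: j2, j1 & s2].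
    by move=> *; apply: psi_sim.
  (* With a third letter k in I, three tail swaps in I and two uses of [sim] swap i and i', while j
     and j' are swapped twice. If I has no third letter, [fam_pos] provides one in J: three tail
     swaps there and three uses of [sim] restore J and swap I an odd number of times. *)
  case: s ss' => [|k s] ss'.
    have /andP[/eqP r_0 /eqP a_0] : (r == 0%N) && (a0 == 0%N) by rewrite -addn_eq0 -ss'.
    case: J1 sJ1 => [|l J1] sJ1.
      by move: (fam_pos F); rewrite a_0 (_ : b0 = 0%N) //; move: sJ1; rewrite r_0.
    have sw (x y : nat) t0 := perm_swap2 x y t0.
    have z1 x y : size [:: x, y & J1] = (r.+1 + b0)%N by rewrite -[RHS]/(r + b0).+1 -sJ1.
    have z2 : (size [:: i; i']) = (r.+2 + a0)%N by rewrite r_0 a_0.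
    have z2' : (size [:: i'; i]) = (r.+2 + a0)%N by rewrite r_0 a_0.
    rewrite (tailJ j _ _ _ (z1 _ _) z2 (sw j' l J1)) [LHS]sim // (tailJ l _ _ _ (z1 _ _) z2' (sw j j' J1)).
    by rewrite [LHS]sim // (tailJ j' _ _ _ (z1 _ _) z2 (sw l j J1)) [LHS]sim.
  have sw (x y : nat) t0 := perm_swap2 x y t0.
  have z1 x y : size [:: x, y & s] = (r.+1 + a0)%N by rewrite -[RHS]/(r + a0).+1 -ss'.
  have z2 x y : (size [:: x, y & J1]) = (r.+2 + b0)%N by rewrite -[RHS]/(r + b0).+2 -sJ1.
  rewrite (tailI i _ _ _ (z1 _ _) (z2 _ _) (sw i' k s)) [LHS]sim // (tailI k _ _ _ (z1 _ _) (z2 _ _) (sw i i' s)).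
  by rewrite [LHS]sim // (tailI i' _ _ _ (z1 _ _) (z2 _ _) (sw k i s)).
have swJ j j' s I1 : (size s).+1 = (r + b0)%N -> size I1 = (r.+1 + a0)%N ->
    psi r.+1 T cs ss I1 [:: j, j' & s] = psi r.+1 T cs ss I1 [:: j', j & s].
  case: r IH tailI tailJ swI {sI sJ} => [|r] IH tailI tailJ swI.
    case: I1 => [|i I1] // ss' [sI1]; rewrite /=; congr (_ *: _); exact: (fam_exJ F).
  case: I1 => [|i [|i' I1]] // [ss'] [sI1].
  by rewrite (psi_sim _ _ _ _ _ t) // swI //= ?sI1 ?ss'.
have e1 : psi r.+1 T cs ss I J = psi r.+1 T cs ss I' J.
  apply: (@perm_eq_head _ (fun s t => psi r.+1 T cs ss s J = psi r.+1 T cs ss t J) (r + a0)) => //.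
  - by move=> s t' u -> ->.
  - by move=> x s t' ss' p; apply: tailI.
  - by move=> x y s ss'; apply: swI.
rewrite e1; apply: (@perm_eq_head _ (fun s t => psi r.+1 T cs ss I' s = psi r.+1 T cs ss I' t) (r + b0)) => //.
- by move=> s t' u -> ->.
- by move=> x s t' ss' p; apply: tailJ; rewrite -?(perm_size pI).
- by move=> x y s ss'; apply: swJ; rewrite -?(perm_size pI).
Qed.

Lemma scaler_quarter2 (u : V) : 2%:R *: (4%:R^-1 *: (u + u)) = u.
Proof.
rewrite -mulr2n -scaler_nat !scalerA -[4%N]/(2 * 2)%N natrM invfM !mulrA.
by rewrite mulfV // mul1r mulVf // scale1r.
Qed.

Lemma psi_S r T cs ss a b I J : typed T cs -> size I = (r + a0)%N -> size J = (r + b0)%N ->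
  psi r T cs ((a, b) :: ss) I J =
  - (2%:R *: (psi r.+1 T cs ss (a :: I) (b :: J) + psi r.+1 T cs ss (b :: I) (a :: J))).
Proof.
move=> t sI sJ; rewrite -[LHS]scaler_quarter2 /= -scalerDr -!scalerN; congr (_ *: (_ *: _)).
rewrite (psi_cs _ _ _ a b) // -(psi_ss _ a b) // opprD !opprB opprK.
by rewrite addrACA subrr addr0.
Qed.

Lemma psi_C r T cs ss a b I J : typed T cs -> size I = (r + a0)%N -> size J = (r + b0)%N ->
  psi r T ((a, b) :: cs) ss I J =
  2%:R *: (psi r.+1 T cs ss (a :: I) (b :: J) - psi r.+1 T cs ss (b :: I) (a :: J)).
Proof.
move=> t sI sJ; rewrite -[LHS]scaler_quarter2 /= -scalerBr; congr (_ *: (_ *: _)).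
rewrite (psi_cs _ _ _ b a) // (psi_ss _ b a) // opprB opprK.
by rewrite addrA subrK.
Qed.

Definition cyc (f : nat -> nat -> nat -> V) i j k := f i j k + f j k i + f k i j.

Lemma addrB3 (x y x' y' x'' y'' : V) :
  (x - y) + (x' - y') + (x'' - y'') = (x + x' + x'') - (y + y' + y'').
Proof. by rewrite (addrACA x) (addrACA (x + x')) -!opprD. Qed.

(** Cyclic relations lift to every r, since [psi] multiplies the three terms by the same factors.
    The varying letters are appended at the ends of I and J, where the recursion, which leaves a0
    and b0 letters, never reaches them. *)
Lemma psi_cyc r T cs ss I J i j k (g : nat -> seq (nat * nat)) (gI gJ : nat -> seq nat) na nb :
  (na <= a0)%N -> (nb <= b0)%N -> (forall k, size (gI k) = na) -> (forall k, size (gJ k) = nb) ->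
  (forall cs ss I J, (size I + na)%N = a0 -> (size J + nb)%N = b0 ->
    cyc (fun i j k => e T ((i, j) :: g k ++ cs) ss (I ++ gI k) (J ++ gJ k)) i j k = 0) ->
  (size I + na)%N = (r + a0)%N -> (size J + nb)%N = (r + b0)%N ->
  cyc (fun i j k => psi r T ((i, j) :: g k ++ cs) ss (I ++ gI k) (J ++ gJ k)) i j k = 0.
Proof.
move=> na_le nb_le sgI sgJ h; elim: r cs ss I J => [|r IH] cs ss I J sI sJ; first exact: h.
case: I sI => [|i' I] sI; first by move: na_le; rewrite -[na]add0n sI /= addSn ltnNge leq_addl.
case: J sJ => [|j' J] sJ; first by move: nb_le; rewrite -[nb]add0n sJ /= addSn ltnNge leq_addl.
case: sI sJ => [sI] [sJ].
have sI' q : size (I ++ gI q) = (r + a0)%N by rewrite size_cat sgI.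
have sJ' q : size (J ++ gJ q) = (r + b0)%N by rewrite size_cat sgJ.
have ep p q : perm_eq ((i', j') :: p :: g q ++ cs) (p :: g q ++ (i', j') :: cs).
  by rewrite (perm_catCA [:: (i', j')] [:: p]) perm_cons (perm_catCA [:: _] (g q) cs).
have ps p q ss' := psi_perm_state (typed_cons T _ _) (sI' q) (sJ' q) (perm_refl T) (ep p q) (perm_refl ss').
rewrite /cyc /= !ps -!scalerDr -[RHS](scaler0 _ 4%:R^-1); congr (_ *: _).
rewrite addrB3.
have := IH ((i', j') :: cs) ss I J sI sJ; have := IH cs ((i', j') :: ss) I J sI sJ.
by rewrite /cyc => -> ->; rewrite subrr.
Qed.

Lemma psi_pf r T cs ss I J i j k l : size I = (r + a0)%N -> size J = (r + b0)%N ->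
  cyc (fun i j k => psi r T [:: (i, j), (l, k) & cs] ss I J) i j k = 0.
Proof.
move=> sI sJ; have := @psi_cyc r T cs ss I J i j k (fun k => [:: (l, k)]) (fun=> [::]) (fun=> [::]) 0 0.
rewrite !cats0 !addn0; apply=> // cs' ss' I' J'; rewrite !addn0 !cats0 => sI' sJ'.
exact: (fam_pf F).
Qed.

Let plI r T cs ss i j k I J := cyc (fun i j k => psi r T ((i, j) :: cs) ss (k :: I) J) i j k = 0.
Let plJ r T cs ss i j k I J := cyc (fun i j k => psi r T ((i, j) :: cs) ss I (k :: J)) i j k = 0.

Lemma psi_plI_base r T cs ss i j k I J : (0 < a0)%N ->
  (size I).+1 = (r + a0)%N -> size J = (r + b0)%N -> plI r T cs ss i j k I J.
Proof.
move=> a0_gt0 sI sJ.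
have := @psi_cyc r T cs ss I J i j k (fun=> [::]) (fun k => [:: k]) (fun=> [::]) 1 0.
rewrite !addn1 !addn0 => /(_ a0_gt0 (leq0n _) (fun=> erefl) (fun=> erefl)) h.
rewrite /plI -[RHS]h //; last first.
  move=> cs' ss' I' J' /=; rewrite !addn1 !addn0 !cats0 => sI' sJ'.
  rewrite -[RHS](fam_plI F T cs' ss' i j k sI' sJ'); congr (_ + _ + _);
    apply: (fam_perm F); rewrite ?typed_cons ?size_cat ?addn1 // cats1 perm_rcons perm_refl //.
rewrite /cyc /= !cats0; congr (_ + _ + _); apply: psi_perm => //;
  by rewrite ?typed_cons // cats1 perm_sym perm_rcons perm_refl.
Qed.

Lemma psi_plJ_base r T cs ss i j k I J : (0 < b0)%N ->
  size I = (r + a0)%N -> (size J).+1 = (r + b0)%N -> plJ r T cs ss i j k I J.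
Proof.
move=> b0_gt0 sI sJ.
have := @psi_cyc r T cs ss I J i j k (fun=> [::]) (fun=> [::]) (fun k => [:: k]) 0 1.
rewrite !addn1 !addn0 => /(_ (leq0n _) b0_gt0 (fun=> erefl) (fun=> erefl)) h.
rewrite /plJ -[RHS]h //; last first.
  move=> cs' ss' I' J' /=; rewrite !addn1 !addn0 !cats0 => sI' sJ'.
  rewrite -[RHS](fam_plJ F T cs' ss' i j k sI' sJ'); congr (_ + _ + _);
    apply: (fam_perm F); rewrite ?typed_cons ?size_cat ?addn1 // cats1 perm_rcons perm_refl //.
rewrite /cyc /= !cats0; congr (_ + _ + _); apply: psi_perm => //;
  by rewrite ?typed_cons // cats1 perm_sym perm_rcons perm_refl.
Qed.

(* Expanding the Pfaffian relation in one commutator exchanges the two Pluecker relations. *)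
Lemma psi_pl_exchange r T cs ss i j k l I J :
  size I = (r + a0)%N -> size J = (r + b0)%N ->
  plI r.+1 T cs ss i j k I (l :: J) <-> plJ r.+1 T cs ss i j k (l :: I) J.
Proof.
move=> sI sJ; have := psi_pf T cs ss i j k l sI sJ.
have ex p q m : psi r T [:: (p, q), (l, m) & cs] ss I J =
    2%:R *: (psi r.+1 T ((p, q) :: cs) ss (l :: I) (m :: J) -
      psi r.+1 T ((p, q) :: cs) ss (m :: I) (l :: J)).
  rewrite -psi_C ?typed_cons //; apply: psi_perm_state; rewrite ?typed_cons //.
  exact: perm_swap2.
rewrite /cyc !ex -!scalerDr addrB3 /plI /plJ /cyc.
move/eqP; rewrite scaler_eq0 (negbTE two_neq0) /= subr_eq0 => /eqP ->.
by [].
Qed.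

(** For a0 = 0 no letter p is left at the end of the recursion to carry the relation; then b0 > 0,
    and [psi_pl_exchange] transfers the relation for q. *)
Lemma psi_plI r T cs ss i j k I J :
  (size I).+1 = (r + a0)%N -> size J = (r + b0)%N -> plI r T cs ss i j k I J.
Proof.
move=> sI sJ; have [a0_gt0|] := ltnP 0 a0; first exact: psi_plI_base.
rewrite leqn0 => /eqP a_0; case: r sI sJ => [|r]; first by rewrite a_0.
case: J => [|l J] // [sI] [sJ]; apply/psi_pl_exchange => //.
apply: psi_plJ_base => //=; rewrite ?sI ?sJ ?addSn //.
by have := fam_pos F; rewrite a_0.
Qed.

Lemma psi_plJ r T cs ss i j k I J :
  size I = (r + a0)%N -> (size J).+1 = (r + b0)%N -> plJ r T cs ss i j k I J.
Proof.
move=> sI sJ; have [b0_gt0|] := ltnP 0 b0; first exact: psi_plJ_base.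
rewrite leqn0 => /eqP b_0; case: r sI sJ => [|r]; first by rewrite b_0.
case: I => [|l I] // [sI] [sJ]; apply/psi_pl_exchange => //.
apply: psi_plI_base => //=; rewrite ?sI ?sJ ?addSn //.
by have := fam_pos F; rewrite b_0 addn0.
Qed.

End Psi.

(** * Integration of a closed system of exchange differences *)

Section Potential.
Variable V : zmodType.

(* A discrete Poincare lemma: a closed form A is the difference of the values of
   the potential when i and j are exchanged between s and t. Without letters y_i at
   least one commutator must be kept, and this recovers psi from such elements. *)
Fixpoint potential (c : seq nat) (A : nat -> nat -> seq nat -> seq nat -> V) (s t : seq nat) : V :=
  if c is m :: c' then
    let A' i j s t := A i j (m :: s) t in
    if m \in s then potential c' A' (rem m s) t
    else if s is i :: s' then potential c' A' s' (i :: rem m t) + A i m s' (rem m t)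
    else 0
  else 0.

(** The letters of c are distributed over a list of p-letters, of length a, and one of q-letters.
    [cf_left] and [cf_right] say that the prescribed differences add up to zero around a triangle of
    exchanges of i, j, k, the third letter staying among the p-letters, resp. the q-letters. *)
Record closed_form (c : seq nat) (a : nat) (A : nat -> nat -> seq nat -> seq nat -> V) : Prop := ClosedForm {
  cf_perm : forall i j s s' t t', perm_eq [:: i, j & s ++ t] c -> (size s).+1 = a ->
    perm_eq s s' -> perm_eq t t' -> A i j s t = A i j s' t';
  cf_anti : forall i j s t, perm_eq [:: i, j & s ++ t] c -> (size s).+1 = a ->
    A i j s t = - A j i s t;
  cf_diag : forall i s t, perm_eq [:: i, i & s ++ t] c -> (size s).+1 = a -> A i i s t = 0;
  cf_left : forall i j k s t, perm_eq [:: i, j, k & s ++ t] c -> (size s).+2 = a ->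
    A i j (k :: s) t + A j k (i :: s) t + A k i (j :: s) t = 0;
  cf_right : forall i j k s t, perm_eq [:: i, j, k & s ++ t] c -> (size s).+1 = a ->
    A i j s (k :: t) + A j k s (i :: t) + A k i s (j :: t) = 0
}.

Lemma closed_form_tail m c a A :
  closed_form (m :: c) a.+1 A -> closed_form c a (fun i j s t => A i j (m :: s) t).
Proof.
case=> hp ha hd hl hr; split.
- move=> i j s s' t t' p sz ps pt; apply: hp; rewrite /= ?sz ?perm_cons //.
  by apply/seq.permP => x; move/seq.permP/(_ x): p; rewrite /= !count_cat /=; clear; lia.
- move=> i j s t p sz; apply: ha; rewrite /= ?sz //.
  by apply/seq.permP => x; move/seq.permP/(_ x): p; rewrite /= !count_cat /=; clear; lia.
- move=> i s t p sz; apply: hd; rewrite /= ?sz //.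
  by apply/seq.permP => x; move/seq.permP/(_ x): p; rewrite /= !count_cat /=; clear; lia.
- move=> i j k s t p sz.
  have pm x y w : perm_eq [:: x, y, w & s ++ t] c ->
      A x y [:: m, w & s] t = A x y [:: w, m & s] t.
    move=> pq; apply: hp; rewrite /= ?sz ?perm_refl // ?perm_swap2 //.
    by apply/seq.permP => z; move/seq.permP/(_ z): pq; rewrite /= !count_cat /=; clear; lia.
  rewrite !pm ?hl //= ?sz //; apply/seq.permP => z; move/seq.permP/(_ z): p; rewrite /= !count_cat /=; clear; lia.
- move=> i j k s t p sz; apply: hr; rewrite /= ?sz //.
  by apply/seq.permP => x; move/seq.permP/(_ x): p; rewrite /= !count_cat /=; clear; lia.
Qed.

Ltac count_perm h :=
  let x := fresh "x" in
  apply/seq.permP => x; move: (seq.permP h x); rewrite /= ?count_cat /= ?count_cat /=; clear; lia.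

Lemma potential_spec c a A : closed_form c a A ->
  (forall s s' t t', perm_eq (s ++ t) c -> size s = a -> perm_eq s s' -> perm_eq t t' ->
    potential c A s t = potential c A s' t') /\
  (forall i j s t, perm_eq [:: i, j & s ++ t] c -> (size s).+1 = a ->
    potential c A (i :: s) (j :: t) - potential c A (j :: s) (i :: t) = A i j s t).
Proof.
elim: c a A => [|m c IH] a A cA; first by split=> // i j s t /perm_size.
case: a cA => [|a] cA.
  split=> // -[|//] s' t t' _ _; rewrite perm_sym => /perm_nilP -> _ //=.
have cA' := closed_form_tail cA; have [IH1 IH2] := IH _ _ cA'.
have [hp ha hd hl hr] := cA.
set A' := fun i j s t => A i j (m :: s) t in cA' IH1 IH2.
(* The value when m is a q-letter: i changes places with m, which puts m among the p-letters, where
   the potential for the shorter list applies. *)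
pose G i s t := potential c A' s (i :: t) + A i m s t.
have left s s0 t : perm_eq (s ++ t) (m :: c) -> size s = a.+1 -> perm_eq s (m :: s0) ->
    potential (m :: c) A s t = potential c A' s0 t.
  move=> p sz ps; rewrite /= (perm_mem ps) inE eqxx /=; apply: IH1 => //.
  - have pr : perm_eq s (m :: rem m s) by apply: perm_to_rem; rewrite (perm_mem ps) inE eqxx.
    rewrite -(perm_cons m); apply: perm_trans p; rewrite -cat_cons perm_cat2r perm_sym //.
  - by rewrite size_rem ?sz // (perm_mem ps) inE eqxx.
  - rewrite -(perm_cons m); apply: (perm_trans _ ps); rewrite perm_sym.
    by apply: perm_to_rem; rewrite (perm_mem ps) inE eqxx.
(* The letter chosen to change places with m does not matter: two choices differ by the triangle i,
   i', m, which closes by [cf_left]. *)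
have Gperm i i' s s' t t' : perm_eq (i :: s ++ t) c -> size s = a ->
    perm_eq (i :: s) (i' :: s') -> perm_eq t t' -> G i s t = G i' s' t'.
  move=> p sz ps pt; have [ii|ii] := eqVneq i i'.
    subst i'; rewrite perm_cons in ps; congr (_ + _).
      by apply: IH1; rewrite ?perm_cons //; count_perm p.
    by apply: hp; rewrite ?sz // ; count_perm p.
  have i's : i' \in s by have := perm_mem ps i'; rewrite !inE eqxx eq_sym (negbTE ii).
  set s2 := rem i' s; have ps2 : perm_eq s (i' :: s2) := perm_to_rem i's.
  have ps2' : perm_eq s' (i :: s2) by apply/seq.permP => x; move: (seq.permP ps x) (seq.permP ps2 x) => /=; clear; lia.
  have sz2 : (size s2).+1 = a by rewrite -sz (perm_size ps2).
  have -> : G i s t = potential c A' (i' :: s2) (i :: t) + A i m (i' :: s2) t.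
    congr (_ + _); first by apply: IH1 => //; count_perm p.
    by apply: hp; rewrite ?sz //; count_perm p.
  have p2 : perm_eq [:: i, i' & s2 ++ t] c.
    by apply/seq.permP => x; move: (seq.permP p x) (seq.permP ps2 x); rewrite /= !count_cat /=; clear; lia.
  have -> : G i' s' t' = potential c A' (i :: s2) (i' :: t) + A i' m (i :: s2) t.
    have sz' : size s' = a by have := perm_size ps => /= -[<-].
    have p' : perm_eq (i' :: s' ++ t') c.
      by apply/seq.permP => x; move: (seq.permP p x) (seq.permP ps x) (seq.permP pt x); rewrite /= !count_cat /=; clear; lia.
    congr (_ + _).
      by apply: IH1; rewrite ?perm_cons // perm_sym //; count_perm p'.
    by apply: hp; rewrite ?sz' // 1?perm_sym //; count_perm p'.
  have p2' : perm_eq [:: i', i & s2 ++ t] c by count_perm p2.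
  have /eqP := IH2 _ _ _ _ p2' sz2; rewrite subr_eq => /eqP ->.
  have p3 : perm_eq [:: i', i, m & s2 ++ t] (m :: c) by count_perm p2.
  have := hl _ _ _ _ _ p3 (f_equal S sz2); rewrite (ha m i') /= ?sz2 //; last by count_perm p3.
  by move/eqP; rewrite subr_eq0 => /eqP <-; rewrite /A' addrAC [in RHS]addrC.
have right i s s1 t t0 : perm_eq (s ++ t) (m :: c) -> size s = a.+1 -> m \notin s ->
    perm_eq s (i :: s1) -> perm_eq t (m :: t0) -> potential (m :: c) A s t = G i s1 t0.
  move=> p sz ms ps pt; rewrite /= (negbTE ms); case: s p sz ms ps => [|i' s'] // p [sz] ms ps.
  have mt : m \in t by rewrite (perm_mem pt) inE eqxx.
  have pr := perm_to_rem mt.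
  have p' : perm_eq (i' :: s' ++ rem m t) c.
    by apply/seq.permP => x; move: (seq.permP p x) (seq.permP pr x); rewrite /= !count_cat /=; clear; lia.
  apply: Gperm => //; apply/seq.permP => x; move: (seq.permP pt x) (seq.permP pr x) => /=; clear; lia.
split=> [s s' t t' p sz ps pt|i j s t p sz].
  have p' : perm_eq (s' ++ t') (m :: c).
    by apply/seq.permP => x; move: (seq.permP p x) (seq.permP ps x) (seq.permP pt x); rewrite /= !count_cat /=; clear; lia.
  have [ms|ms] := boolP (m \in s).
    have pr := perm_to_rem ms.
    rewrite (left _ _ _ p sz pr) (left s' (rem m s)) -?(perm_size ps) //; first last.
      by apply/seq.permP => x; move: (seq.permP ps x) (seq.permP pr x) => /=; clear; lia.
    apply: IH1 => //; last by rewrite size_rem // sz.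
    by apply/seq.permP => x; move: (seq.permP p x) (seq.permP pr x); rewrite /= !count_cat /=; clear; lia.
  have ms' : m \notin s' by rewrite -(perm_mem ps).
  have mt : m \in t by have := perm_mem p m; rewrite mem_cat (negbTE ms) inE eqxx.
  case: s p sz ms ps => [|i s] // p sz ms ps.
  rewrite (right i _ s _ _ p sz ms (perm_refl _) (perm_to_rem mt)) (right i s' s t' (rem m t)) //.
  - by rewrite -(perm_size ps).
  - by rewrite perm_sym.
  - by rewrite perm_sym (perm_trans _ pt) // perm_sym perm_to_rem.
have [ms|ms] := boolP (m \in s).
  have pr := perm_to_rem ms.
  have e x y : perm_eq (x :: y :: s ++ t) (m :: c) -> potential (m :: c) A (x :: s) (y :: t) = potential c A' (x :: rem m s) (y :: t).
    move=> q; apply: left; rewrite /= ?sz //; first by count_perm q.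
    by apply/seq.permP => w; move: (seq.permP pr w) => /=; clear; lia.
  rewrite !e //; last by count_perm p.
  have sr : (size (rem m s)).+1 = a by have := perm_size pr; rewrite /= => <-; case: sz.
  rewrite IH2 //; last first.
    by apply/seq.permP => x; move: (seq.permP p x) (seq.permP pr x); rewrite /= !count_cat /=; clear; lia.
  rewrite /A'; apply: hp; rewrite 1?perm_sym //= ?sr //.
  by apply/seq.permP => x; move: (seq.permP p x) (seq.permP pr x); rewrite /= !count_cat /=; clear; lia.
have szx x : size (x :: s) = a.+1 by rewrite -[LHS]/(size s).+1 sz.
have [ij|ij] := eqVneq i j; first by subst j; rewrite subrr hd.
have [jm|jm] := eqVneq j m.
  subst j; rewrite (right i (i :: s) s (m :: t) t) ?szx ?perm_refl //; first last.
  - by rewrite inE negb_or eq_sym ij.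
  - by count_perm p.
  rewrite (left (m :: s) s) ?szx ?perm_refl //; last by count_perm p.
  by rewrite /G addrAC subrr add0r.
have [im|im] := eqVneq i m.
  subst i; rewrite (left (m :: s) s) ?szx ?perm_refl //; last by count_perm p.
  rewrite (right j (j :: s) s (m :: t) t) ?szx ?perm_refl //; first last.
  - by rewrite inE negb_or ij.
  - by count_perm p.
  by rewrite /G opprD addrA subrr add0r (ha _ _ _ _ p sz).
have mt : m \in t.
  by have := perm_mem p m; rewrite !inE mem_cat eqxx (negbTE ms) ![m == _]eq_sym (negbTE im) (negbTE jm).
set t0 := rem m t; have pr := perm_to_rem mt; rewrite -/t0 in pr.
rewrite (right i (i :: s) s (j :: t) (j :: t0)) ?szx ?perm_refl //; first last.
- by apply/seq.permP => x; move: (seq.permP pr x) => /=; clear; lia.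
- by rewrite inE negb_or eq_sym im.
- by count_perm p.
rewrite (right j (j :: s) s (i :: t) (i :: t0)) ?szx ?perm_refl //; first last.
- by apply/seq.permP => x; move: (seq.permP pr x) => /=; clear; lia.
- by rewrite inE negb_or eq_sym jm.
- by count_perm p.
have p3 : perm_eq [:: i, j, m & s ++ t0] (m :: c).
  by apply/seq.permP => x; move: (seq.permP p x) (seq.permP pr x); rewrite /= !count_cat /=; clear; lia.
have p4 : perm_eq [:: i, m & s ++ (j :: t0)] (m :: c) by count_perm p3.
rewrite (hp i j _ s _ (m :: t0) p sz (perm_refl _) pr).
(* Here m is a q-letter different from i and j. Both values are reached through m, and the triangle
   closes by [cf_right]. *)
have := hr _ _ _ _ _ p3 sz; rewrite (ha m i) //; last by count_perm p3.
move/eqP; rewrite subr_eq0 => /eqP e.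
rewrite /G opprD addrACA.
have -> : potential c A' s [:: i, j & t0] = potential c A' s [:: j, i & t0].
  apply: IH1; rewrite ?perm_refl ?perm_swap2 //; last by case: sz.
  by rewrite -(perm_cons m); count_perm p3.
by rewrite subrr add0r -e addrK.
Qed.
End Potential.

(** * Expansion along independent monomials *)

Lemma sum_by_value (S : eqType) (K : pzRingType) (V : lmodType K) (ks : seq (K * S)) (psi : S -> V) :
  \sum_(k <- ks) k.1 *: psi k.2 =
  \sum_(s <- undup [seq k.2 | k <- ks]) (\sum_(k <- ks | k.2 == s) k.1) *: psi s.
Proof.
under [RHS]eq_bigr => s _.
  rewrite scaler_suml.
  over.
rewrite (exchange_big_dep xpredT) //= big_seq [RHS]big_seq; apply: eq_bigr => k kks.
rewrite -big_filter (eq_filter (a2 := pred1 k.2)) => [|s]; last exact: eq_sym.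
by rewrite filter_pred1_uniq ?undup_uniq ?big_seq1 // mem_undup map_f.
Qed.

(** Artin's argument: translating the relation by an x0 that separates s from the first character,
    and subtracting a multiple of the original relation, removes that character. Characters may be
    repeated, so their coefficients are summed. *)
Lemma dedekind (K : fieldType) (X : Type) (S : eqType) (chi : S -> X -> K)
    (mul : X -> X -> X) (one : X) (ks : seq (K * S)) :
  (forall s x y, chi s (mul x y) = chi s x * chi s y) -> (forall s, chi s one = 1) ->
  (forall s s', s \in [seq k.2 | k <- ks] -> s' \in [seq k.2 | k <- ks] -> s != s' ->
    exists x, chi s x != chi s' x) ->
  (forall x, \sum_(k <- ks) k.1 * chi k.2 x = 0) ->
  forall s, \sum_(k <- ks | k.2 == s) k.1 = 0.
Proof.
move=> chiM chi1; have [n] := ubnP (size ks); elim: n ks => // n IH [|[a s0] ks].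
  by move=> _ _ _ s; rewrite big_nil.
rewrite ltnS => lt_n sep sum0.
have sum_other s : s != s0 -> \sum_(k <- ks | k.2 == s) k.1 = 0.
  move=> ss0; have [sks|sks] := boolP (s \in [seq k.2 | k <- ks]); last first.
    rewrite big_seq_cond big1 // => k /andP[kks /eqP ks_s].
    by rewrite -ks_s map_f in sks.
  have [x0 neq0] : exists x, chi s x != chi s0 x.
    by apply: sep => //; rewrite /= in_cons ?sks ?eqxx ?orbT.
  pose g (k : K * S) := (k.1 * (chi k.2 x0 - chi s0 x0), k.2).
  have mg : [seq k.2 | k <- map g ks] = [seq k.2 | k <- ks] by rewrite -map_comp.
  have := IH (map g ks) _ _ _ s; rewrite size_map mg.
  have h1 : forall s1 s2, s1 \in [seq k.2 | k <- ks] -> s2 \in [seq k.2 | k <- ks] ->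
      s1 != s2 -> exists x, chi s1 x != chi s2 x.
    by move=> s1 s2 h1 h2; apply: sep; rewrite /= in_cons ?h1 ?h2 orbT.
  have h2 x : \sum_(k <- map g ks) k.1 * chi k.2 x = 0.
    rewrite big_map /=.
    have := sum0 (mul x0 x); rewrite big_cons /= chiM => e1.
    have := sum0 x; rewrite big_cons /= => e2.
    under eq_bigr do rewrite mulrBr mulrBl.
    rewrite big_split /= sumrN.
    under eq_bigr do rewrite -mulrA -chiM.
    have -> : \sum_(k <- ks) k.1 * chi k.2 (mul x0 x) = - (a * (chi s0 x0 * chi s0 x)).
      by apply/eqP; rewrite -addr_eq0 addrC e1.
    under eq_bigr do rewrite mulrAC.
    rewrite -big_distrl /= (_ : \sum_(k <- ks) k.1 * chi k.2 x = - (a * chi s0 x)).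
      by rewrite mulNr opprK mulrA mulrAC addrC subrr.
    by apply/eqP; rewrite -addr_eq0 addrC e2.
  move/(_ lt_n h1 h2); rewrite big_map /=.
  under eq_bigr => k /eqP -> do over.
  by rewrite -big_distrl /= => /eqP; rewrite mulf_eq0 subr_eq0 (negbTE neq0) orbF => /eqP.
move=> s; have [->|ss0] := eqVneq s s0; last first.
  by rewrite big_cons /= eq_sym (negbTE ss0) sum_other.
have tot x : \sum_(k <- (a, s0) :: ks) k.1 * chi k.2 x =
    (\sum_(k <- (a, s0) :: ks | k.2 == s0) k.1) * chi s0 x.
  transitivity (\sum_(s <- undup [seq k.2 | k <- (a, s0) :: ks])
      (\sum_(k <- (a, s0) :: ks | k.2 == s) k.1) * chi s x).
    exact: (sum_by_value ((a, s0) :: ks) (fun s => chi s x : K^o)).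
  set U := undup _; have Uu : uniq U := undup_uniq _.
  have s0U : s0 \in U by rewrite mem_undup mem_head.
  rewrite (bigD1_seq s0) //= [X in _ + X]big1 ?addr0 // => t ts0.
  by rewrite big_cons /= eq_sym (negbTE ts0) sum_other // mul0r.
by have := sum0 one; rewrite tot chi1 mulr1.
Qed.

Definition key : eqType := (seq nat * seq nat * seq nat)%type.
Definition canon (k : key) : key := (sort leq k.1.1, sort leq k.1.2, sort leq k.2).

Section Expansion.
Variables (K : fieldType) (V : lmodType K).
Hypothesis char0 : [pchar K] =i pred0.

Definition chi (t p q : nat -> K) (k : key) : K :=
  \prod_(i <- k.1.1) t i * \prod_(i <- k.1.2) p i * \prod_(j <- k.2) q j.

Lemma natr_inj_char0 (m n : nat) : (m%:R = n%:R :> K) -> m = n.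
Proof.
wlog le_mn : m n / (m <= n)%N.
  by move=> h; case: (leqP m n) => [/h//|/ltnW/h h' e]; rewrite h'.
move/eqP; rewrite eq_sym -subr_eq0 -natrB // (pcharf0P K).1 // subn_eq0 => le_nm.
by apply/eqP; rewrite eqn_leq le_mn.
Qed.

(** Setting one letter to 2 and all others to 1 reads off its multiplicity as a power of 2, and
    distinct powers stay distinct in characteristic zero. *)
Lemma separate_lists (s s' : seq nat) : sorted leq s -> sorted leq s' -> s != s' ->
  exists t : nat -> K, \prod_(i <- s) t i != \prod_(i <- s') t i.
Proof.
move=> ss ss'; have [/allP e|/allPn[i _ ne]] := boolP (all (fun i => count_mem i s == count_mem i s') (s ++ s')).
  case/eqP; apply: (sorted_eq leq_trans anti_leq) => //.
  by apply/allP => x /e.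
exists (fun j => if j == i then 2%:R else 1).
have pr u : \prod_(j <- u) (if j == i then 2%:R else 1 : K) = (2 ^ count_mem i u)%:R.
  elim: u => [|x u IH]; first by rewrite big_nil.
  by rewrite big_cons IH /=; case: eqP => _; rewrite ?mul1r // expnS natrM.
rewrite !pr; apply/eqP => /natr_inj_char0 /eqP.
by rewrite eqn_exp2l // (negbTE ne).
Qed.

Variables (P : key -> Prop) (psi : key -> V).
Hypothesis psi_canon : forall k, P k -> psi (canon k) = psi k.

(** The same coefficients describe v by the elements [psi] and f by monomials. This is the passage
    from values back to elements: by [expands_eq0] a zero value forces a zero element. *)
Definition expands (v : V) (f : (nat -> K) -> (nat -> K) -> (nat -> K) -> K) : Prop :=
  exists ks : seq (K * key), [/\ forall k, k \in ks -> P k.2,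
    v = \sum_(k <- ks) k.1 *: psi k.2 &
    forall t p q, f t p q = \sum_(k <- ks) k.1 * chi t p q k.2].

Lemma chi_canon t p q k : chi t p q (canon k) = chi t p q k.
Proof. by rewrite /chi /=; congr (_ * _ * _); apply: perm_big; rewrite perm_sort. Qed.

Lemma expands0 : expands 0 (fun _ _ _ => 0).
Proof. by exists [::]; split=> [//||t p q]; rewrite big_nil. Qed.

Lemma expandsD v w f g : expands v f -> expands w g ->
  expands (v + w) (fun t p q => f t p q + g t p q).
Proof.
move=> [ks [kP -> kf]] [ls [lP -> lg]]; exists (ks ++ ls); split=> [k||t p q].
- by rewrite mem_cat => /orP[/kP|/lP].
- by rewrite big_cat.
- by rewrite big_cat kf lg.
Qed.

Lemma expandsZ a v f : expands v f -> expands (a *: v) (fun t p q => a * f t p q).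
Proof.
move=> [ks [kP -> kf]]; exists [seq (a * k.1, k.2) | k <- ks]; split=> [k||t p q].
- by case/mapP => l lks -> /=; apply: kP.
- by rewrite big_map scaler_sumr; apply: eq_bigr => k _; rewrite scalerA.
- by rewrite kf big_map mulr_sumr; apply: eq_bigr => k _; rewrite mulrA.
Qed.

Lemma expands_ext v f g : (forall t p q, f t p q = g t p q) -> expands v f -> expands v g.
Proof. by move=> e [ks [kP kv kf]]; exists ks; split=> // t p q; rewrite -e. Qed.

Lemma expands_eq0 v f : expands v f -> (forall t p q, f t p q = 0) -> v = 0.
Proof.
move=> [ks [kP -> kf]] f0; pose X := ((nat -> K) * (nat -> K) * (nat -> K))%type.
pose ch (s : key) (x : X) := chi x.1.1 x.1.2 x.2 s.
pose ml (x y : X) : X := (fun i => x.1.1 i * y.1.1 i, fun i => x.1.2 i * y.1.2 i, fun i => x.2 i * y.2 i).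
pose o : X := (fun=> 1, fun=> 1, fun=> 1).
pose ls := [seq (k.1, canon k.2) | k <- ks].
have chM s x y : ch s (ml x y) = ch s x * ch s y.
  by rewrite /ch /chi /= !big_split /=; ring.
have ch1 s : ch s o = 1 by rewrite /ch /chi /= !big1 ?mulr1.
have can k : k \in [seq k.2 | k <- ls] -> [/\ sorted leq k.1.1, sorted leq k.1.2 & sorted leq k.2].
  case/mapP => _ /mapP[l _ ->] -> /=.
  by split; apply: sort_sorted; exact: leq_total.
have sep s s' : s \in [seq k.2 | k <- ls] -> s' \in [seq k.2 | k <- ls] -> s != s' ->
    exists x, ch s x != ch s' x.
  move=> /can[s1 s2 s3] /can[s1' s2' s3'] ss'.
  have [e1|n1] := eqVneq s.1.1 s'.1.1; last first.
    have [t nt] := separate_lists s1 s1' n1; exists (t, fun=> 1, fun=> 1).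
    by rewrite /ch /chi /= [\prod_(i <- s.1.2) _]big1 // [\prod_(i <- s.2) _]big1 //
      [\prod_(i <- s'.1.2) _]big1 // [\prod_(i <- s'.2) _]big1 // !mulr1.
  have [e2|n2] := eqVneq s.1.2 s'.1.2; last first.
    have [t nt] := separate_lists s2 s2' n2; exists (fun=> 1, t, fun=> 1).
    by rewrite /ch /chi /= [\prod_(i <- s.1.1) _]big1 // [\prod_(i <- s.2) _]big1 //
      [\prod_(i <- s'.1.1) _]big1 // [\prod_(i <- s'.2) _]big1 // !mulr1 !mul1r.
  have n3 : s.2 != s'.2.
    apply: contraNneq ss' => e3.
    by rewrite [s]surjective_pairing [s.1]surjective_pairing e1 e2 e3 -!surjective_pairing.
  have [t nt] := separate_lists s3 s3' n3; exists (fun=> 1, fun=> 1, t).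
  by rewrite /ch /chi /= [\prod_(i <- s.1.1) _]big1 // [\prod_(i <- s.1.2) _]big1 //
      [\prod_(i <- s'.1.1) _]big1 // [\prod_(i <- s'.1.2) _]big1 // !mulr1 !mul1r.
have sum0 x : \sum_(k <- ls) k.1 * ch k.2 x = 0.
  rewrite big_map -[RHS](f0 x.1.1 x.1.2 x.2) kf; apply: eq_bigr => k _.
  by rewrite /ch chi_canon.
have dd := dedekind chM ch1 sep sum0.
transitivity (\sum_(k <- ls) k.1 *: psi k.2).
  by rewrite big_map !big_seq; apply: eq_bigr => k /kP Pk /=; rewrite psi_canon.
by rewrite sum_by_value big1 // => s _; rewrite dd scale0r.
Qed.

End Expansion.

Section FamilyExpansion.
Variables (K : fieldType) (V : lmodType K) (a0 b0 : nat).
Variable e : seq nat -> seq (nat * nat) -> seq (nat * nat) -> seq nat -> seq nat -> V.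
Hypothesis two_neq0 : 2%:R != 0 :> K.
Hypothesis F : family a0 b0 e.

Definition fam_form (r : nat) (i j : nat) (s t : seq nat) : V := psi e r [::] [:: (i, j)] [::] s t.

(** Without y_i one factor stays in a commutator, hence r - 1. As c_ij has the value 2 (p_i q_j -
    p_j q_i), the prescribed differences are twice the wanted ones, hence the factor 1/2. *)
Definition fam_psi (k : key) : V :=
  let r := (size k.1.2 - a0)%N in
  if k.1.1 == [::] then
    2%:R^-1 *: potential (sort leq (k.1.2 ++ k.2)) (fam_form r.-1) k.1.2 k.2
  else psi e r k.1.1 [::] [::] k.1.2 k.2.

Definition fam_valid (k : key) : Prop :=
  exists r, [/\ size k.1.2 = (r + a0)%N, size k.2 = (r + b0)%N & k.1.1 = [::] -> (0 < r)%N].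

Lemma fam_form_closed r c : size c = (r + a0 + (r + b0)).+2 -> closed_form c (r + a0).+1 (fam_form r).
Proof.
move=> sc; have st i j s t : perm_eq [:: i, j & s ++ t] c -> size s = (r + a0)%N -> size t = (r + b0)%N.
  by move=> /perm_size; rewrite sc /= size_cat => -[h] hs; lia.
have anti i j s t : size s = (r + a0)%N -> size t = (r + b0)%N -> fam_form r i j s t = - fam_form r j i s t.
  by move=> *; apply: (psi_cs F).
split.
- move=> i j s s' t t' p [sz] ps pt; apply: (psi_perm F) => //; exact: st p sz.
- by move=> i j s t p [sz]; apply: anti => //; apply: st p sz.
- move=> i s t p [sz]; have /eqP := anti i i s t sz (st _ _ _ _ p sz).
  rewrite -addr_eq0 -mulr2n -scaler_nat scaler_eq0 (negbTE two_neq0) /=; exact: eqP.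
- move=> i j k s t p [sz]; apply: (psi_plI two_neq0 F [::] [::] [::] i j k sz).
  by have := st i j (k :: s) t; apply => //; rewrite (perm_trans _ p).
- move=> i j k s t p [sz]; apply: (psi_plJ two_neq0 F [::] [::] [::] i j k sz).
  have := st i j s (k :: t); apply => //; apply: perm_trans p.
  by apply/seq.permP => x; rewrite /= !count_cat /=; clear; lia.
Qed.

Lemma fam_psi_canon k : fam_valid k -> fam_psi (canon k) = fam_psi k.
Proof.
case: k => [[T s] t] [r /= [sz szt r_gt0]]; rewrite /fam_psi /= !size_sort.
have sT : (sort leq T == [::]) = (T == [::]) by rewrite -!size_eq0 size_sort.
have -> : sort leq (sort leq s ++ sort leq t) = sort leq (s ++ t).
  apply/(perm_sortP leq_total leq_trans anti_leq).
  by apply: perm_cat; rewrite perm_sort.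
rewrite sT; case: eqP => T0; last first.
  have er : (size s - a0)%N = r by rewrite sz addnK.
  have tT : typed (sort leq T) [::] by rewrite /typed sT; case: eqP.
  transitivity (psi e r (sort leq T) [::] [::] s t); rewrite er.
    by apply: (psi_perm F); rewrite ?size_sort ?perm_sort.
  by apply: (psi_perm_state F); rewrite ?perm_sort.
case: r sz szt {r_gt0}(r_gt0 T0) => // r sz szt _; congr (_ *: _).
rewrite sz addnK /= -/leq; have cf : closed_form (sort leq (s ++ t)) (r + a0).+1 (fam_form r).
  by apply: fam_form_closed; rewrite size_sort size_cat sz szt; lia.
case: (potential_spec cf) => h _; apply: h; rewrite ?size_sort ?perm_sort // perm_sym perm_sort.
by apply: perm_cat; rewrite perm_sym perm_sort.
Qed.

Definition generic_value (cs ss : seq (nat * nat)) (p q : nat -> K) : K :=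
  \prod_(x <- cs) (2%:R * (p x.1 * q x.2 - p x.2 * q x.1)) *
  \prod_(x <- ss) (- (2%:R * (p x.1 * q x.2 + p x.2 * q x.1))).

(** Pairs and then commutators are turned into letters by [psi_S] and [psi_C]. The last commutator
    of a product without y_i cannot be removed so; it is a difference of two values of the
    potential. *)
Lemma fam_expand r T cs ss s t : typed T cs -> size s = (r + a0)%N -> size t = (r + b0)%N ->
  expands fam_valid fam_psi (psi e r T cs ss s t)
    (fun x p q => \prod_(i <- T) x i * generic_value cs ss p q * (\prod_(i <- s) p i * \prod_(j <- t) q j)).
Proof.
elim: ss r s t => [|[a b] ss IH] r s t; last first.
  move=> ty sz szt; have sz' i : size (i :: s) = (r.+1 + a0)%N by rewrite /= sz.
  have szt' j : size (j :: t) = (r.+1 + b0)%N by rewrite /= szt.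
  rewrite (psi_S two_neq0 F) // -scaleNr.
  have h := expandsZ (- 2%:R) (expandsD (IH _ _ _ ty (sz' a) (szt' b)) (IH _ _ _ ty (sz' b) (szt' a))).
  apply: expands_ext h => x p q; rewrite /generic_value !big_cons /=; ring.
elim: cs r s t => [|[a b] cs IH] r s t ty sz szt.
  have T0 : T != [::] by move: ty; rewrite /typed orbF.
  exists [:: (1, (T, s, t))]; split.
  - by move=> k; rewrite inE => /eqP -> /=; exists r; split=> //= /eqP; rewrite (negbTE T0).
  - by rewrite big_seq1 scale1r /fam_psi /= (negbTE T0) sz addnK.
  - by move=> x p q; rewrite big_seq1 /generic_value /chi !big_nil /=; ring.
have sz' i : size (i :: s) = (r.+1 + a0)%N by rewrite /= sz.
have szt' j : size (j :: t) = (r.+1 + b0)%N by rewrite /= szt.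
have [ty'|nty] := boolP (typed T cs).
  rewrite (psi_C two_neq0 F) //.
  have h := expandsZ 2%:R (expandsD (IH _ _ _ ty' (sz' a) (szt' b))
    (expandsZ (-1) (IH _ _ _ ty' (sz' b) (szt' a)))).
  rewrite scaleN1r in h.
  apply: expands_ext h => x p q; rewrite /generic_value !big_cons /=; ring.
have [T0 c0] : T = [::] /\ cs = [::].
  by move: nty; rewrite /typed negb_or !negbK => /andP[/eqP -> /eqP ->].
subst T cs; exists [:: (2%:R, ([::], a :: s, b :: t)); (- 2%:R, ([::], b :: s, a :: t))]; split.
- by move=> k; rewrite !inE => /orP[] /eqP -> /=; exists r.+1; split; rewrite /= ?sz ?szt.
- rewrite big_cons big_seq1 /fam_psi /= sz -addSn addnK /= !scalerA mulNr mulfV // scale1r scaleN1r.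
  have -> : sort leq (b :: s ++ a :: t) = sort leq (a :: s ++ b :: t).
    apply/(perm_sortP leq_total leq_trans anti_leq).
    by apply/seq.permP => x; rewrite /= !count_cat /=; clear; lia.
  have cf : closed_form (sort leq (a :: s ++ b :: t)) (r + a0).+1 (fam_form r).
    by apply: fam_form_closed; rewrite size_sort /= size_cat /= sz szt; lia.
  case: (potential_spec cf) => _ -> //; last by rewrite sz.
  by rewrite perm_sym perm_sort; apply/seq.permP => x; rewrite /= !count_cat /=; clear; lia.
- by move=> x p q; rewrite big_cons big_seq1 /generic_value /chi !big_cons !big_nil /=; ring.
Qed.

End FamilyExpansion.

(** * Products in the quotient *)

Section TypedWords.
Variables (R : pzRingType) (E O : R -> Prop) (H : @weak_rel R E O).
Variables (y z : nat -> R).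
Hypotheses (Ey : forall i, E (y i)) (Oz : forall i, O (z i)).

Local Notation P Z := (\prod_(x <- Z) x).
Local Notation pairs := (pairs z).

Lemma typed_left_last Z : Z != [::] -> allE E Z -> exists u x, P Z = u * x /\ E x.
Proof.
case/lastP: Z => // Z x _ aZ; exists (P Z), x; rewrite -cats1 big_cat big_seq1.
by split=> //; apply: aZ; rewrite mem_rcons mem_head.
Qed.

Lemma typed_left_perm ss ss' k Z : perm_eq ss ss' -> O k -> Z != [::] -> allE E Z ->
  P Z * k * pairs ss = P Z * k * pairs ss'.
Proof.
move=> p Ok Z0 aZ; have [u [x [-> Ex]]] := typed_left_last Z0 aZ.
by rewrite -!mulrA !(mulrA x) (pairs_left_perm H Oz p Ok Ex).
Qed.

Lemma typed_left_swap a b ss k Z : O k -> Z != [::] -> allE E Z ->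
  P Z * k * pairs ((a, b) :: ss) = P Z * k * pairs ((b, a) :: ss).
Proof.
move=> Ok Z0 aZ; have [u [x [-> Ex]]] := typed_left_last Z0 aZ.
by rewrite -!mulrA !(mulrA x) (pairs_left_swap H Oz a b ss Ok Ex).
Qed.

Lemma typed_left_brk0 a b k Z : O a -> O b -> O k -> Z != [::] -> allE E Z ->
  P Z * k * brk a b = 0.
Proof.
move=> Oa Ob Ok Z0 aZ; have [u [x [-> Ex]]] := typed_left_last Z0 aZ.
by rewrite -!mulrA !(mulrA x) (odd_pair0 H Oa Ob Ok Ex) mulr0.
Qed.

Lemma sandwich_ss_perm ss ss' k l Z : perm_eq ss ss' -> O k -> Z != [::] -> allE E Z ->
  sandwich Z (k * pairs ss * l) = sandwich Z (k * pairs ss' * l).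
Proof.
case: Z => // x Z p Ok _ /allE_cons[Ex _] /=.
by rewrite !mulrA (pairs_left_perm H Oz p Ok Ex).
Qed.

Lemma sandwich_ss_swap a b ss k l Z : O k -> Z != [::] -> allE E Z ->
  sandwich Z (k * pairs ((a, b) :: ss) * l) = sandwich Z (k * pairs ((b, a) :: ss) * l).
Proof.
case: Z => // x Z Ok _ /allE_cons[Ex _] /=.
by rewrite !mulrA (pairs_left_swap H Oz a b ss Ok Ex).
Qed.

Definition cm (p : nat * nat) : R := brk (z p.1) (z p.2).
Definition evens (T : seq nat) (cs : seq (nat * nat)) : seq R :=
  [seq cm p | p <- cs] ++ [seq y i | i <- T].

Lemma E_cm p : E (cm p). Proof. exact: (relOO H). Qed.

Lemma cmC a b : cm (a, b) = - cm (b, a). Proof. by rewrite /cm /brk opprB. Qed.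

Lemma allE_evens T cs : allE E (evens T cs).
Proof.
move=> x; rewrite mem_cat => /orP[] /mapP[i _ ->]; [exact: E_cm | exact: Ey].
Qed.

Lemma evens_neq0 T cs : typed T cs -> evens T cs != [::].
Proof. by rewrite /typed /evens; case: cs => [|c cs]; case: T. Qed.

Lemma perm_evens T T' cs cs' : perm_eq T T' -> perm_eq cs cs' ->
  perm_eq (evens T cs) (evens T' cs').
Proof. by move=> pT pc; apply: perm_cat; apply: perm_map. Qed.

Definition PE T cs := P (evens T cs).

Lemma PE_cons T p cs : PE T (p :: cs) = cm p * PE T cs.
Proof. by rewrite /PE big_cons. Qed.

Lemma PE_cons_r T p cs : PE T (p :: cs) = PE T cs * cm p.
Proof. by rewrite PE_cons (prod_comm H (E_cm p) (@allE_evens T cs)). Qed.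

Lemma PE_perm T T' cs cs' : perm_eq T T' -> perm_eq cs cs' -> PE T cs = PE T' cs'.
Proof. by move=> pT pc; apply: (prod_perm H); [exact: perm_evens | exact: allE_evens]. Qed.

Lemma cyc_cm_r i j k : z k * cm (i, j) + z i * cm (j, k) + z j * cm (k, i) = 0.
Proof.
rewrite /cm /= -[RHS](rel4 H (Oz i) (Oz j) (Oz k)); ncr.
Qed.

Lemma cyc_cm_l i j k : cm (i, j) * z k + cm (j, k) * z i + cm (k, i) * z j = 0.
Proof. exact: (rel4 H). Qed.

Lemma pf_cm i j k l : cm (i, j) * cm (l, k) + cm (j, k) * cm (l, i) + cm (k, i) * cm (l, j) = 0.
Proof.
have C p q := rel1 H (E_cm p) (E_cm q).
by rewrite !(C _ (l, _)) (pfaffian0 H (Oz l) (Oz k) (Oz i) (Oz j)).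
Qed.

(** Opening one commutator as z_l z_k - z_k z_l gives two instances of [cyclic_right]. In the first,
    z_k has to pass z_a, which is free: their commutator sits in a product killed by
    [even_pairs_even0]. *)
Lemma pf_middle i j k l a b ss :
  cm (i, j) * (z a * pairs ss * z b) * cm (l, k) + cm (j, k) * (z a * pairs ss * z b) * cm (l, i)
  + cm (k, i) * (z a * pairs ss * z b) * cm (l, j) = 0.
Proof.
have sw p q := swap_middle H Oz ss (E_cm p) (E_cm q) (Oz a) (Oz b).
rewrite !(sw _ (l, _)).
have e1 : z k * (z a * pairs ss * z b) * cm (i, j) + z i * (z a * pairs ss * z b) * cm (j, k)
    + z j * (z a * pairs ss * z b) * cm (k, i) = 0.
  have h m p : z m * (z a * pairs ss * z b) * cm p = z a * (z m * pairs ss * z b * cm p).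
    apply/subr0_eq.
    have -> : z m * (z a * pairs ss * z b) * cm p - z a * (z m * pairs ss * z b * cm p)
       = cm (m, a) * pairs ss * z b * cm p by rewrite /cm /=; ncr.
    exact: (even_pairs_even0 H Oz ss (E_cm (m, a)) (Oz b) (E_cm p)).
  rewrite !h -!mulrDr (cyclic_right H Oz) ?mulr0 //.
have e2 := cyclic_right H Oz ((l, a) :: ss) (Oz i) (Oz j) (Oz k) (Oz b).
rewrite !pairs_cons /= in e2.
set D := (X in X = _).
have -> : D = z l * (z k * (z a * pairs ss * z b) * cm (i, j) + z i * (z a * pairs ss * z b) * cm (j, k)
    + z j * (z a * pairs ss * z b) * cm (k, i))
   - (z k * (z l * z a * pairs ss) * z b * brk (z i) (z j) + z i * (z l * z a * pairs ss) * z b * brk (z j) (z k) +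
      z j * (z l * z a * pairs ss) * z b * brk (z k) (z i)) by rewrite /D /cm /=; ncr.
by rewrite e1 e2 mulr0 subr0.
Qed.

End TypedWords.

Section Families.
Variables (Q : pzRingType) (E O : Q -> Prop) (H : @weak_rel Q E O).
Variables (y z : nat -> Q).
Hypotheses (Ey : forall i, E (y i)) (Oz : forall i, O (z i)).

Local Notation pairs := (pairs z).
Local Notation PE := (PE y z).
Local Notation evens := (evens y z).
Local Notation cm := (cm z).
Local Notation z0 s := (z (head 0%N s)).
Local Notation E_cm := (E_cm H Oz).
Local Notation aE := (allE_evens H Ey Oz).

Definition e_UL (T : seq nat) (cs ss : seq (nat * nat)) (s t : seq nat) : Q :=
  pairs ss * z0 s * PE T cs.
Definition e_LU (T : seq nat) (cs ss : seq (nat * nat)) (s t : seq nat) : Q :=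
  PE T cs * z0 t * pairs ss.
Definition e_UU (T : seq nat) (cs ss : seq (nat * nat)) (s t : seq nat) : Q :=
  pairs ss * z0 s * PE T cs * z0 t.
(** The two summands agree in entry (1,1) and cancel in entry (1,2) of the generic matrices. *)
Definition e_plus (T : seq nat) (cs ss : seq (nat * nat)) (s t : seq nat) : Q :=
  z0 t * pairs ss * z0 s * PE T cs + sandwich (evens T cs) (z0 t * pairs ss * z0 s).
(** In entry (1,2) the sign of the difference alternates with the number of even factors. The
    prefactor cancels it, as the exchange relation, which changes the number of commutators,
    requires. *)
Definition e_minus (T : seq nat) (cs ss : seq (nat * nat)) (s t : seq nat) : Q :=
  (-1) ^+ (size T + size cs) * (z0 t * pairs ss * z0 (behead t) * PE T cs
    - sandwich (evens T cs) (z0 t * pairs ss * z0 (behead t))).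

Lemma typed_pairs_perm ss ss' l T cs : typed T cs -> perm_eq ss ss' ->
  pairs ss * z l * PE T cs = pairs ss' * z l * PE T cs.
Proof. by move=> ty p; apply: (pairs_typed_perm H Oz p); rewrite ?evens_neq0 //; exact: aE. Qed.

Lemma typed_pairs_swap a b ss l T cs : typed T cs ->
  pairs ((a, b) :: ss) * z l * PE T cs = pairs ((b, a) :: ss) * z l * PE T cs.
Proof. by move=> ty; apply: (pairs_typed_swap H Oz); rewrite ?evens_neq0 //; exact: aE. Qed.

Lemma typed_pairs_last a b ss l T cs : typed T cs ->
  pairs ((a, b) :: ss) * z l * PE T cs = pairs ss * z a * z b * z l * PE T cs.
Proof.
move=> ty; have p : perm_eq ((a, b) :: ss) (rcons ss (a, b)) by rewrite perm_sym perm_rcons.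
rewrite (typed_pairs_perm _ ty p).
by rewrite /pairs -cats1 big_cat big_seq1 /= !mulrA.
Qed.

Lemma typed_cm0 a b l T cs : typed T cs -> cm (a, b) * z l * PE T cs = 0.
Proof. by move=> ty; apply: (typed_brk0 H); rewrite ?evens_neq0 //; exact: aE. Qed.

Lemma typed_cm0_l a b l T cs : typed T cs -> PE T cs * z l * cm (a, b) = 0.
Proof. by move=> ty; apply: (typed_left_brk0 H); rewrite ?evens_neq0 //; exact: aE. Qed.

(** With the pair moved next to the odd letter, the difference contains [z_k,z_i] before an odd
    letter and the even factors, and [rel2] applies. *)
Lemma UL_exchange i j k ss T cs : typed T cs ->
  pairs ss * z k * (cm (i, j) * PE T cs) - pairs ((i, j) :: ss) * z k * PE T cs =
  pairs ss * z i * (cm (k, j) * PE T cs) - pairs ((k, j) :: ss) * z i * PE T cs.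
Proof.
move=> ty; rewrite !typed_pairs_last //; apply/subr0_eq; set D := (X in X = _).
have -> : D = pairs ss * (cm (k, i) * z j * PE T cs) by rewrite /D /cm /=; ncr.
by rewrite typed_cm0 ?mulr0.
Qed.

Lemma perm_head (s t : seq nat) : size s = 1%N -> perm_eq s t -> head 0%N s = head 0%N t.
Proof. by move=> sz p; rewrite (perm_small_eq _ p) // -(perm_size p) sz. Qed.

Lemma fam_UL : family 1 0 e_UL.
Proof.
split=> //.
- move=> T T' cs cs' ss ss' s s' t t' ty sz _ pT pc ps pss _.
  by rewrite /e_UL (perm_head sz pss) -(PE_perm H Ey Oz pT pc) (typed_pairs_perm _ ty ps).
- by move=> T cs ss a b s t ty _ _; apply: typed_pairs_swap.
- by move=> T cs ss a b s t _ _; rewrite /e_UL !PE_cons // cmC mulNr mulrN.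
- by move=> T cs ss i j k s t ty [sz] _; rewrite /e_UL !PE_cons; apply: UL_exchange.
- move=> T cs ss i j k s t _ _; rewrite /e_UL !PE_cons /= -!mulrA -!mulrDr !mulrA -!mulrDl.
  by rewrite (cyc_cm_r H Oz) mul0r mulr0.
- move=> T cs ss i j k l s t _ _; rewrite /e_UL !PE_cons -!mulrDr !mulrA -!mulrDl.
  by rewrite (pf_cm H Oz) mul0r mulr0.
Qed.

Lemma fam_LU : family 0 1 e_LU.
Proof.
split=> //.
- move=> T T' cs cs' ss ss' s s' t t' ty _ sz pT pc ps _ pt.
  rewrite /e_LU (perm_head sz pt) -(PE_perm H Ey Oz pT pc).
  by apply: (typed_left_perm H Oz ps); rewrite ?evens_neq0 //; exact: aE.
- move=> T cs ss a b s t ty _ _.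
  by apply: (typed_left_swap H Oz); rewrite ?evens_neq0 //; exact: aE.
- by move=> T cs ss a b s t _ _; rewrite /e_LU !PE_cons // cmC !mulNr.
- move=> T cs ss i j k s t ty _ [sz]; rewrite /e_LU !(PE_cons_r H Ey Oz) !pairs_cons /=.
  apply/subr0_eq; set D := (X in X = _).
  have -> : D = PE T cs * z i * cm (j, k) * pairs ss by rewrite /D /cm /=; ncr.
  by rewrite typed_cm0_l ?mul0r.
- move=> T cs ss i j k s t _ _; rewrite /e_LU !(PE_cons_r H Ey Oz) /= -!mulrDl -!mulrA -!mulrDr.
  by rewrite (cyc_cm_l H Oz) mulr0 mul0r.
- move=> T cs ss i j k l s t _ _; rewrite /e_LU !PE_cons !mulrA -!mulrDl.
  by rewrite (pf_cm H Oz) !mul0r.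
Qed.

Lemma fam_UU : family 1 1 e_UU.
Proof.
split=> //.
- move=> T T' cs cs' ss ss' s s' t t' ty sz szt pT pc ps pss pt.
  by rewrite /e_UU (perm_head sz pss) (perm_head szt pt) -(PE_perm H Ey Oz pT pc) (typed_pairs_perm _ ty ps).
- by move=> T cs ss a b s t ty _ _; rewrite /e_UU typed_pairs_swap.
- by move=> T cs ss a b s t _ _; rewrite /e_UU !PE_cons // cmC mulNr mulrN mulNr.
- by move=> T cs ss i j k s t ty [sz] _; rewrite /e_UU !PE_cons -!mulrBl UL_exchange.
- move=> T cs ss i j k s t ty sz [szt]; rewrite /e_UU !PE_cons !typed_pairs_last //=.
  set l := head _ _.
  have h := uu_exchange H (Oz i) (Oz j) (Oz k) (Oz l) (evens_neq0 y z ty) (@aE T cs).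
  rewrite -!/(PE T cs) in h; apply/subr0_eq; set D := (X in X = _).
  have -> : D = pairs ss * (z l * brk (z i) (z j) * PE T cs * z k - z i * z j * z l * PE T cs * z k
    - (z l * brk (z i) (z k) * PE T cs * z j - z i * z k * z l * PE T cs * z j)).
    by rewrite /D /cm /=; ncr.
  by rewrite h subrr mulr0.
- move=> T cs ss i j k s t _ _; rewrite /e_UU !PE_cons /= -!mulrA -!mulrDr !mulrA -!mulrDl.
  by rewrite (cyc_cm_r H Oz) !mul0r mulr0.
- move=> T cs ss i j k s t _ _; rewrite /e_UU !(PE_cons_r H Ey Oz) /= -!mulrA -!mulrDr.
  by rewrite (cyc_cm_l H Oz) !mulr0.
- move=> T cs ss i j k l s t _ _; rewrite /e_UU !PE_cons -!mulrDl -!mulrDr !mulrA -!mulrDl.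
  by rewrite (pf_cm H Oz) mul0r mulr0 mul0r.
Qed.

Lemma evens_split T cs : typed T cs ->
  exists x Z, [/\ evens T cs = x :: Z, E x & allE E Z].
Proof.
move=> ty; have := evens_neq0 y z ty; have := @aE T cs.
by case: (evens T cs) => // x Z /allE_cons[]; exists x, Z.
Qed.

Lemma evens_cons T p cs : evens T (p :: cs) = cm p :: evens T cs. Proof. by []. Qed.

Section LowerExchange.
Variables (T : seq nat) (cs ss : seq (nat * nat)) (x : Q) (Z : seq Q).
Hypotheses (eZ : evens T cs = x :: Z) (Ex : E x).
Local Notation W k ss l := (z k * pairs ss * z l).
Local Notation PZ := (\prod_(u <- Z) u).

Let ty : typed T cs.
Proof. by move: eZ; rewrite /typed /evens; case: (cs); case: (T). Qed.

Let ePE : PE T cs = x * PZ. Proof. by rewrite /PE eZ big_cons. Qed.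

(** [comm_middle] brings the new commutator to the left of the word in both summands, next to the
    first odd letter, where that letter can be exchanged. *)
Lemma plus_cons k l p :
  W k ss l * PE T (p :: cs) + sandwich (evens T (p :: cs)) (W k ss l) =
  x * cm p * W k ss l * PZ + cm p * W k ss l * PE T cs.
Proof.
rewrite evens_cons /= -/(PE T cs) PE_cons ePE; congr (_ + _).
have Ec := E_cm p; rewrite (rel1 H Ex Ec) (comm_middle H Oz ss Ec Ex (Oz k) (Oz l)).
by rewrite !mulrA.
Qed.

Lemma minus_cons k l p :
  W k ss l * PE T (p :: cs) - sandwich (evens T (p :: cs)) (W k ss l) =
  x * cm p * W k ss l * PZ - cm p * W k ss l * PE T cs.
Proof.
rewrite evens_cons /= -/(PE T cs) PE_cons ePE; congr (_ - _).
have Ec := E_cm p; rewrite (rel1 H Ex Ec) (comm_middle H Oz ss Ec Ex (Oz k) (Oz l)).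
by rewrite !mulrA.
Qed.

Lemma lower_first_left k j l i :
  cm (i, j) * W k ss l * PE T cs - W k ((i, j) :: ss) l * PE T cs =
  cm (i, k) * W j ss l * PE T cs - W j ((i, k) :: ss) l * PE T cs.
Proof.
rewrite !pairs_cons /=; apply/subr0_eq; set D := (X in X = _).
have -> : D = z i * (cm (j, k) * pairs ss * z l * x) * PZ by rewrite /D ePE /cm /=; ncr.
by rewrite (even_pairs_even0 H Oz ss (E_cm _) (Oz l) Ex) mulr0 mul0r.
Qed.

Lemma lower_first_right k j l i :
  x * cm (i, j) * W k ss l * PZ - x * W k ((i, j) :: ss) l * PZ =
  x * cm (i, k) * W j ss l * PZ - x * W j ((i, k) :: ss) l * PZ.
Proof.
rewrite !pairs_cons /=; apply/subr0_eq; set D := (X in X = _).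
have -> : D = x * z i * cm (j, k) * (pairs ss * z l * PZ) by rewrite /D /cm /=; ncr.
by rewrite (odd_pair0 H (Oz j) (Oz k) (Oz i) Ex) mul0r.
Qed.

(** For the last odd letter, [swap_middle] moves the commutator to the right of the word, and the
    pair is moved to the end of [ss], so that both stand next to that letter. *)
Lemma lower_last k i j m :
  W m ss k * PE T ((i, j) :: cs) + sandwich (evens T ((i, j) :: cs)) (W m ss k)
  - (W m ((i, j) :: ss) k * PE T cs + sandwich (evens T cs) (W m ((i, j) :: ss) k)) =
  W m ss i * PE T ((k, j) :: cs) + sandwich (evens T ((k, j) :: cs)) (W m ss i)
  - (W m ((k, j) :: ss) i * PE T cs + sandwich (evens T cs) (W m ((k, j) :: ss) i)).
Proof.
have p u v : perm_eq ((u, v) :: ss) (rcons ss (u, v)) by rewrite perm_sym perm_rcons.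
have ex u v w : sandwich (evens T ((u, v) :: cs)) (W m ss w) = x * W m ss w * cm (u, v) * PZ.
  rewrite evens_cons /= -/(PE T cs) ePE mulrA.
  by rewrite (swap_middle H Oz ss (E_cm (u, v)) Ex (Oz m) (Oz w)).
have ey u v w : sandwich (evens T cs) (W m ((u, v) :: ss) w) = x * z m * pairs ss * z u * z v * z w * PZ.
  rewrite eZ /= !mulrA (pairs_left_perm H Oz (p u v) (Oz m) Ex).
  by rewrite /pairs -cats1 big_cat big_seq1 /= !mulrA.
have ez u v w : W m ((u, v) :: ss) w * PE T cs = z m * (pairs ss * z u * z v * z w * PE T cs).
  by rewrite -typed_pairs_last // !mulrA.
rewrite !ex !ey !ez !PE_cons; apply/subr0_eq; set D := (X in X = _).
have -> : D = z m * pairs ss * (cm (k, i) * z j * PE T cs) + x * z m * pairs ss * cm (k, i) * z j * PZ.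
  by rewrite /D /cm /=; ncr.
rewrite typed_cm0 // mulr0 add0r -(adl_left H Oz ss (Oz m) Ex).
by rewrite (odd_pair0 H (Oz k) (Oz i) (Oz m) (E_adl H Oz ss Ex)) !mul0r.
Qed.

(** Each side is the commutator of a product of two odd letters with the even element [adl z ss x],
    times the rest. Antisymmetrizing in k and l leaves a commutator of two even elements. *)
Lemma minus_sym k l : W k ss l * PE T cs - sandwich (evens T cs) (W k ss l) =
  W l ss k * PE T cs - sandwich (evens T cs) (W l ss k).
Proof.
have e u v : W u ss v * PE T cs - sandwich (evens T cs) (W u ss v) =
    (z u * z v * adl z ss x - adl z ss x * z u * z v) * PZ.
  have e1 : W u ss v * x = z u * z v * adl z ss x.
    by rewrite -!mulrA (mulrA (pairs ss)) -(adl_right H Oz ss (Oz v) Ex).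
  have e2 : x * W u ss v = adl z ss x * z u * z v by rewrite !mulrA -(adl_left H Oz ss (Oz u) Ex).
  by rewrite eZ /= ePE mulrA e1 e2 mulrBl.
rewrite !e; apply/subr0_eq; set D := (X in X = _).
have EX := E_adl H Oz ss Ex.
have -> : D = (cm (k, l) * adl z ss x - adl z ss x * cm (k, l)) * PZ by rewrite /D /cm /=; ncr.
by rewrite (rel1 H (E_cm _) EX) subrr mul0r.
Qed.

End LowerExchange.

Lemma sandwich_cons T p cs w : sandwich (evens T (p :: cs)) w = cm p * w * PE T cs.
Proof. by []. Qed.

Lemma lower_perm T T' cs cs' ss ss' k l : typed T cs ->
  perm_eq T T' -> perm_eq cs cs' -> perm_eq ss ss' ->
  sandwich (evens T cs) (z k * pairs ss * z l) = sandwich (evens T' cs') (z k * pairs ss' * z l).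
Proof.
move=> ty pT pc ps.
rewrite (sandwich_ss_perm H Oz (z l) ps (Oz k) (evens_neq0 y z ty) (@aE T cs)).
by apply: (sandwich_perm H Oz); [exact: perm_evens | exact: aE | exact: Oz | exact: Oz].
Qed.

Lemma fam_plus : family 1 1 e_plus.
Proof.
split=> //.
- move=> T T' cs cs' ss ss' s s' t t' ty sz szt pT pc ps pss pt.
  rewrite /e_plus (perm_head sz pss) (perm_head szt pt) -(PE_perm H Ey Oz pT pc).
  by rewrite (lower_perm _ _ ty pT pc ps) -!mulrA !(mulrA (pairs _)) (typed_pairs_perm _ ty ps).
- move=> T cs ss a b s t ty _ _; rewrite /e_plus -!mulrA !(mulrA (pairs _)) typed_pairs_swap //.
  by rewrite !mulrA (sandwich_ss_swap H Oz a b ss _ (Oz _) (evens_neq0 y z ty) (@aE T cs)).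
- move=> T cs ss a b s t _ _; rewrite /e_plus !sandwich_cons !PE_cons // cmC.
  by rewrite !mulNr mulrN opprD.
- move=> T cs ss i j k s t ty _ _; rewrite /e_plus.
  have [x [Z [eZ Ex aZ]]] := evens_split ty.
  exact: (lower_last ss eZ Ex).
- move=> T cs ss i j k s t ty _ _; rewrite /e_plus.
  have [x [Z [eZ Ex aZ]]] := evens_split ty.
  rewrite !(plus_cons ss eZ Ex) /= eZ /=.
  have h1 := lower_first_left ss eZ Ex k j (head 0%N s) i.
  have h2 := lower_first_right ss Z Ex k j (head 0%N s) i.
  rewrite !(addrC (x * cm _ * _ * _)) !opprD !(addrACA _ _ (- _)); congr (_ + _).
  + exact: h1.
  + by rewrite !mulrA in h2 *; exact: h2.
- move=> T cs ss i j k s t _ _; rewrite /e_plus !sandwich_cons !PE_cons /=.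
  set m := z0 t; have h := cyclic_left H Oz ss (Oz i) (Oz j) (Oz k) (Oz (head 0%N t)).
  set D := (X in X = _).
  have -> : D = m * pairs ss * (z k * cm (i, j) + z i * cm (j, k) + z j * cm (k, i)) * PE T cs
    + (brk (z i) (z j) * m * pairs ss * z k + brk (z j) (z k) * m * pairs ss * z i
      + brk (z k) (z i) * m * pairs ss * z j) * PE T cs by rewrite /D /cm /=; ncr.
  by rewrite h (cyc_cm_r H Oz) mulr0 !mul0r addr0.
- move=> T cs ss i j k s t _ _; rewrite /e_plus !sandwich_cons !PE_cons /=.
  set m := z0 s; have h := cyclic_right H Oz ss (Oz i) (Oz j) (Oz k) (Oz (head 0%N s)).
  set D := (X in X = _).
  have -> : D = (cm (i, j) * z k + cm (j, k) * z i + cm (k, i) * z j) * pairs ss * m * PE T cs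
    + (z k * pairs ss * m * brk (z i) (z j) + z i * pairs ss * m * brk (z j) (z k)
      + z j * pairs ss * m * brk (z k) (z i)) * PE T cs by rewrite /D /cm /=; ncr.
  by rewrite h (cyc_cm_l H Oz) !mul0r addr0.
- move=> T cs ss i j k l s t _ _; rewrite /e_plus !sandwich_cons !PE_cons.
  set a := head _ t; set b := head _ s; have h := pf_middle H Oz i j k l a b ss.
  set D := (X in X = _).
  have -> : D = z a * pairs ss * z b * (cm (i, j) * cm (l, k) + cm (j, k) * cm (l, i)
     + cm (k, i) * cm (l, j)) * PE T cs
    + (cm (i, j) * (z a * pairs ss * z b) * cm (l, k) + cm (j, k) * (z a * pairs ss * z b) * cm (l, i)
  + cm (k, i) * (z a * pairs ss * z b) * cm (l, j)) * PE T cs by rewrite /D; ncr.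
  by rewrite h (pf_cm H Oz) mulr0 !mul0r addr0.
Qed.

Lemma fam_minus : family 0 2 e_minus.
Proof.
split=> //.
- move=> T T' cs cs' ss ss' s s' t t' ty _ szt pT pc ps _ pt.
  have -> : e_minus T' cs' ss' s' t' = e_minus T cs ss s' t'.
    rewrite /e_minus (perm_size pT) (perm_size pc) -(PE_perm H Ey Oz pT pc).
    by rewrite (lower_perm _ _ ty pT pc ps) -!mulrA !(mulrA (pairs _)) (typed_pairs_perm _ ty ps).
  have [x [Z [eZ Ex aZ]]] := evens_split ty.
  apply: (@perm_eq_head _ (fun u v => e_minus T cs ss s u = e_minus T cs ss s' v) 1%N) szt pt.
  + by move=> u v w ->.
  + by move=> w u v sz p; rewrite (perm_small_eq _ p) // -(perm_size p) sz.
  + by move=> a b [|//] _; rewrite /e_minus /= (minus_sym ss eZ Ex a b).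
- move=> T cs ss a b s t ty _ _; rewrite /e_minus -!mulrA !(mulrA (pairs _)) typed_pairs_swap //.
  by rewrite !mulrA (sandwich_ss_swap H Oz a b ss _ (Oz _) (evens_neq0 y z ty) (@aE T cs)).
- move=> T cs ss a b s t _ _; rewrite /e_minus !sandwich_cons !PE_cons // cmC /=; ncr.
- move=> T cs ss i j k s t ty _ _; rewrite /e_minus.
  have [x [Z [eZ Ex aZ]]] := evens_split ty.
  rewrite !(minus_cons ss eZ Ex) /= eZ /=.
  have h1 := lower_first_left ss eZ Ex k j (head 0%N t) i.
  have h2 := lower_first_right ss Z Ex k j (head 0%N t) i.
  rewrite !addnS exprS; set u := _ ^+ _.
  set D := (X in X = _); set D' := (X in _ = X).
  have -> : D = u * (cm (i, j) * (z k * pairs ss * z0 t) * PE T cs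
      - z k * pairs ((i, j) :: ss) * z0 t * PE T cs)
    - u * (x * cm (i, j) * (z k * pairs ss * z0 t) * \prod_(v <- Z) v
      - x * (z k * pairs ((i, j) :: ss) * z0 t) * \prod_(v <- Z) v) by rewrite /D; ncr.
  rewrite h1 h2 /D'; ncr.
- move=> T cs ss i j k s t _ _; rewrite /e_minus !sandwich_cons !PE_cons /=.
  set m := z0 t; have h := cyclic_right H Oz ss (Oz i) (Oz j) (Oz k) (Oz (head 0%N t)).
  rewrite -!mulrDr; set D := (X in _ * X = _).
  have -> : D = (z k * pairs ss * m * brk (z i) (z j) + z i * pairs ss * m * brk (z j) (z k)
      + z j * pairs ss * m * brk (z k) (z i)) * PE T cs
    - (cm (i, j) * z k + cm (j, k) * z i + cm (k, i) * z j) * pairs ss * m * PE T cs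
    by rewrite /D /cm /=; ncr.
  by rewrite h (cyc_cm_l H Oz) !mul0r subr0 mulr0.
- move=> T cs ss i j k l s t _ _; rewrite /e_minus !sandwich_cons !PE_cons /=.
  set a := head _ t; set b := head _ _; have h := pf_middle H Oz i j k l a b ss.
  rewrite -!mulrDr; set D := (X in _ * X = _).
  have -> : D = z a * pairs ss * z b * (cm (i, j) * cm (l, k) + cm (j, k) * cm (l, i)
     + cm (k, i) * cm (l, j)) * PE T cs
    - (cm (i, j) * (z a * pairs ss * z b) * cm (l, k) + cm (j, k) * (z a * pairs ss * z b) * cm (l, i)
  + cm (k, i) * (z a * pairs ss * z b) * cm (l, j)) * PE T cs by rewrite /D; ncr.
  by rewrite h (pf_cm H Oz) mulr0 !mul0r subr0 mulr0.
Qed.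

End Families.

(* U and L record whether a product starts, resp. ends, in the row of index 0 (U) or
   in the rows 1, 2 (L) of the matrices; ShA and ShB are both of type LL. *)
Inductive shape : Type :=
  | ShUL of nat | ShLU of nat | ShUU of nat & nat | ShA of nat & nat | ShB of nat & nat | ShY.

Record term : Type := Term {
  t_evens : seq nat; t_brks : seq (nat * nat); t_pairs : seq (nat * nat); t_shape : shape }.

Definition tval (R : pzRingType) (y z : nat -> R) (t : term) : R :=
  let: Term T cs ss sh := t in
  match sh with
  | ShUL k => pairs z ss * z k * PE y z T cs
  | ShLU k => PE y z T cs * z k * pairs z ss
  | ShUU l k => pairs z ss * z l * PE y z T cs * z k
  | ShA k l => z k * pairs z ss * z l * PE y z T cs
  | ShB k l => sandwich (evens y z T cs) (z k * pairs z ss * z l)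
  | ShY => PE y z T cs
  end.

Definition comb (R : pzRingType) (y z : nat -> R) (ns : seq (int * term)) : R :=
  \sum_(n <- ns) tval y z n.2 *~ n.1.

(** The even factors that arise from words: a word containing some y_i needs no commutators, and
    sorting an odd word produces exactly one. *)
Definition basic (T : seq nat) (cs : seq (nat * nat)) : bool :=
  if T == [::] then size cs == 1%N else cs == [::].

Definition basic_term (t : term) : bool := basic (t_evens t) (t_brks t).

Lemma basic_typed T cs : basic T cs -> typed T cs.
Proof. by rewrite /basic /typed; case: eqP => // _; case: cs. Qed.

(** * Reduction of words to terms of the six shapes *)

Section NormalForm.
Variables (R : pzRingType) (E O : R -> Prop) (H : @weak_rel R E O).
Variables (y z : nat -> R).
Hypotheses (Ey : forall i, E (y i)) (Oz : forall i, O (z i)).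

Local Notation pairs := (pairs z).
Local Notation PE := (PE y z).
Local Notation evens := (evens y z).
Local Notation cm := (cm z).
Local Notation E_cm := (E_cm H Oz).
Local Notation aE := (allE_evens H Ey Oz).
Local Notation zw w := (\prod_(i <- w) z i).

(* Only terms with exactly the even factors T, cs are allowed. *)
Definition inspan (T : seq nat) (cs : seq (nat * nat)) (x : R) : Prop :=
  exists2 ns : seq (int * term),
    (forall n, n \in [seq (t_evens n.2, t_brks n.2) | n <- ns] -> n = (T, cs)) & x = comb y z ns.

Lemma inspan0 T cs : inspan T cs 0.
Proof. by exists [::] => //; rewrite /comb big_nil. Qed.

Lemma inspanD T cs u v : inspan T cs u -> inspan T cs v -> inspan T cs (u + v).
Proof.
move=> [ns h ->] [ms h' ->]; exists (ns ++ ms); last by rewrite /comb big_cat.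
by move=> n; rewrite map_cat mem_cat => /orP[/h|/h'].
Qed.

Lemma inspanN T cs u : inspan T cs u -> inspan T cs (- u).
Proof.
move=> [ns h ->]; exists [seq (- n.1, n.2) | n <- ns]; first by rewrite -map_comp.
by rewrite /comb big_map -sumrN; apply: eq_bigr => n _; rewrite mulrNz.
Qed.

Lemma inspan_term T cs ss sh : inspan T cs (tval y z (Term T cs ss sh)).
Proof.
exists [:: (1, Term T cs ss sh)]; last by rewrite /comb big_seq1 mulr1z.
by move=> n; rewrite inE => /eqP.
Qed.

Lemma inspan_map T cs T' cs' (f : R -> R) : (forall u v, f (u + v) = f u + f v) ->
  (forall ss sh, inspan T' cs' (f (tval y z (Term T cs ss sh)))) ->
  forall u, inspan T cs u -> inspan T' cs' (f u).
Proof.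
move=> fD h u [ns hn ->].
have f0 : f 0 = 0 by apply: (addrI (f 0)); rewrite -fD !addr0.
have fN v : f (- v) = - f v by apply: (addrI (f v)); rewrite -fD !subrr f0.
have fMn v n : inspan T' cs' (f v) -> inspan T' cs' (f (v *+ n)).
  by move=> hv; elim: n => [|n IH]; rewrite ?mulr0n ?f0 ?mulrS ?fD; [exact: inspan0 | exact: inspanD].
rewrite /comb; elim: ns hn => [|n ns IH] hn; first by rewrite big_nil f0; exact: inspan0.
rewrite big_cons fD; apply: inspanD; last first.
  by apply: IH => m hm; apply: hn; rewrite /= in_cons hm orbT.
have := hn (t_evens n.2, t_brks n.2); rewrite /= mem_head => /(_ isT).
case: n {hn} => [m [T0 cs0 ss sh]] /= [-> ->].
case: m => k /=; first by apply: fMn; exact: h.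
by rewrite NegzE mulrNz fN; apply/inspanN/fMn/h.
Qed.

Variables (T : seq nat) (cs : seq (nat * nat)).
Hypothesis ty : typed T cs.

(** The pairs on the right are carried to the left one at a time by [move_list]; [pre] collects
    them. *)
Lemma inspan_UU ss i k pre : inspan T cs (pairs pre * (z i * PE T cs * z k * pairs ss)).
Proof.
elim: ss i k pre => [|[a b] ss IH] i k pre.
  by rewrite pairs_nil mulr1 !mulrA; exact: (inspan_term T cs pre (ShUU i k)).
rewrite pairs_cons /= !mulrA -!(mulrA (pairs pre)).
have := move_list H (Oz i) (Oz k) (Oz a) (evens_neq0 y z ty) (@aE T cs).
rewrite -/(PE T cs) => ->; case: ifP => _.
  have -> : pairs pre * (z a * brk (z k) (z i) * PE T cs * z b * pairs ss) =
     pairs (rcons pre (a, k)) * (z i * PE T cs * z b * pairs ss)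
   - pairs (rcons pre (a, i)) * (z k * PE T cs * z b * pairs ss).
    by rewrite /pairs -!cats1 !big_cat !big_seq1 /=; ncr.
  by apply: inspanD; [|apply: inspanN]; exact: IH.
have -> : pairs pre * (z i * z k * z a * PE T cs * z b * pairs ss) =
    pairs (rcons pre (i, k)) * (z a * PE T cs * z b * pairs ss).
  by rewrite /pairs -!cats1 !big_cat !big_seq1 /=; ncr.
exact: IH.
Qed.

Lemma move_list_left a b c Z : O a -> O b -> O c -> Z != [::] -> allE E Z ->
  c * b * (\prod_(x <- Z) x) * a =
  (\prod_(x <- Z) x) * (if odd (size Z) then brk a b * c else c * b * a).
Proof.
move=> Oa Ob Oc Z0 aZ.
have Z0' : rev Z != [::] by rewrite -size_eq0 size_rev size_eq0.
have aZ' : allE E (rev Z) by move=> x; rewrite mem_rev; exact: aZ.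
have := @move_list R^c E O (weak_rel_conv H) a b c (rev Z) Oa Ob Oc Z0' aZ'.
rewrite size_rev rev_prodr revK -!(@mulrA R^c) => h.
refine (etrans _ (etrans h _)); first by [].
by case: ifP.
Qed.

Lemma pairs_rcons ss a b : pairs (rcons ss (a, b)) = pairs ss * (z a * z b).
Proof. by rewrite /pairs -cats1 big_cat big_seq1. Qed.

(** The mirror process: pairs leave [ss] from its end and are collected on the right in [post]. *)
Lemma inspan_LU ss i l k post : inspan T cs (z i * pairs ss * z l * PE T cs * z k * pairs post).
Proof.
elim/last_ind: ss i l k post => [|ss [a b] IH] i l k post.
  rewrite pairs_nil mulr1.
  have := move_list_left (Oz k) (Oz l) (Oz i) (evens_neq0 y z ty) (@aE T cs).
  rewrite -/(PE T cs) => ->; case: ifP => _.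
    have -> : PE T cs * (brk (z k) (z l) * z i) * pairs post =
      PE T cs * z k * pairs ((l, i) :: post) - PE T cs * z l * pairs ((k, i) :: post).
      by rewrite !pairs_cons /=; ncr.
    apply: inspanD; first exact: (inspan_term T cs _ (ShLU k)).
    by apply: inspanN; exact: (inspan_term T cs _ (ShLU l)).
  have -> : PE T cs * (z i * z l * z k) * pairs post = PE T cs * z i * pairs ((l, k) :: post).
    by rewrite pairs_cons /=; ncr.
  exact: (inspan_term T cs _ (ShLU i)).
have := move_list_left (Oz k) (Oz l) (Oz b) (evens_neq0 y z ty) (@aE T cs).
rewrite -/(PE T cs) pairs_rcons => e.
have -> : z i * (pairs ss * (z a * z b)) * z l * PE T cs * z k * pairs post =
  z i * pairs ss * z a * (z b * z l * PE T cs * z k) * pairs post by ncr.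
rewrite e; case: ifP => _.
  have -> : z i * pairs ss * z a * (PE T cs * (brk (z k) (z l) * z b)) * pairs post =
     z i * pairs ss * z a * PE T cs * z k * pairs ((l, b) :: post)
     - z i * pairs ss * z a * PE T cs * z l * pairs ((k, b) :: post).
    by rewrite !pairs_cons /=; ncr.
  by apply: inspanD; [|apply: inspanN]; exact: IH.
have -> : z i * pairs ss * z a * (PE T cs * (z b * z l * z k)) * pairs post =
    z i * pairs ss * z a * PE T cs * z b * pairs ((l, k) :: post).
  by rewrite !pairs_cons /=; ncr.
exact: IH.
Qed.

(** [move_y] pushes the left even factor through the word, one pair at a time, until only terms of
    shape [ShUL] remain. *)
Lemma inspan_zB ss i k l pre :
  inspan T cs (pairs pre * (z i * sandwich (evens T cs) (z k * pairs ss * z l))).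
Proof.
have [x [Z [eZ Ex aZ]]] := evens_split H Ey Oz ty; rewrite eZ /=.
have ePE : PE T cs = x * \prod_(v <- Z) v by rewrite /PE eZ big_cons.
elim: ss i k pre => [|[a b] ss IH] i k pre.
  have -> : pairs pre * (z i * (x * (z k * pairs [::] * z l) * \prod_(v <- Z) v)) =
     pairs pre * (z i * x * z k * z l) * \prod_(v <- Z) v by rewrite pairs_nil; ncr.
  rewrite (move_y H (Oz l) (Oz i) (Oz k) Ex).
  have -> : pairs pre * (z l * brk (z k) (z i) * x) * \prod_(v <- Z) v =
    pairs (rcons pre (l, k)) * z i * PE T cs - pairs (rcons pre (l, i)) * z k * PE T cs.
    by rewrite !pairs_rcons ePE; ncr.
  apply: inspanD; first exact: (inspan_term T cs _ (ShUL i)).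
  by apply: inspanN; exact: (inspan_term T cs _ (ShUL k)).
have -> : pairs pre * (z i * (x * (z k * pairs ((a, b) :: ss) * z l) * \prod_(v <- Z) v)) =
   pairs pre * (z i * x * z k * z a) * z b * pairs ss * z l * \prod_(v <- Z) v.
  by rewrite pairs_cons /=; ncr.
rewrite (move_y H (Oz a) (Oz i) (Oz k) Ex).
have -> : pairs pre * (z a * brk (z k) (z i) * x) * z b * pairs ss * z l * \prod_(v <- Z) v =
   pairs (rcons pre (a, k)) * (z i * (x * (z b * pairs ss * z l) * \prod_(v <- Z) v))
   - pairs (rcons pre (a, i)) * (z k * (x * (z b * pairs ss * z l) * \prod_(v <- Z) v)).
  by rewrite !pairs_rcons; ncr.
by apply: inspanD; [|apply: inspanN]; exact: IH.
Qed.

(** Multiplication by z_i changes the starting row: UL becomes A, LU becomes UU, UU becomes LU, and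
    A, B and Y become UL. *)
Lemma inspan_mulz i u : inspan T cs u -> inspan T cs (z i * u).
Proof.
apply: inspan_map => [v w|ss sh]; first exact: mulrDr.
case: sh => [k|k|l k|k l|k l|] /=.
- by rewrite !mulrA; exact: (inspan_term T cs ss (ShA i k)).
- by have := inspan_UU ss i k [::]; rewrite pairs_nil mul1r !mulrA.
- by have := inspan_LU ss i l k [::]; rewrite pairs_nil mulr1 !mulrA.
- have := inspan_term T cs ((i, k) :: ss) (ShUL l); rewrite /= pairs_cons /=.
  by rewrite !mulrA.
- by have := inspan_zB ss i k l [::]; rewrite pairs_nil mul1r.
- by have := inspan_term T cs [::] (ShUL i); rewrite /= pairs_nil mul1r.
Qed.

Lemma PE_consT j : PE (j :: T) cs = y j * PE T cs.
Proof.
have p : perm_eq (evens (j :: T) cs) (y j :: evens T cs).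
  by rewrite /evens (perm_catCA _ [:: y j]).
by rewrite /PE (prod_perm H p (@aE _ _)) big_cons.
Qed.

Lemma sandwich_consT j k ss l : sandwich (evens (j :: T) cs) (z k * pairs ss * z l) =
  y j * (z k * pairs ss * z l) * PE T cs.
Proof.
have p : perm_eq (evens (j :: T) cs) (y j :: evens T cs).
  by rewrite /evens (perm_catCA _ [:: y j]).
by rewrite (sandwich_perm H Oz ss p (@aE _ _) (Oz k) (Oz l)).
Qed.

(** The factor y_j annihilates products that start in the row of index 0. It turns [ShA] into [ShB];
    on [ShB] the two even factors on the left cross the word together and give [ShA]. *)
Lemma inspan_muly j u : inspan T cs u -> inspan (j :: T) cs (y j * u).
Proof.
have [x [Z [eZ Ex aZ]]] := evens_split H Ey Oz ty.
have ePE : PE T cs = x * \prod_(v <- Z) v by rewrite /PE eZ big_cons.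
have e0 ss k : y j * (pairs ss * z k * PE T cs) = 0.
  by rewrite ePE !mulrA (even_pairs_even0 H Oz ss (Ey j) (Oz k) Ex) mul0r.
apply: inspan_map => [v w|ss sh]; first exact: mulrDr.
case: sh => [k|k|l k|k l|k l|] /=.
- by rewrite e0; exact: inspan0.
- by have := inspan_term (j :: T) cs ss (ShLU k); rewrite /= PE_consT !mulrA.
- by rewrite mulrA e0 mul0r; exact: inspan0.
- by have := inspan_term (j :: T) cs ss (ShB k l); rewrite /= sandwich_consT !mulrA.
- rewrite eZ /= (mulrA (y j)) (mulrA (y j)) (comm_middle H Oz ss (Ey j) Ex (Oz k) (Oz l)).
  by have := inspan_term (j :: T) cs ss (ShA k l); rewrite /= PE_consT ePE !mulrA.
- by rewrite -PE_consT; exact: (inspan_term (j :: T) cs [::] ShY).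
Qed.

End NormalForm.

Section WordForm.
Variables (R : pzRingType) (E O : R -> Prop) (H : @weak_rel R E O).
Variables (y z : nat -> R).
Hypotheses (Ey : forall i, E (y i)) (Oz : forall i, O (z i)).

Local Notation pairs := (pairs z).
Local Notation PE := (PE y z).
Local Notation evens := (evens y z).
Local Notation cm := (cm z).
Local Notation inspan := (inspan y z).
Local Notation zw w := (\prod_(i <- w) z i).

Lemma even_word w : ~~ odd (size w) -> exists ss, zw w = pairs ss.
Proof.
have [n] := ubnP (size w); elim: n w => // n IH [|a [|b w]] //=.
  by exists [::]; rewrite big_nil pairs_nil.
rewrite !ltnS negbK => lt_n /(IH w (ltnW lt_n))[ss e].
by exists ((a, b) :: ss); rewrite !big_cons e pairs_cons mulrA.
Qed.

Lemma odd_word_last w : odd (size w) -> exists ss l, zw w = pairs ss * z l.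
Proof.
case/lastP: w => // w l; rewrite size_rcons => /even_word[ss e]; exists ss, l.
by rewrite -cats1 big_cat big_seq1 e.
Qed.

Lemma inspan_base T cs x w : evens T cs = [:: x] -> inspan T cs (x * zw w).
Proof.
move=> eZ; have ePE : PE T cs = x by rewrite /PE eZ big_seq1.
case: w => [|k w].
  by rewrite big_nil mulr1 -ePE; exact: (inspan_term y z T cs [::] ShY).
have [ow|ew] := boolP (odd (size w)).
  have [ss [l e]] := odd_word_last ow; have := inspan_term y z T cs ss (ShB k l).
  by rewrite /= eZ /= big_nil mulr1 big_cons e !mulrA.
have [ss e] := even_word ew; have := inspan_term y z T cs ss (ShLU k).
by rewrite /= ePE big_cons e mulrA.
Qed.

Definition combs (P : seq nat * seq (nat * nat) -> Prop) (u : R) : Prop :=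
  exists2 ns : seq (int * term),
    (forall n, n \in [seq (t_evens n.2, t_brks n.2) | n <- ns] -> P n) & u = comb y z ns.

Lemma combs0 P : combs P 0.
Proof. by exists [::] => //; rewrite /comb big_nil. Qed.

Lemma combsD P u v : combs P u -> combs P v -> combs P (u + v).
Proof.
move=> [ns h ->] [ms h' ->]; exists (ns ++ ms); last by rewrite /comb big_cat.
by move=> n; rewrite map_cat mem_cat => /orP[/h|/h'].
Qed.

Lemma combs_inspan (P : seq nat * seq (nat * nat) -> Prop) T cs u :
  P (T, cs) -> inspan T cs u -> combs P u.
Proof. by move=> PT [ns h e]; exists ns => // n /h ->. Qed.

Lemma combs_mulz P i u : (forall T cs, P (T, cs) -> typed T cs) -> combs P u -> combs P (z i * u).
Proof.
move=> Pty [ns h ->]; rewrite /comb; elim: ns h => [|[m [T cs ss sh]] ns IH] h.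
  by rewrite big_nil mulr0; exact: combs0.
rewrite big_cons mulrDr; apply: combsD; last first.
  by apply: IH => n hn; apply: h; rewrite /= in_cons hn orbT.
have PT : P (T, cs) by apply: (h (T, cs)); rewrite /= mem_head.
apply: (combs_inspan PT); apply: (inspan_mulz H Ey Oz (Pty _ _ PT)).
exists [:: (m, Term T cs ss sh)]; last by rewrite /comb big_seq1.
by move=> n; rewrite inE => /eqP.
Qed.

Definition single_brk (n : seq nat * seq (nat * nat)) : Prop := exists p, n = ([::], [:: p]).

(* Sorting a word in the odd variables creates words with one commutator. *)
Lemma sort_word s t : perm_eq s t -> combs single_brk (zw s - zw t).
Proof.
have sty T cs : single_brk (T, cs) -> typed T cs by case=> p [-> ->].
elim/perm_eq_rel => {s t}.
- by move=> s; rewrite subrr; exact: combs0.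
- by move=> s t u st tu; rewrite -(subrK (zw t) (zw s)) -addrA; exact: combsD.
- move=> a b s; have -> : zw [:: a, b & s] - zw [:: b, a & s] = cm (a, b) * zw s.
    by rewrite !big_cons /cm /=; ncr.
  apply: (combs_inspan (T := [::]) (cs := [:: (a, b)])); first by exists (a, b).
  exact: inspan_base.
- by move=> a s t st; rewrite !big_cons -mulrBr; exact: combs_mulz.
Qed.

Definition letter (x : variable) : R := match x with inl i => y i | inr i => z i end.
Definition evens_of (w : seq variable) : seq nat := pmap (fun x => if x is inl i then Some i else None) w.
Definition odds_of (w : seq variable) : seq nat := pmap (fun x => if x is inr i then Some i else None) w.

Lemma word_odd w : evens_of w = [::] -> \prod_(x <- w) letter x = zw (odds_of w).
Proof.
elim: w => [|[i|i] w IH] //=; first by rewrite !big_nil.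
by move=> /IH e; rewrite !big_cons e.
Qed.

Lemma word_inspan w : evens_of w != [::] -> inspan (evens_of w) [::] (\prod_(x <- w) letter x).
Proof.
elim: w => [|[i|i] w IH] //= h; rewrite big_cons /=.
  have [e|e] := eqVneq (evens_of w) [::].
    by rewrite (word_odd e) e; apply: inspan_base.
  by apply: (inspan_muly H Ey Oz) (IH e); rewrite /typed e.
by apply: (inspan_mulz H Ey Oz) (IH h); rewrite /typed h.
Qed.

Lemma word_normal w : exists2 ns : seq (int * term), all (fun n => basic_term n.2) ns &
  \prod_(x <- w) letter x =
    comb y z ns + (if evens_of w == [::] then zw (sort leq (odds_of w)) else 0).
Proof.
have allB (P : seq nat * seq (nat * nat) -> Prop) (ns : seq (int * term)) :
    (forall n, P n -> basic n.1 n.2) ->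
    (forall n, n \in [seq (t_evens n.2, t_brks n.2) | n <- ns] -> P n) -> all (fun n => basic_term n.2) ns.
  move=> hP h; rewrite -[all _ _](all_map (fun n : int * term => (t_evens n.2, t_brks n.2)) (fun n => basic n.1 n.2)).
  by apply/allP => n /h /hP.
have [e|e] := eqVneq (evens_of w) [::].
  have p : perm_eq (odds_of w) (sort leq (odds_of w)) by rewrite perm_sym perm_sort.
  have [ns h eq] := sort_word p.
  exists ns; last by rewrite (word_odd e) -eq subrK.
  by apply: allB h => _ [q ->].
have [ns h eq] := word_inspan e; exists ns; last by rewrite addr0.
by apply: allB h => _ ->; rewrite /basic (negbTE e).
Qed.

End WordForm.

(** * The free algebra and its quotients *)

Lemma free_scalerAr (K : fieldType) (c : K) (f g : free_algebra K) : c *: (f * g) = f * (c *: g).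
Proof.
have e : f * c%:MP = c *: f.
  rewrite malgM_def fgmulgU malgZ_def; apply: eq_bigr => k _.
  by rewrite mulm1 mulrC.
by rewrite -[in RHS]mul_malgC mulrA e scalerAl.
Qed.

(* An alias: {malg _} already has a canonical algebra structure, which requires
   commutative monomials. *)
Definition free_alg (K : fieldType) : Type := free_algebra K.

HB.instance Definition _ (K : fieldType) := GRing.Lalgebra.on (free_alg K).
HB.instance Definition _ (K : fieldType) :=
  GRing.Lalgebra_isAlgebra.Build K (free_alg K) (@free_scalerAr K).

Section Eval.
Variables (K : fieldType) (A : algType K) (v : variable -> A).

Lemma evalE f : eval v f = \sum_(w <- msupp f) f@_w *: \prod_(x <- (w : {fmonom variable})) v x.
Proof. by rewrite /eval mmapE; apply: eq_bigr => w _; rewrite /= mulr_algl. Qed.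

Definition word_prod (w : {fmonom variable}) : A := \prod_(x <- w) v x.

Lemma word_mmorphism : mmorphism word_prod.
Proof.
split; last by rewrite /word_prod fm1 big_nil.
by move=> u w; rewrite /word_prod fmM big_cat.
Qed.

HB.instance Definition _ := monalg.isMultiplicative.Build {fmonom variable} A word_prod word_mmorphism.

Lemma eval_multiplicative : multiplicative (eval v).
Proof.
apply: (@commr_mmap_is_multiplicative _ _ _ (in_alg A) word_prod) => g m m'.
by rewrite /GRing.comm /= mulr_algl mulr_algr.
Qed.

HB.instance Definition _ := GRing.isAdditive.Build (free_algebra K) A (eval v) (@mmap_is_additive _ _ _ _ _).
HB.instance Definition _ := GRing.isMultiplicative.Build (free_algebra K) A (eval v) eval_multiplicative.

Lemma eval_scalable : scalable (eval v).
Proof.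
move=> c f; have := mmapZ (f := in_alg A) (h := word_prod) c f.
by rewrite /= mulr_algl.
Qed.

HB.instance Definition _ := GRing.isScalable.Build K (free_algebra K) A *:%R (eval v) eval_scalable.

Lemma eval_gen x : eval v (gen K x) = v x.
Proof. by rewrite /eval /gen mmapU /= scale1r mul1r fmU big_seq1. Qed.

End Eval.

Section FreeAlgebra.
Variable K : fieldType.
Local Notation F := (free_algebra K).

Lemma word_gen (w : {fmonom variable}) : << w >> = \prod_(x <- w) gen K x.
Proof.
have [s es] : exists s, s = w :> seq variable by exists w.
rewrite -es; elim: s w es => [|x s IH] w es.
  rewrite big_nil; apply/malgP => k; rewrite mcoeff1 mcoeffU eq_sym.
  by have -> : w = mone by apply: val_inj; rewrite /= -es fm1.
rewrite big_cons -(IH (FMonom s)) //= /gen malgM_def fgmulUU mulr1; congr (mkmalgU _ _).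
by apply: val_inj; rewrite /= fmM fmU.
Qed.

Lemma free_expansion (f : F) : f = \sum_(w <- msupp f) f@_w *: \prod_(x <- (w : {fmonom variable})) gen K x.
Proof.
rewrite [LHS]monalgE; apply: eq_bigr => w _; rewrite -word_gen.
by apply/malgP => k; rewrite mcoeffZ !mcoeffU mulrnAr mulr1.
Qed.

Lemma lrmorphism_eval (A : algType K) (phi : {lrmorphism F -> A}) (f : F) :
  phi f = eval (fun x => phi (gen K x)) f.
Proof.
rewrite {1}[f]free_expansion linear_sum evalE; apply: eq_bigr => w _.
by rewrite linearZ rmorph_prod.
Qed.

End FreeAlgebra.

Definition substitute (K : fieldType) (g : variable -> free_algebra K) :
  free_algebra K -> free_algebra K := @eval K (free_alg K) g.

Section Substitute.
Variables (K : fieldType) (g : variable -> free_algebra K).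
Local Notation F := (free_algebra K).

Lemma substitute_additive : additive (substitute g).
Proof. exact: (raddfB (@eval K (free_alg K) g)). Qed.
Lemma substitute_multiplicative : multiplicative (substitute g).
Proof. exact: (@eval_multiplicative K (free_alg K) g). Qed.
Lemma substitute_scalable : scalable (substitute g).
Proof. exact: (@eval_scalable K (free_alg K) g). Qed.

HB.instance Definition _ := GRing.isAdditive.Build F F (substitute g) substitute_additive.
HB.instance Definition _ := GRing.isMultiplicative.Build F F (substitute g) substitute_multiplicative.
HB.instance Definition _ := GRing.isScalable.Build K F F *:%R (substitute g) substitute_scalable.

Lemma substitute_gen x : substitute g (gen K x) = g x.
Proof. exact: (@eval_gen K (free_alg K) g). Qed.

End Substitute.

(** * The quotient of the free algebra by a proper ideal *)

Record proper_ideal_pred (K : fieldType) := ProperIdealPred {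
  pip_pred :> free_algebra K -> Prop;
  pip_ideal : is_ideal pip_pred;
  pip_proper : ~ pip_pred 1
}.

Section QuotientAlgebra.
Variables (K : fieldType) (I : proper_ideal_pred K).
Local Notation F := (free_algebra K).

Definition in_ideal : {pred F} :=
  fun f => if excluded_middle_informative (I f) then true else false.

Lemma in_idealP f : reflect (I f) (f \in in_ideal).
Proof. by rewrite unfold_in; case: excluded_middle_informative => h; constructor. Qed.

Lemma in_ideal_zmod_closed : zmod_closed in_ideal.
Proof.
have [[I0 IZ] _] := pip_ideal I; split=> [|f g]; first exact/in_idealP.
move=> /in_idealP If /in_idealP Ig; apply/in_idealP.
by rewrite addrC -scaleN1r; apply: IZ.
Qed.

HB.instance Definition _ := GRing.isZmodClosed.Build F in_ideal in_ideal_zmod_closed.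

Definition quot_alg : Type := Quotient.quot (in_ideal : zmodClosed F).

HB.instance Definition _ := GRing.Zmodule.on quot_alg.

Definition qpi (f : F) : quot_alg := \pi_(Quotient.quot (in_ideal : zmodClosed F))%qT f.
Definition qrepr (x : quot_alg) : F := repr x.

Lemma qreprK x : qpi (qrepr x) = x. Proof. exact: reprK. Qed.

Lemma qpi_eq f g : qpi f = qpi g <-> I (f - g).
Proof.
have e := Quotient.idealrBE (in_ideal : zmodClosed F) f g.
split=> [h|h]; first by apply/in_idealP; apply: (etrans e); apply/eqP.
by apply/eqP; apply: (etrans (esym e)); apply/in_idealP.
Qed.

Lemma qpiD f g : qpi (f + g) = qpi f + qpi g.
Proof. exact: (raddfD \pi_(Quotient.quot (in_ideal : zmodClosed F))%qT). Qed.

Lemma qpi0 : qpi 0 = 0.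
Proof. exact: (raddf0 \pi_(Quotient.quot (in_ideal : zmodClosed F))%qT). Qed.

Definition qmul (x y : quot_alg) : quot_alg := qpi (qrepr x * qrepr y).
Definition qscale (c : K) (x : quot_alg) : quot_alg := qpi (c *: qrepr x).

Lemma qpiM f g : qpi (f * g) = qmul (qpi f) (qpi g).
Proof.
apply/qpi_eq; have [[I0 IZ] IM] := pip_ideal I.
set f' := qrepr _; set g' := qrepr _.
have If : I (f - f') by apply/qpi_eq; rewrite qreprK.
have Ig : I (g - g') by apply/qpi_eq; rewrite qreprK.
have -> : f * g - f' * g' = 1 *: ((f - f') * g) + f' * (g - g').
  by rewrite scale1r mulrBl mulrBr addrA subrK.
by apply: IZ; [apply: (IM _ _ If).2 | apply: (IM _ _ Ig).1].
Qed.

Lemma qpiZ c f : qpi (c *: f) = qscale c (qpi f).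
Proof.
apply/qpi_eq; have [[I0 IZ] IM] := pip_ideal I.
have If : I (f - qrepr (qpi f)) by apply/qpi_eq; rewrite qreprK.
by rewrite -scalerBr -[_ *: _]addr0; apply: IZ.
Qed.

Lemma qind (P : quot_alg -> Prop) : (forall f, P (qpi f)) -> forall x, P x.
Proof. by move=> h x; rewrite -(qreprK x). Qed.

Lemma qmulA : associative qmul.
Proof. by elim/qind=> f; elim/qind=> g; elim/qind=> h; rewrite -!qpiM mulrA. Qed.
Lemma qmul1x : left_id (qpi 1) qmul.
Proof. by elim/qind=> f; rewrite -qpiM mul1r. Qed.
Lemma qmulx1 : right_id (qpi 1) qmul.
Proof. by elim/qind=> f; rewrite -qpiM mulr1. Qed.
Lemma qmulDl : left_distributive qmul +%R.
Proof. by elim/qind=> f; elim/qind=> g; elim/qind=> h; rewrite -!(qpiM, qpiD) mulrDl. Qed.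
Lemma qmulDr : right_distributive qmul +%R.
Proof. by elim/qind=> f; elim/qind=> g; elim/qind=> h; rewrite -!(qpiM, qpiD) mulrDr. Qed.
Lemma q1_neq0 : qpi 1 != 0.
Proof. by apply/eqP; rewrite -qpi0 => /qpi_eq; rewrite subr0; exact: pip_proper. Qed.

HB.instance Definition _ := GRing.Zmodule_isNzRing.Build quot_alg
  qmulA qmul1x qmulx1 qmulDl qmulDr q1_neq0.

Lemma qscaleA a b x : qscale a (qscale b x) = qscale (a * b) x.
Proof. by elim/qind: x => f; rewrite -!qpiZ scalerA. Qed.
Lemma qscale1 : left_id 1 qscale.
Proof. by elim/qind=> f; rewrite -qpiZ scale1r. Qed.
Lemma qscaleDr : right_distributive qscale +%R.
Proof. by move=> c; elim/qind=> f; elim/qind=> g; rewrite -!(qpiD, qpiZ) scalerDr. Qed.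
Lemma qscaleDl x : {morph qscale^~ x : a b / a + b}.
Proof. by move=> a b; elim/qind: x => f; rewrite -!(qpiD, qpiZ) scalerDl. Qed.

HB.instance Definition _ := GRing.Zmodule_isLmodule.Build K quot_alg
  qscaleA qscale1 qscaleDr qscaleDl.

Lemma qscaleAl c (x y : quot_alg) : c *: (x * y) = (c *: x) * y.
Proof.
elim/qind: x => f; elim/qind: y => g.
change (qscale c (qmul (qpi f) (qpi g)) = qmul (qscale c (qpi f)) (qpi g)).
by rewrite -!(qpiM, qpiZ) scalerAl.
Qed.

Lemma qscaleAr c (x y : quot_alg) : c *: (x * y) = x * (c *: y).
Proof.
elim/qind: x => f; elim/qind: y => g.
change (qscale c (qmul (qpi f) (qpi g)) = qmul (qpi f) (qscale c (qpi g))).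
by rewrite -!(qpiM, qpiZ) free_scalerAr.
Qed.

HB.instance Definition _ := GRing.Lmodule_isLalgebra.Build K quot_alg qscaleAl.
HB.instance Definition _ := GRing.Lalgebra_isAlgebra.Build K quot_alg qscaleAr.

Lemma qpi_additive : additive qpi.
Proof. exact: (raddfB \pi_(Quotient.quot (in_ideal : zmodClosed F))%qT). Qed.
Lemma qpi_multiplicative : multiplicative qpi.
Proof. by split; [exact: qpiM | exact: erefl]. Qed.

HB.instance Definition _ := GRing.isAdditive.Build F quot_alg qpi qpi_additive.
HB.instance Definition _ := GRing.isMultiplicative.Build F quot_alg qpi qpi_multiplicative.
HB.instance Definition _ := GRing.isScalable.Build K F quot_alg *:%R qpi qpiZ.

End QuotientAlgebra.

Lemma s3E (R : pzRingType) (a b c : R) :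
  s3 a b c = brk a b * c + brk b c * a + brk c a * b.
Proof.
have tpE (i j k : 'I_3) : tperm i j k = if k == i then j else if k == j then i else k.
  by rewrite permE.
pose i0 : 'I_3 := ord0; pose i1 : 'I_3 := inord 1; pose i2 : 'I_3 := inord 2.
have v1 : val i1 = 1%N by rewrite /= inordK.
have v2 : val i2 = 2%N by rewrite /= inordK.
have n01 : i0 == i1 = false by rewrite -val_eqE v1.
have n02 : i0 == i2 = false by rewrite -val_eqE v2.
have n12 : i1 == i2 = false by rewrite -val_eqE v1 v2.
have n10 : i1 == i0 = false by rewrite eq_sym.
have n20 : i2 == i0 = false by rewrite eq_sym.
have n21 : i2 == i1 = false by rewrite eq_sym.
(* These are all permutations: they are distinct because their values at 0 and 1 are, and there are
   six of them. *)
pose L : seq 'S_3 := [:: 1%g; tperm i0 i1; tperm i1 i2; tperm i0 i2;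
  (tperm i0 i1 * tperm i1 i2)%g; (tperm i1 i2 * tperm i0 i1)%g].
pose simp := (tpE, permM, perm1, eqxx, n01, n02, n12, n10, n20, n21).
have uL : uniq L.
  apply: (@map_uniq _ _ (fun s : 'S_3 => (s i0, s i1))).
  by rewrite /= !simp /= !inE !xpair_eqE !simp.
have LT (s : 'S_3) : s \in L.
  have sz : #|L| = #|{: 'S_3}| by rewrite (card_uniqP uL) card_Sn.
  by have /subset_cardP/(_ (subset_predT _))-> := sz.
rewrite /s3 (eq_bigl (fun s => s \in L)) => [|s]; last by rewrite LT.
rewrite -big_uniq //= !big_cons big_nil.
have ordE (F : 'I_3 -> R) : \prod_(i < 3) F i = F i0 * F i1 * F i2.
  rewrite !big_ord_recl big_ord0 mulr1 mulrA; congr (_ * F _ * F _); apply: val_inj;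
  by rewrite /= ?inordK.
rewrite !ordE !simp !odd_permM !odd_tperm odd_perm1 !simp /= v1 v2 /=.
rewrite !expr0 !expr1; ncr.
Qed.

Lemma rmorph_brk (R S : pzRingType) (e : {rmorphism R -> S}) a b :
  e (brk a b) = brk (e a) (e b).
Proof. by rewrite /brk rmorphB !rmorphM. Qed.

(** * Weak identities of a graded pair form a weak ideal *)

Section WeakIdentities.
Variables (K : fieldType) (P : graded_pair K).
Local Notation F := (free_algebra K).

(** For 1 = a0 + a1 the product a0 a1 is odd and also even, being a0 - a0 a0, so it vanishes; then
    a1 = a1 a1 is even too and vanishes. *)
Lemma gp_comp1 : gp_comp false (1 : P).
Proof.
have [a0 [a1 [c0 c1 e]]] := gp_comp_sum (1 : P).
have sub d (a b : P) : gp_comp d a -> gp_comp d b -> gp_comp d (a - b).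
  move=> ca cb; have [_ h] := gp_comp_subspace P d.
  by rewrite addrC -scaleN1r; exact: h.
have z01 : a0 * a1 = 0.
  apply: gp_comp_direct; last exact: (gp_comp_mul c0 c1).
  have -> : a0 * a1 = a0 - a0 * a0 by rewrite -{2}[a0]mulr1 e mulrDr addrC addKr.
  by apply: sub => //; exact: (gp_comp_mul c0 c0).
have z1 : a1 = 0.
  apply: gp_comp_direct => //.
  by rewrite -[a1]mul1r e mulrDl z01 add0r; exact: (gp_comp_mul c1 c1).
by rewrite e z1 addr0.
Qed.

Lemma eval_comp (v : variable -> P) : (forall x, gp_comp (odd_variable x) (v x)) ->
  forall d (f : F), free_comp d f -> gp_comp d (eval v f).
Proof.
move=> hv d f hf; rewrite evalE.
have [h0 hD] := gp_comp_subspace P d.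
rewrite big_seq; elim/big_rec: _ => [//|w a wf ca]; apply: hD => //.
rewrite -(hf w wf); have [s ->] : exists s, (w : seq variable) = s by exists w.
elim: s => [|x s IH]; first by rewrite big_nil; exact: gp_comp1.
by rewrite big_cons /= oddD oddb; exact: gp_comp_mul.
Qed.

Lemma eval_lie (v : variable -> P) : (forall x, gp_lie (v x)) ->
  forall f : F, free_lie f -> gp_lie (eval v f).
Proof.
move=> hv f hf; apply: (hf (fun g => gp_lie (eval v g))); last first.
  by move=> x; rewrite eval_gen.
have [[h0 hD] hB] := gp_lie_subalgebra P; split; first split.
- by rewrite raddf0.
- by move=> c a b ha hb; rewrite linearP; exact: hD.
- by move=> a b ha hb; rewrite [eval v _](rmorph_brk (eval v)); exact: hB.
Qed.

(** Evaluating homogeneous Lie elements gives homogeneous elements of the Lie subalgebra, so an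
    admissible substitution followed by an admissible evaluation is again an admissible
    evaluation. *)
Lemma T2_ideal : is_weak_T2_ideal (T2 P).
Proof.
split; first split; first split.
- by move=> v _; rewrite raddf0.
- by move=> c f g hf hg v hv; rewrite linearP /= hf ?hg // scaler0 addr0.
- by move=> f g hf; split=> v hv; rewrite rmorphM /= hf // ?mulr0 ?mul0r.
move=> phi hphi f hf v hv.
rewrite [LHS](lrmorphism_eval (eval v \o phi)); apply: hf => x /=.
have [h1 h2] := hphi x; split.
- by apply: eval_comp => // z; have [] := hv z.
- by apply: eval_lie => // z; have [] := hv z.
Qed.

End WeakIdentities.

Section FreeLie.
Variable K : fieldType.
Local Notation F := (free_algebra K).

Lemma free_lie_gen x : free_lie_comp (odd_variable x) (gen K x).
Proof.
split; last by move=> P _; exact.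
by move=> w; rewrite /gen msuppU1 inE => /eqP->; rewrite fmU /= addn0 oddb.
Qed.

Lemma free_lie_subalgebra : is_lie_subalgebra (@free_lie K).
Proof.
split; first split.
- by move=> P [[]].
- by move=> c f g hf hg P hP hx; have [[_ h] _] := hP; apply: h; [exact: hf | exact: hg].
- by move=> f g hf hg P hP hx; have [_ h] := hP; apply: h; [exact: hf | exact: hg].
Qed.

Lemma free_comp_subspace d : is_subspace (@free_comp K d).
Proof.
split=> [w|c f g hf hg w]; first by rewrite msupp0.
move/(fsubsetP (msuppD_le _ _)); rewrite in_fsetU => /orP[|/hg //].
by move/(fsubsetP (msuppZ_le _ _))/hf.
Qed.

Lemma free_comp_mul d e (f g : F) :
  free_comp d f -> free_comp e g -> free_comp (d (+) e) (f * g).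
Proof.
move=> hf hg w /msuppM_le[w1 [w2 [/hf h1 /hg h2 ->]]].
by rewrite fmM count_cat oddD h1 h2.
Qed.

Lemma free_lie_comp_subspace d : is_subspace (@free_lie_comp K d).
Proof.
have [[l0 lD] _] := free_lie_subalgebra; have [c0 cD] := free_comp_subspace d.
split=> // c f g [cf lf] [cg lg]; split; [exact: cD | exact: lD].
Qed.

Lemma free_lie_comp_brk d e (f g : F) :
  free_lie_comp d f -> free_lie_comp e g -> free_lie_comp (d (+) e) (brk f g).
Proof.
move=> [cf lf] [cg lg]; have [_ lB] := free_lie_subalgebra; split; last exact: lB.
have [c0 cD] := free_comp_subspace (d (+) e).
rewrite /brk addrC -scaleN1r; apply: cD; last exact: free_comp_mul.
by rewrite addbC; exact: free_comp_mul.
Qed.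

Variable G : F -> Prop.

Lemma generated_ideal : is_weak_T2_ideal (weak_T2_ideal_generated G).
Proof.
split; first split; first split.
- by move=> I [[[h _] _] _] _.
- move=> c f g hf hg I hI hG; have [[[_ h] _] _] := hI.
  by apply: h; [exact: hf | exact: hg].
- by move=> f g hf; split=> I hI hG; have [[_ h] _] := hI;
    have [] := h f g (hf I hI hG).
move=> phi hphi f hf I hI hG; have [_ h] := hI; apply: h => //; exact: hf.
Qed.

Lemma generated_mem f : G f -> weak_T2_ideal_generated G f.
Proof. by move=> hf I _; exact. Qed.

Lemma generated_substitute (y z : nat -> F) f :
  (forall i, free_lie_comp false (y i)) -> (forall i, free_lie_comp true (z i)) ->
  weak_T2_ideal_generated G f ->
  weak_T2_ideal_generated G (substitute (letter y z) f).
Proof.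
move=> hy hz hf; have [_ h] := generated_ideal; apply: h => // x.
by rewrite /= substitute_gen; case: x.
Qed.

End FreeLie.

(** * Evaluation on matrices *)

Section ExplicitMatrices.
Variable K : fieldType.
Local Notation M := 'M[K]_3.

Definition mx33 (a b c d e f g h i : K) : M :=
  \matrix_(r < 3, s < 3) nth 0 (nth [::] [:: [:: a; b; c]; [:: d; e; f]; [:: g; h; i]] r) s.

Ltac mx3 := apply/matrixP => - [[|[|[|//]]] ?] [[|[|[|//]]] ?]; rewrite -?mulmxE;
  rewrite !mxE ?big_ord_recl ?big_ord0 ?mxE /= ?addr0 ?addrA //.

Lemma mx33M a b c d e f g h i a' b' c' d' e' f' g' h' i' :
  mx33 a b c d e f g h i * mx33 a' b' c' d' e' f' g' h' i' =
  mx33 (a * a' + b * d' + c * g') (a * b' + b * e' + c * h') (a * c' + b * f' + c * i')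
       (d * a' + e * d' + f * g') (d * b' + e * e' + f * h') (d * c' + e * f' + f * i')
       (g * a' + h * d' + i * g') (g * b' + h * e' + i * h') (g * c' + h * f' + i * i').
Proof. mx3. Qed.

Lemma mx33D a b c d e f g h i a' b' c' d' e' f' g' h' i' :
  mx33 a b c d e f g h i + mx33 a' b' c' d' e' f' g' h' i' =
  mx33 (a + a') (b + b') (c + c') (d + d') (e + e') (f + f') (g + g') (h + h') (i + i').
Proof. mx3. Qed.

Lemma mx33N a b c d e f g h i :
  - mx33 a b c d e f g h i = mx33 (- a) (- b) (- c) (- d) (- e) (- f) (- g) (- h) (- i).
Proof. mx3. Qed.

Lemma mx33_scalar a : mx33 a 0 0 0 a 0 0 0 a = a%:M.
Proof. mx3. Qed.

Lemma ad_sl2E a m n :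
  ad_sl2 a m n = mx33 0 (- n) m (- (2 * m)) (2 * a) 0 (2 * n) 0 (- (2 * a)).
Proof. by []. Qed.

End ExplicitMatrices.

Section BasisIdentities.
Variable K : fieldType.
Hypothesis two_neq0 : (2 : K) != 0.
Local Notation M := 'M[K]_3.
Local Notation Y a := (ad_sl2 a 0 0).
Local Notation Z m n := (ad_sl2 0 m n).

Let o1 : 'I_3 := Ordinal (isT : (1 < 3)%N).
Let o2 : 'I_3 := Ordinal (isT : (2 < 3)%N).

Lemma pair_MS_even (A : pair_MS K) : gp_lie_comp false A -> exists a, A = Y a.
Proof.
move=> [hA [a [m [n e]]]]; exists a; rewrite e; move: hA; rewrite e => hA.
have := hA ord0 o2 isT; rewrite mxE /= => ->.
by have := hA ord0 o1 isT; rewrite mxE /= => /eqP; rewrite oppr_eq0 => /eqP->.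
Qed.

Lemma pair_MS_odd (A : pair_MS K) : gp_lie_comp true A -> exists m n, A = Z m n.
Proof.
move=> [hA [a [m [n e]]]]; exists m, n; rewrite e; move: hA; rewrite e => hA.
have := hA o1 o1 isT; rewrite mxE /= => /eqP.
by rewrite mulf_eq0 (negbTE two_neq0) => /eqP->.
Qed.

Definition mx33E := (mx33M, mx33D, mx33N).

Ltac mx33_ring := rewrite /brk !ad_sl2E !mx33E -?mx33_scalar; congr (mx33 _ _ _ _ _ _ _ _ _); ring.

Lemma adjoint_identity1 a b : brk (Y a) (Y b) = 0%:M :> M. Proof. mx33_ring. Qed.
Lemma adjoint_identity2 a m n b : Y a * Z m n * Y b = 0%:M :> M. Proof. mx33_ring. Qed.
Lemma adjoint_identity3 a m n p q : Z m n * Y a * Z p q + Z p q * Y a * Z m n = 0%:M :> M. Proof. mx33_ring. Qed.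
Lemma adjoint_identity5 a m n p q b : Y a * Z m n * Z p q * Y b - Y b * Z m n * Z p q * Y a = 0%:M :> M. Proof. mx33_ring. Qed.
Lemma adjoint_identity6 a m n p q b : Z m n * Y a * Y b * Z p q - Z p q * Y a * Y b * Z m n = 0%:M :> M. Proof. mx33_ring. Qed.

Lemma adjoint_identity4 a b c d p q : s3 (Z a b) (Z c d) (Z p q) = 0%:M :> M.
Proof. rewrite s3E; mx33_ring. Qed.
Lemma adjoint_identity7 a b c d y : exists k, s3 (Z a b) (Z c d) (Y y) = k%:M :> M.
Proof. exists (8 * (a * d - b * c) * y); rewrite s3E; mx33_ring. Qed.

End BasisIdentities.

(* Stated for a morphism of abstract rings: rewriting inside {malg _} would make
   Rocq compare distinct products of letters by unfolding the multiplication. *)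
Lemma rmorph_MS_basis (R S : pzRingType) (e : {rmorphism R -> S})
    (y1 y2 z1 z2 z3 x : R) (u1 u2 w1 w2 w3 t : S) :
  e y1 = u1 -> e y2 = u2 -> e z1 = w1 -> e z2 = w2 -> e z3 = w3 -> e x = t ->
  [/\ [/\ e (brk y1 y2) = brk u1 u2, e (y1 * z1 * y2) = u1 * w1 * u2 &
       e (z1 * y1 * z2 + z2 * y1 * z1) = w1 * u1 * w2 + w2 * u1 * w1],
    e (s3 z1 z2 z3) = s3 w1 w2 w3,
    e (y1 * z1 * z2 * y2 - y2 * z1 * z2 * y1) = u1 * w1 * w2 * u2 - u2 * w1 * w2 * u1,
    e (z1 * y1 * y2 * z2 - z2 * y1 * y2 * z1) = w1 * u1 * u2 * w2 - w2 * u1 * u2 * w1 &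
    e (s3 z1 z2 y1 * x - x * s3 z1 z2 y1) = s3 w1 w2 u1 * t - t * s3 w1 w2 u1].
Proof.
move=> e1 e2 e3 e4 e5 e6; rewrite !s3E /brk !(rmorphD, rmorphN, rmorphM) /=.
by rewrite e1 e2 e3 e4 e5 e6.
Qed.

Lemma eval_MS_basis (K : fieldType) (A : algType K) (v : variable -> A) g :
  let y i := v (inl i) in let z i := v (inr i) in
  brk (y 1%N) (y 2%N) = 0 -> y 1%N * z 1%N * y 2%N = 0 ->
  z 1%N * y 1%N * z 2%N + z 2%N * y 1%N * z 1%N = 0 ->
  s3 (z 1%N) (z 2%N) (z 3%N) = 0 ->
  y 1%N * z 1%N * z 2%N * y 2%N - y 2%N * z 1%N * z 2%N * y 1%N = 0 ->
  z 1%N * y 1%N * y 2%N * z 2%N - z 2%N * y 1%N * y 2%N * z 1%N = 0 ->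
  (forall x, GRing.comm (s3 (z 1%N) (z 2%N) (y 1%N)) (v x)) ->
  MS_basis g -> eval v g = 0.
Proof.
move=> y z h1 h2 h3 h4 h5 h6 h7.
have relations x := rmorph_MS_basis (e := eval v) (eval_gen v (inl 1%N)) (eval_gen v (inl 2%N))
  (eval_gen v (inr 1%N)) (eval_gen v (inr 2%N)) (eval_gen v (inr 3%N)) (eval_gen v x).
have [[r1 r2 r3] r4 r5 r6 _] := relations (inl 0%N).
case; [exact: etrans r1 h1|exact: etrans r2 h2|exact: etrans r3 h3|exact: etrans r4 h4|
  exact: etrans r5 h5|exact: etrans r6 h6|move=> x].
have [_ _ _ _ r7] := relations x.
by apply: (etrans r7); have -> := h7 x; rewrite subrr.
Qed.

(** * The generated ideal and the relations in its quotient *)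

Section GeneratedIdeal.
Variable K : fieldType.
Hypothesis char0 : [pchar K] =i pred0.

Lemma two_neq0 : (2 : K) != 0.
Proof. by have := char0 2; rewrite !inE /= => ->. Qed.

Lemma MS_basis_T2 g : MS_basis g -> T2 (pair_MS K) g.
Proof.
move=> hg v hv.
have hy i : exists a, v (inl i) = ad_sl2 a 0 0 by apply: pair_MS_even; exact: (hv (inl i)).
have hz i : exists m n, v (inr i) = ad_sl2 0 m n.
  by apply: (pair_MS_odd two_neq0); exact: (hv (inr i)).
have [y1 ey1] := hy 1%N; have [y2 ey2] := hy 2%N.
have [m1 [n1 ez1]] := hz 1%N; have [m2 [n2 ez2]] := hz 2%N; have [m3 [n3 ez3]] := hz 3%N.
have M0 : (0 : 'M[K]_3) = 0%:M by rewrite raddf0.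
move: hg; apply: eval_MS_basis; rewrite ?(ey1, ey2, ez1, ez2, ez3).
- exact: etrans (adjoint_identity1 _ _) (esym M0).
- exact: etrans (adjoint_identity2 _ _ _ _) (esym M0).
- exact: etrans (adjoint_identity3 _ _ _ _ _) (esym M0).
- exact: etrans (adjoint_identity4 _ _ _ _ _ _) (esym M0).
- exact: etrans (adjoint_identity5 _ _ _ _ _ _) (esym M0).
- exact: etrans (adjoint_identity6 _ _ _ _ _ _) (esym M0).
move=> x; have [k ek] := adjoint_identity7 m1 n1 m2 n2 y1; rewrite /GRing.comm [s3 _ _ _]ek.
exact: (esym (scalar_mxC k (v x : 'M[K]_3))).
Qed.

Lemma generated_T2 f : weak_T2_ideal_generated (@MS_basis K) f -> T2 (pair_MS K) f.
Proof. by move=> hf; apply: (hf _ (T2_ideal (pair_MS K))) => g; exact: MS_basis_T2. Qed.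

Lemma T2_proper : ~ T2 (pair_MS K) 1.
Proof.
move=> h; have e0 := h (fun=> 0); rewrite rmorph1 in e0.
have l0 : S_lie (0 : 'M[K]_3) by exact: (S_lie_subalgebra K).1.1.
have /eqP : (1 : 'M[K]_3) = 0.
  by apply: e0 => x; split; [exact: (M_comp_subspace K (odd_variable x)).1 | exact: l0].
by rewrite oner_eq0.
Qed.

Definition MS_ideal : proper_ideal_pred K.
Proof.
apply: (@ProperIdealPred K (weak_T2_ideal_generated (@MS_basis K))).
- by have [] := generated_ideal (@MS_basis K).
- by move/generated_T2; exact: T2_proper.
(* Transparent, so that membership unfolds to [weak_T2_ideal_generated]. *)
Defined.

Local Notation Q := (quot_alg MS_ideal).

Definition lie_image (d : bool) (q : Q) : Prop :=
  exists2 f, free_lie_comp d f & q = qpi MS_ideal f.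

(** The ideal is stable under substituting homogeneous Lie elements, so each generator gives a
    relation among the images of all such elements, commutators included. *)
Lemma MS_relation (y1 y2 z1 z2 z3 : Q) :
  lie_image false y1 -> lie_image false y2 ->
  lie_image true z1 -> lie_image true z2 -> lie_image true z3 ->
  [/\ brk y1 y2 = 0, y1 * z1 * y2 = 0, z1 * y1 * z2 + z2 * y1 * z1 = 0,
    s3 z1 z2 z3 = 0 & y1 * z1 * z2 * y2 - y2 * z1 * z2 * y1 = 0].
Proof.
move=> [f1 hf1 e1] [f2 hf2 e2] [g1 hg1 e3] [g2 hg2 e4] [g3 hg3 e5].
pose y i := if i == 1%N then f1 else f2.
pose z i := if i == 1%N then g1 else if i == 2%N then g2 else g3.
pose e : {rmorphism free_algebra K -> Q} := qpi MS_ideal \o substitute (letter y z).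
have e0 g : MS_basis g -> e g = 0.
  move=> /generated_mem hg; rewrite -(rmorph0 (qpi MS_ideal)); apply/qpi_eq.
  rewrite subr0; apply: generated_substitute => // i; first by rewrite /y; case: ifP.
  by rewrite /z; case: ifP => // _; case: ifP.
have eg x : e (gen K x) = qpi MS_ideal (letter y z x) by rewrite /e /= substitute_gen.
have [[r1 r2 r3] r4 r5 _ _] := rmorph_MS_basis (e := e)
  (etrans (eg (inl 1%N)) (esym e1)) (etrans (eg (inl 2%N)) (esym e2))
  (etrans (eg (inr 1%N)) (esym e3)) (etrans (eg (inr 2%N)) (esym e4))
  (etrans (eg (inr 3%N)) (esym e5)) (eg (inl 0%N)).
split.
- exact: etrans (esym r1) (e0 _ (MS_basis1 K)).
- exact: etrans (esym r2) (e0 _ (MS_basis2 K)).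
- exact: etrans (esym r3) (e0 _ (MS_basis3 K)).
- exact: etrans (esym r4) (e0 _ (MS_basis4 K)).
exact: etrans (esym r5) (e0 _ (MS_basis5 K)).
Qed.

Lemma MS_weak_rel : @weak_rel Q (lie_image false) (lie_image true).
Proof.
have brkP d e a b : lie_image d a -> lie_image e b -> lie_image (d (+) e) (brk a b).
  move=> [f hf ->] [g hg ->]; exists (brk f g); first exact: free_lie_comp_brk.
  exact: esym (rmorph_brk (qpi MS_ideal) f g).
have oppP d a : lie_image d a -> lie_image d (- a).
  move=> [f hf ->]; exists (- f); last by rewrite rmorphN.
  have [h0 hD] := @free_lie_comp_subspace K d.
  by rewrite -scaleN1r -[_ *: _]addr0; exact: hD.
have im0 d : lie_image d 0.
  by exists 0; rewrite ?rmorph0 //; exact: (@free_lie_comp_subspace K d).1.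
split.
- exact: brkP.
- exact: brkP.
- exact: brkP.
- exact: oppP.
- exact: oppP.
- move=> x y hx hy; apply/subr0_eq.
  have [r _ _ _ _] := MS_relation hx hy (im0 _) (im0 _) (im0 _); exact: r.
- move=> x a y hx ha hy.
  have [_ r _ _ _] := MS_relation hx hy ha (im0 _) (im0 _); exact: r.
- move=> a y b ha hy hb.
  have [_ _ r _ _] := MS_relation hy (im0 _) ha hb (im0 _); exact: r.
- move=> a b c ha hb hc; rewrite -s3E.
  have [_ _ _ r _] := MS_relation (im0 _) (im0 _) ha hb hc; exact: r.
- move=> x a b y hx ha hb hy; apply/subr0_eq.
  have [_ _ _ _ r] := MS_relation hx hy ha hb (im0 _); exact: r.
move=> x h; have : (2 : K) *: x = 0 by rewrite scaler_nat mulr2n.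
by move/eqP; rewrite scaler_eq0 (negbTE two_neq0) => /eqP.
Qed.

End GeneratedIdeal.

(** * Entries of the terms on generic matrices *)

Section GenericMatrices.
Variable K : fieldType.
Hypothesis two_neq0 : (2 : K) != 0.
Variables (t p q : nat -> K).
Local Notation M := 'M[K]_3.

(** Halving t_i undoes the factor 2 a in [ad_sl2]; the parameters q_i and -p_i of z_i come from its
    first row (0, -n, m). *)
Definition generic_y (i : nat) : M := ad_sl2 (t i / 2) 0 0.
Definition generic_z (i : nat) : M := ad_sl2 0 (q i) (- p i).
Local Notation Y := generic_y.
Local Notation Z := generic_z.
Local Notation diag d a b := (mx33 d 0 0 0 a 0 0 0 b).

Lemma generic_yE i : Y i = diag 0 (t i) (- t i).
Proof. by rewrite /Y ad_sl2E; congr mx33; rewrite ?mulr0 ?oppr0 // mulrCA divff ?mulr1. Qed.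

Lemma generic_zE i : Z i = mx33 0 (p i) (q i) (- (2 * q i)) 0 0 (- (2 * p i)) 0 0.
Proof. by rewrite /Z ad_sl2E; congr mx33; ring. Qed.

Lemma generic_cm c : cm Z c =
  diag 0 (2 * (p c.1 * q c.2 - p c.2 * q c.1)) (- (2 * (p c.1 * q c.2 - p c.2 * q c.1))).
Proof. by rewrite /cm /brk !generic_zE !mx33E; congr mx33; ring. Qed.

Definition even_value (T : seq nat) (cs : seq (nat * nat)) : K :=
  \prod_(i <- T) t i * \prod_(c <- cs) (2 * (p c.1 * q c.2 - p c.2 * q c.1)).
Definition odd_value (ss : seq (nat * nat)) : K :=
  \prod_(x <- ss) (- (2 * (p x.1 * q x.2 + p x.2 * q x.1))).

Lemma generic_PE T cs : PE Y Z T cs =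
  diag (0 ^+ (size T + size cs)) (even_value T cs) ((-1) ^+ (size T + size cs) * even_value T cs).
Proof.
elim: cs => [|c cs IH]; last first.
  rewrite addnS /even_value /PE /evens !big_cons -/(PE Y Z T cs) IH generic_cm mx33M !exprS /even_value.
  by congr mx33; ring.
elim: T => [|i T IH].
  by rewrite /even_value /PE big_nil !big_nil !expr0 !mulr1 mx33_scalar.
rewrite /= addSn /even_value /PE /evens /= !big_cons -/(PE Y Z T [::]) IH generic_yE mx33M !exprS.
by rewrite /even_value; congr mx33; ring.
Qed.

Lemma generic_pairs ss : exists a b c d, pairs Z ss = mx33 (odd_value ss) 0 0 0 a b 0 c d.
Proof.
elim: ss => [|s ss [a [b [c [d IH]]]]].
  by exists 1, 0, 0, 1; rewrite /pairs /odd_value !big_nil mx33_scalar.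
rewrite /pairs big_cons -/(pairs Z ss) IH !generic_zE !mx33M /odd_value big_cons.
by do 4 eexists; congr mx33; ring.
Qed.

Local Notation i0 := (ord0 : 'I_3).
Let i1 : 'I_3 := Ordinal (isT : (1 < 3)%N).
Let i2 : 'I_3 := Ordinal (isT : (2 < 3)%N).

Lemma generic_tval T cs ss sh : basic T cs ->
  let A := tval Y Z (Term T cs ss sh) in
  let G := even_value T cs * odd_value ss in
  let d := (size T + size cs)%N in
  [/\ A i0 i1 = (if sh is ShUL k then G * p k else 0),
    A i1 i0 = (if sh is ShLU k then - 2 * (G * q k) else 0),
    A i0 i0 = (if sh is ShUU l k then - 2 * (G * (p l * q k + (-1) ^+ d * (q l * p k))) else 0),
    A i1 i1 = match sh with
      | ShA k l | ShB k l => - 2 * (G * (q k * p l)) | ShY => even_value T cs | _ => 0 end &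
    A i1 i2 = match sh with
      | ShA k l => - 2 * ((-1) ^+ d * (G * (q k * q l)))
      | ShB k l => 2 * ((-1) ^+ d * (G * (q k * q l)))
      | _ => 0 end].
Proof.
move=> bas A G d.
have [a [b [c [e ep]]]] := generic_pairs ss.
have d0 : (0 : K) ^+ d = 0.
  rewrite /d; move: bas; rewrite /basic; case: (T) => [/eqP ->|? ? /eqP ->]; by rewrite ?addSn exprS mul0r.
have ePE := generic_PE T cs; rewrite -/d d0 in ePE.
case: sh @A => [k|k|l k|k l|k l|] /=.
- by rewrite ep ePE generic_zE !mx33M; split; rewrite mxE /= /G; ring.
- by rewrite ep ePE generic_zE !mx33M; split; rewrite mxE /= /G; ring.
- by rewrite ep ePE !generic_zE !mx33M; split; rewrite mxE /= /G; ring.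
- by rewrite ep ePE !generic_zE !mx33M; split; rewrite mxE /= /G; ring.
(* The first even factor and the product of the remaining ones are recorded separately; their last
   diagonal entries carry the signs -1 and (-1)^(d-1). *)
- have [h [h' [r [ev e']]]] : exists h h' r, sandwich (evens Y Z T cs) (Z k * pairs Z ss * Z l)
      = diag 0 h (- h) * (Z k * pairs Z ss * Z l) * diag r h' (- (-1) ^+ d * h') /\ h * h' = even_value T cs.
    rewrite /d /even_value; move: bas; rewrite /basic; case: (T) => [|i T'] /= /eqP.
    + case: (cs) => [//|x [|//]] _; rewrite /evens /=.
      exists (2 * (p x.1 * q x.2 - p x.2 * q x.1)), 1, 1.
      rewrite -generic_cm add0n expr1 opprK !mulr1 mx33_scalar !big_nil big_seq1; split=> //.
      by rewrite mul1r.
    + move=> ->; rewrite /evens /=; exists (t i), (even_value T' [::]), (0 ^+ size T').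
      have := generic_PE T' [::]; rewrite /PE /evens /= => ->.
      rewrite !addn0 exprS mulN1r opprK -generic_yE; split=> //.
      by rewrite /even_value !big_nil big_cons; ring.
  rewrite ev ep !generic_zE !mx33M; split; rewrite mxE /= /G -?e'; ring.
- by rewrite ePE; split; rewrite mxE /=.
Qed.

End GenericMatrices.

Lemma generic_tval0 (K : fieldType) (x : nat -> K) n : (2 : K) != 0 -> basic_term n ->
  tval (generic_y (fun=> 0)) (generic_z x x) n = 0.
Proof.
move=> two_neq0; case: n => T cs ss sh; rewrite /basic_term /basic /=.
have mx0 : mx33 0 0 0 0 0 0 0 0 0 = 0 :> 'M[K]_3 by rewrite mx33_scalar raddf0.
have y0 i : generic_y (fun=> 0) i = 0 :> 'M[K]_3 by rewrite generic_yE // oppr0 mx0.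
have c0 c : cm (generic_z x x) c = 0.
  by rewrite generic_cm (mulrC (x c.2)) subrr mulr0 oppr0 mx0.
case: T => [|i T] /eqP.
  case: cs => [//|c [|//]] _; have E0 : PE (generic_y (fun=> 0)) (generic_z x x) [::] [:: c] = 0.
    by rewrite /PE /evens big_cons c0 mul0r.
  by case: sh => *; rewrite ?E0 /= ?c0 ?(mulr0, mul0r).
move=> ->; have E0 : PE (generic_y (fun=> 0)) (generic_z x x) (i :: T) [::] = 0.
  by rewrite /PE /evens big_cons y0 mul0r.
by case: sh => *; rewrite ?E0 /= ?y0 ?(mulr0, mul0r).
Qed.

Definition lin (K : fieldType) (V : lalgType K) (y z : nat -> V)
    (N : seq (K * term)) (W : seq (K * seq nat)) : V :=
  \sum_(n <- N) n.1 *: tval y z n.2 + \sum_(w <- W) w.1 *: \prod_(i <- w.2) z i.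

Definition scale_fst (K : fieldType) T (c : K) (s : seq (K * T)) : seq (K * T) :=
  [seq (c * n.1, n.2) | n <- s].

Lemma linP (K : fieldType) (V : lalgType K) (y z : nat -> V) c N W N' W' :
  lin y z (scale_fst c N ++ N') (scale_fst c W ++ W') = c *: lin y z N W + lin y z N' W'.
Proof.
rewrite /lin !big_cat !big_map addrACA scalerDr !scaler_sumr.
by congr (_ + _ + _); apply: eq_bigr => n _; rewrite scalerA.
Qed.

Lemma rmorph_tval (R S : pzRingType) (e : {rmorphism R -> S}) (y z : nat -> R) (y' z' : nat -> S) :
  (forall i, e (y i) = y' i) -> (forall i, e (z i) = z' i) ->
  forall t, e (tval y z t) = tval y' z' t.
Proof.
move=> ey ez.
have epairs ss : e (pairs z ss) = pairs z' ss.
  by rewrite /pairs rmorph_prod; apply: eq_bigr => x _; rewrite rmorphM !ez.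
have eevens T cs : [seq e x | x <- evens y z T cs] = evens y' z' T cs.
  rewrite /evens map_cat -!map_comp; congr (_ ++ _); last exact: eq_map.
  by apply: eq_map => x; rewrite /= /cm /brk rmorphB !rmorphM !ez.
have eprod Z : e (\prod_(x <- Z) x) = \prod_(x <- map e Z) x by rewrite big_map rmorph_prod.
have ePE T cs : e (PE y z T cs) = PE y' z' T cs by rewrite /PE eprod eevens.
case=> T cs ss [k|k|l k|k l|k l|] /=; rewrite -?eevens; last exact: ePE.
- by rewrite !rmorphM epairs ePE ez.
- by rewrite !rmorphM epairs ePE ez.
- by rewrite !rmorphM epairs ePE !ez.
- by rewrite !rmorphM epairs ePE !ez.
by case: (evens y z T cs) => [|x Z] /=; rewrite !rmorphM epairs !ez ?eprod.
Qed.

Lemma lrmorph_lin (K : fieldType) (A B : lalgType K) (e : {lrmorphism A -> B})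
    (y z : nat -> A) (y' z' : nat -> B) N W :
  (forall i, e (y i) = y' i) -> (forall i, e (z i) = z' i) ->
  e (lin y z N W) = lin y' z' N W.
Proof.
move=> ey ez; have eZ c x : e (c *: x) = c *: e x by exact: linearZ_LR.
have esum T (r : seq T) (F : T -> A) : e (\sum_(x <- r) F x) = \sum_(x <- r) e (F x) by exact: raddf_sum.
have eprod T (r : seq T) (F : T -> A) : e (\prod_(x <- r) F x) = \prod_(x <- r) e (F x) by exact: rmorph_prod.
rewrite /lin [LHS]raddfD; congr (_ + _); apply: (etrans (esum _ _ _)); apply: eq_bigr => n _.
  by rewrite eZ; congr (_ *: _); exact: (rmorph_tval (e := e)).
by rewrite eZ eprod; congr (_ *: _); apply: eq_bigr.
Qed.

(** * Linear independence of the normal forms *)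

Section Independence.
Variable K : fieldType.
Hypothesis char0 : [pchar K] =i pred0.
Let K2 : (2 : K) != 0 := two_neq0 char0.

Section Part.
Variables (V : lmodType K) (P : key -> Prop) (psi : key -> V).
Hypothesis psi_canon : forall k, P k -> psi (canon k) = psi k.

Lemma part_eq0 (part : term -> V) (ent : term -> (nat -> K) -> (nat -> K) -> (nat -> K) -> K)
    (N : seq (K * term)) :
  all (fun n => basic_term n.2) N ->
  (forall n, basic_term n -> expands P psi (part n) (ent n)) ->
  (forall t p q, \sum_(n <- N) n.1 * ent n.2 t p q = 0) ->
  \sum_(n <- N) n.1 *: part n.2 = 0.
Proof.
move=> aN hx; apply: (expands_eq0 char0 psi_canon).
elim: N aN => [_|n N IH] /=; first by rewrite big_nil; apply: expands_ext (expands0 P psi) => *; rewrite big_nil.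
move=> /andP[bn /IH h]; rewrite big_cons.
by apply: expands_ext (expandsD (expandsZ n.1 (hx _ bn)) h) => *; rewrite big_cons.
Qed.

Lemma expands_sub (P' : key -> Prop) (psi' : key -> V) v f :
  (forall k, P' k -> P k /\ psi k = psi' k) -> expands P' psi' v f -> expands P psi v f.
Proof.
move=> h [ks [kP -> kf]]; exists ks; split=> // [k /kP /h[] //|].
by rewrite !big_seq; apply: eq_bigr => k /kP /h[_ ->].
Qed.

End Part.

Section OddWords.

(** A functional that is nonzero on every power of [J]: the first row of an even power lives in
    entry 0, that of an odd power in entries 1 and 2. *)
Definition row_sum (A : 'M[K]_3) : K := A ord0 ord0 + A ord0 (Ordinal (isT : (1 < 3)%N)).

Let J : 'M[K]_3 := mx33 0 1 1 (- 2) 0 0 (- 2) 0 0.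

Lemma row_sum_pow n : row_sum (J ^+ n) != 0.
Proof.
suff: row_sum (J ^+ n) != 0 /\ row_sum (J ^+ n.+1) != 0 by case.
elim: n => [|n [h0 h1]].
  by rewrite expr0 expr1 /row_sum !mxE /= addr0 add0r oner_eq0.
split=> //; have -> : row_sum (J ^+ n.+2) = - 2 * 2 * row_sum (J ^+ n).
  rewrite !exprS mulrA mx33M /row_sum -mulmxE !mxE !big_ord_recl !big_ord0 !mxE /=; ring.
by rewrite !mulf_neq0 // oppr_eq0.
Qed.

(** At p = q = x each z_i is x_i [J], so a word gives a monomial times a power of [J], and a sorted
    word is determined by its monomial. [psi] divides by the value of the functional. *)
Lemma odd_words_eq0 (V : lalgType K) (z : nat -> V) (W : seq (K * seq nat)) :
  all (fun w => sorted leq w.2) W ->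
  (forall x : nat -> K, \sum_(w <- W) w.1 *: \prod_(i <- w.2) generic_z x x i = 0) ->
  \sum_(w <- W) w.1 *: \prod_(i <- w.2) z i = 0.
Proof.
move=> sW h.
pose psi (k : key) := (row_sum (J ^+ size k.1.2))^-1 *: \prod_(i <- sort leq k.1.2) z i.
have psic k : True -> psi (canon k) = psi k.
  by move=> _; rewrite /psi /canon /= size_sort sorted_sort ?sort_sorted //; [exact: leq_trans | exact: leq_total].
apply: (@expands_eq0 K V char0 (fun=> True) psi psic _
  (fun _ p _ => \sum_(w <- W) w.1 * (row_sum (J ^+ size w.2) * \prod_(i <- w.2) p i))).
  elim: W sW {h} => [_|w W IH] /=; first by rewrite big_nil; apply: expands_ext (expands0 _ psi) => *; rewrite big_nil.
  move=> /andP[sw /IH h]; rewrite big_cons.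
  have hw : expands (fun=> True) psi (\prod_(i <- w.2) z i)
      (fun _ p _ => row_sum (J ^+ size w.2) * \prod_(i <- w.2) p i).
    exists [:: (row_sum (J ^+ size w.2), ([::], w.2, [::]))]; split=> //.
      rewrite big_seq1 /psi /= scalerA mulfV ?row_sum_pow // scale1r.
      by rewrite sorted_sort //; exact: leq_trans.
    by move=> t p q; rewrite big_seq1 /chi /= !big_nil mul1r mulr1.
  by apply: expands_ext (expandsD (expandsZ w.1 hw) h) => *; rewrite big_cons.
move=> _ x _; transitivity (row_sum (\sum_(w <- W) w.1 *: \prod_(i <- w.2) generic_z x x i)); last first.
  by rewrite h /row_sum !mxE addr0.
have rsD A B : row_sum (A + B) = row_sum A + row_sum B by rewrite /row_sum !mxE addrACA.
have rsZ c A : row_sum (c *: A) = c * row_sum A by rewrite /row_sum !mxE mulrDr.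
rewrite (big_morph row_sum (id1 := 0) (op1 := +%R) rsD); last by rewrite /row_sum !mxE addr0.
apply: eq_bigr => w _; rewrite rsZ; congr (_ * _).
have -> : \prod_(i <- w.2) generic_z x x i = (\prod_(i <- w.2) x i) *: J ^+ size w.2.
  elim: (w.2) => [|i s IH]; first by rewrite !big_nil scale1r.
  rewrite !big_cons /= IH exprS -scalerA scalerAr scalerAl; congr (_ * _).
  rewrite generic_zE; apply/matrixP => - [[|[|[|//]]] ?] [[|[|[|//]]] ?]; rewrite !mxE /=; ring.
by rewrite rsZ mulrC.
Qed.

End OddWords.
End Independence.

Section TypedPart.
Variable K : fieldType.
Hypothesis char0 : [pchar K] =i pred0.
Variables (Q : algType K) (E O : Q -> Prop) (H : @weak_rel Q E O).
Variables (y z : nat -> Q).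
Hypotheses (Ey : forall i, E (y i)) (Oz : forall i, O (z i)).
Let K2 : (2 : K) != 0 := two_neq0 char0.
Local Notation EL := (e_UL y z).
Local Notation LE := (e_LU y z).
Local Notation EU := (e_UU y z).
Local Notation EP := (e_plus y z).
Local Notation EM := (e_minus y z).

Definition total_value (n : term) (t p q : nat -> K) : K :=
  \prod_(i <- t_evens n) t i * generic_value (t_brks n) (t_pairs n) p q.

Lemma total_valueE n t p q :
  total_value n t p q = even_value t p q (t_evens n) (t_brks n) * odd_value p q (t_pairs n).
Proof. by rewrite /total_value /even_value /odd_value /generic_value !mulrA. Qed.

Definition part_UL (n : term) : Q := if t_shape n is ShUL _ then tval y z n else 0.
Definition part_LU (n : term) : Q := if t_shape n is ShLU _ then tval y z n else 0.
Definition part_UU (n : term) : Q := if t_shape n is ShUU _ _ then tval y z n else 0.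
(** Products of the two LL shapes split as A = (A + B)/2 + (A - B)/2 and B = (A + B)/2 - (A - B)/2;
    this is the symmetric half. Bare even products are visible in the same entry (1,1) and join
    it. *)
Definition part_plus (n : term) : Q :=
  match t_shape n with
  | ShA k l | ShB k l => 2^-1 *: EP (t_evens n) (t_brks n) (t_pairs n) [:: l] [:: k]
  | ShY => tval y z n
  | _ => 0
  end.
Definition deg (n : term) : nat := size (t_evens n) + size (t_brks n).
Definition part_minus (n : term) : Q :=
  match t_shape n with
  | ShA k l => (2^-1 * (-1) ^+ deg n) *: EM (t_evens n) (t_brks n) (t_pairs n) [::] [:: k; l]
  | ShB k l => (- (2^-1 * (-1) ^+ deg n)) *: EM (t_evens n) (t_brks n) (t_pairs n) [::] [:: k; l]
  | _ => 0
  end.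

(** These values are entries of the generic matrices divided by a constant common to all shapes: 1,
    -2, -4, -4 and -4 for the five parts. *)
Definition value_UL (n : term) (t p q : nat -> K) : K :=
  if t_shape n is ShUL k then total_value n t p q * p k else 0.
Definition value_LU (n : term) (t p q : nat -> K) : K :=
  if t_shape n is ShLU k then total_value n t p q * q k else 0.
Definition value_UU (n : term) (t p q : nat -> K) : K :=
  if t_shape n is ShUU l k then
     2^-1 * (total_value n t p q * (p l * q k + (-1) ^+ deg n * (q l * p k))) else 0.
Definition value_plus (n : term) (t p q : nat -> K) : K :=
  match t_shape n with
     | ShA k l | ShB k l => 2^-1 * (total_value n t p q * (q k * p l))
     | ShY => - 4^-1 * even_value t p q (t_evens n) (t_brks n)
     | _ => 0 end.
Definition value_minus (n : term) (t p q : nat -> K) : K :=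
  match t_shape n with
     | ShA k l => 2^-1 * (-1) ^+ deg n * (total_value n t p q * (q k * q l))
     | ShB k l => - (2^-1 * (-1) ^+ deg n) * (total_value n t p q * (q k * q l))
     | _ => 0 end.

Lemma scale_sign (V : algType K) d (x : V) : (-1) ^+ d *: x = (-1) ^+ d * x.
Proof. by rewrite -signr_odd -[in RHS]signr_odd; case: odd; rewrite ?expr1 ?expr0 ?scaleN1r ?mulN1r ?scale1r ?mul1r. Qed.

Lemma half_sum (x u : Q) : x = 2^-1 *: (x + u) + 2^-1 *: (x - u).
Proof.
by rewrite -scalerDr addrACA subrr addr0 -mulr2n -scaler_nat scalerA mulVf // scale1r.
Qed.

Lemma tval_parts n : tval y z n =
  part_UL n + part_LU n + part_UU n + part_plus n + part_minus n.
Proof.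
case: n => T cs ss sh; rewrite /part_UL /part_LU /part_UU /part_plus /part_minus /deg /=.
have sgn d : (-1) ^+ d * (-1) ^+ d = 1 :> Q by rewrite -expr2 sqrr_sign.
case: sh => [k|k|l k|k l|k l|]; rewrite ?(add0r, addr0) //.
- by rewrite -scalerA /e_plus /e_minus scale_sign mulrA sgn mul1r; exact: half_sum.
- rewrite scaleNr -scalerA /e_plus /e_minus scale_sign mulrA sgn mul1r /=.
  set a := _ * PE _ _ _ _; set b := sandwich _ _.
  by rewrite -scalerN opprB (addrC a); exact: half_sum.
Qed.

Lemma shape_expand a0 b0 (e : seq nat -> seq (nat * nat) -> seq (nat * nat) -> seq nat -> seq nat -> Q) n s t :
  family a0 b0 e -> basic_term n -> size s = a0 -> size t = b0 ->
  expands (fam_valid a0 b0) (fam_psi a0 e) (e (t_evens n) (t_brks n) (t_pairs n) s t)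
    (fun x p q => total_value n x p q * (\prod_(i <- s) p i * \prod_(j <- t) q j)).
Proof.
move=> F bn hs ht.
have := fam_expand K2 F (r := 0) (t_pairs n) (basic_typed bn) hs ht.
by apply: expands_ext => x p q.
Qed.

Lemma expand_UL n : basic_term n -> expands (fam_valid 1 0) (fam_psi 1 EL) (part_UL n) (value_UL n).
Proof.
move=> bn; have h s t := shape_expand (s := s) (t := t) (fam_UL H Ey Oz) bn.
rewrite /part_UL /value_UL; case: n bn h => T cs ss [k|k|l k|k l|k l|] bn h; try exact: expands0.
by apply: expands_ext (h [:: k] [::] erefl erefl) => t p q; rewrite big_seq1 big_nil mulr1.
Qed.

Lemma expand_LU n : basic_term n -> expands (fam_valid 0 1) (fam_psi 0 LE) (part_LU n) (value_LU n).
Proof.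
move=> bn; have h s t := shape_expand (s := s) (t := t) (fam_LU H Ey Oz) bn.
rewrite /part_LU /value_LU; case: n bn h => T cs ss [k|k|l k|k l|k l|] bn h; try exact: expands0.
by apply: expands_ext (h [::] [:: k] erefl erefl) => t p q; rewrite big_seq1 big_nil mul1r.
Qed.

Lemma e_UU_swap T cs ss k l : typed T cs ->
  EU T cs ss [:: l] [:: k] = (-1) ^+ (size T + size cs) * EU T cs ss [:: k] [:: l].
Proof.
move=> ty; have := odd_even_odd H (Oz l) (Oz k) (evens_neq0 y z ty) (allE_evens H Ey Oz (T := T) (cs := cs)).
rewrite -!/(PE y z T cs) /e_UU /= => h.
rewrite -!mulrA (mulrA (z l)) h /evens size_cat !size_map addnC.
by rewrite [LHS]mulrA commr_sign -!mulrA.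
Qed.

(** Entry (0,0) only sees p_l q_k symmetrized with a sign, while the family attaches the single
    monomial p_l q_k. By [e_UU_swap] the product is the half-sum of both orders, so it also expands
    to the symmetrized value. *)
Lemma expand_UU n : basic_term n -> expands (fam_valid 1 1) (fam_psi 1 EU) (part_UU n) (value_UU n).
Proof.
move=> bn; have h s t := shape_expand (s := s) (t := t) (fam_UU H Ey Oz) bn.
rewrite /part_UU /value_UU; case: n bn h => T cs ss [k|k|l k|k l|k l|] bn h; try exact: expands0.
have -> : tval y z (Term T cs ss (ShUU l k)) =
    2^-1 *: (EU T cs ss [:: l] [:: k] + (-1) ^+ (size T + size cs) *: EU T cs ss [:: k] [:: l]).
  rewrite scale_sign -e_UU_swap; last exact: basic_typed bn.
  by rewrite -mulr2n -scaler_nat scalerA mulVf // scale1r.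
apply: expands_ext (expandsZ 2^-1 (expandsD (h [:: l] [:: k] erefl erefl)
  (expandsZ ((-1) ^+ (size T + size cs)) (h [:: k] [:: l] erefl erefl)))) => t p q.
by rewrite !big_seq1 /deg /=; ring.
Qed.

Lemma expand_minus n : basic_term n -> expands (fam_valid 0 2) (fam_psi 0 EM) (part_minus n) (value_minus n).
Proof.
move=> bn; have h s t := shape_expand (s := s) (t := t) (fam_minus H Ey Oz) bn.
rewrite /part_minus /value_minus; case: n bn h => T cs ss [k|k|l k|k l|k l|] bn h; try exact: expands0.
- apply: expands_ext (expandsZ _ (h [::] [:: k; l] erefl erefl)) => t p q.
  by rewrite !big_cons !big_nil mulr1 mul1r.
- apply: expands_ext (expandsZ _ (h [::] [:: k; l] erefl erefl)) => t p q.
  by rewrite !big_cons !big_nil mulr1 mul1r.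
Qed.

(* The sizes of the keys separate the bare products of even factors from the
   terms of e_plus; -4 matches the factor -2 of the latter in entry (1,1). *)
Definition even_key (k : key) : bool := size k.1.2 == (k.1.1 == [::]).
Definition plus_psi (k : key) : Q :=
  if even_key k then
    if k.1.1 == [::] then - cm z (head 0%N k.1.2, head 0%N k.2)
    else - (4 : K) *: \prod_(i <- sort leq k.1.1) y i
  else fam_psi 1 EP k.
Definition plus_valid (k : key) : Prop :=
  (~~ even_key k /\ fam_valid 1 1 k) \/ (even_key k /\ size k.2 = size k.1.2).

Lemma plus_psi_canon k : plus_valid k -> plus_psi (canon k) = plus_psi k.
Proof.
case: k => [[T s] t]; have sT : (sort leq T == [::]) = (T == [::]) by rewrite -!size_eq0 size_sort.
rewrite /plus_psi /plus_valid /even_key /= size_sort sT.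
case=> [[/negbTE -> v]|[ev st]]; first exact: (fam_psi_canon K2 (fam_plus H Ey Oz) v).
rewrite ev; have [T0|T0] := eqVneq T [::].
  move: ev st; rewrite T0 /=; case: s => [|a [|]] //; case: t => [|b [|]] //.
by rewrite sorted_sort ?sort_sorted //; [exact: leq_trans | exact: leq_total].
Qed.

Lemma expand_plus n : basic_term n -> expands plus_valid plus_psi (part_plus n) (value_plus n).
Proof.
have K4 : (4 : K) != 0 by rewrite -[4%N]/(2 * 2)%N natrM mulf_neq0.
move=> bn; have h s t := shape_expand (s := s) (t := t) (fam_plus H Ey Oz) bn.
have sub k : fam_valid 1 1 k -> plus_valid k /\ plus_psi k = fam_psi 1 EP k.
  move=> v; have ne : ~~ even_key k.
    case: v => r [hs ht hr]; rewrite /even_key hs addn1.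
    by have [/hr|_] := eqVneq k.1.1 [::] => //=; case: (r).
  by split; [left | rewrite /plus_psi (negbTE ne)].
have h2 k l : expands plus_valid plus_psi
    (2^-1 *: EP (t_evens n) (t_brks n) (t_pairs n) [:: l] [:: k])
    (fun t p q => 2^-1 * (total_value n t p q * (q k * p l))).
  apply: (@expands_sub _ _ plus_valid plus_psi _ _ _ _ sub).
  by apply: expands_ext (expandsZ 2^-1 (h [:: l] [:: k] erefl erefl)) => t p q; rewrite !big_seq1 (mulrC (p l)).
rewrite /part_plus /value_plus; case: n bn h h2 => T cs ss [k|k|l k|k l|k l|] bn h h2; try exact: expands0.
- exact: h2.
- exact: h2.
move: bn; rewrite /basic_term /basic /=; have [-> |T0] := eqVneq T [::].
  case: cs {h h2} => [//|[i j] [|//]] _.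
  (* The value -c_ij/4 is -p_i q_j/2 + p_j q_i/2, and each of the two keys contributes half of the
     commutator. *)
  exists [:: (- 2^-1, ([::], [:: i], [:: j])); (2^-1, ([::], [:: j], [:: i]))]; split.
  - by move=> k; rewrite !inE => /orP[] /eqP -> /=; right.
  - rewrite big_cons big_seq1 /plus_psi /= /PE /evens /= big_seq1 (cmC _ j i) opprK.
    rewrite scaleNr scalerN opprK -scalerDr -mulr2n -scaler_nat scalerA mulVf // scale1r //.
  - move=> t p q; rewrite big_cons big_seq1 /even_value /chi !big_cons !big_nil /=.
    by field; rewrite K2.
move=> /eqP ->; exists [:: (- 4^-1, (T, [::], [::]))]; split.
- by move=> k; rewrite !inE => /eqP -> /=; right; rewrite /even_key /= (negbTE T0).
- rewrite big_seq1 /plus_psi /even_key /= (negbTE T0) /= scalerA mulrNN mulVf // scale1r.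
  rewrite -(PE_perm H Ey Oz (T := sort leq T) (T' := T) (cs := [::]) (cs' := [::])) ?perm_sort //.
  by rewrite /PE /evens /= big_map.
- by move=> t p q; rewrite big_seq1 /even_value /chi !big_nil /=; ring.
Qed.

(** Each of the five parts is isolated by one matrix entry, namely (0,1), (1,0), (0,0), (1,1) and
    (1,2). *)
Lemma typed_part_eq0 (N : seq (K * term)) : all (fun n => basic_term n.2) N ->
  (forall t p q, \sum_(n <- N) n.1 *: tval (generic_y t) (generic_z p q) n.2 = 0) ->
  \sum_(n <- N) n.1 *: tval y z n.2 = 0.
Proof.
move=> bN hN.
have entry (f : term -> (nat -> K) -> (nat -> K) -> (nat -> K) -> K) (i j : 'I_3) (c : K) : c != 0 ->
    (forall n t p q, basic_term n -> tval (generic_y t) (generic_z p q) n i j = c * f n t p q) ->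
    forall t p q, \sum_(n <- N) n.1 * f n.2 t p q = 0.
  move=> c0 hf t p q; apply: (mulfI c0); rewrite mulr0.
  have := congr1 (fun A : 'M[K]_3 => A i j) (hN t p q); rewrite summxE [RHS]mxE => e0; rewrite -[RHS]e0.
  rewrite mulr_sumr; elim: N bN {hN e0} => [|n N' IH] /=; first by rewrite !big_nil.
  by move=> /andP[bn /IH e]; rewrite !big_cons e mxE hf // mulrCA.
pose i1 : 'I_3 := Ordinal (isT : (1 < 3)%N).
pose i2 : 'I_3 := Ordinal (isT : (2 < 3)%N).
have m2 : (-2 : K) != 0 by rewrite oppr_eq0.
have z1 : \sum_(n <- N) n.1 *: part_UL n.2 = 0.
  apply: (part_eq0 char0 (fam_psi_canon K2 (fam_UL H Ey Oz)) bN expand_UL).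
  apply: (entry value_UL ord0 i1 1 (oner_neq0 _)) => -[T cs ss sh] t p q bn; rewrite /value_UL total_valueE mul1r.
  by have [-> _ _ _ _] := generic_tval K2 t p q ss sh bn.
have z2 : \sum_(n <- N) n.1 *: part_LU n.2 = 0.
  apply: (part_eq0 char0 (fam_psi_canon K2 (fam_LU H Ey Oz)) bN expand_LU).
  apply: (entry value_LU i1 ord0 (-2) m2) => -[T cs ss sh] t p q bn; rewrite /value_LU total_valueE.
  have [_ -> _ _ _] := generic_tval K2 t p q ss sh bn.
  by case: sh {bn} => *; rewrite ?mulr0.
have z3 : \sum_(n <- N) n.1 *: part_UU n.2 = 0.
  apply: (part_eq0 char0 (fam_psi_canon K2 (fam_UU H Ey Oz)) bN expand_UU).
  apply: (entry value_UU ord0 ord0 (-2 * 2)) => [|[T cs ss sh] t p q bn]; first by rewrite mulf_neq0.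
  rewrite /value_UU total_valueE; have [_ _ -> _ _] := generic_tval K2 t p q ss sh bn.
  by case: sh {bn} => *; rewrite ?mulr0 // /deg /= -!mulrA mulVKf.
have z4 : \sum_(n <- N) n.1 *: part_plus n.2 = 0.
  apply: (part_eq0 char0 plus_psi_canon bN expand_plus).
  apply: (entry value_plus i1 i1 (-4)) => [|[T cs ss sh] t p q bn].
    by rewrite -[4%N]/(2 * 2)%N natrM oppr_eq0 mulf_neq0.
  rewrite /value_plus total_valueE; have [_ _ _ -> _] := generic_tval K2 t p q ss sh bn.
  have K4 : (4 : K) != 0 by rewrite -[4%N]/(2 * 2)%N natrM mulf_neq0.
  by case: sh {bn} => *; rewrite ?mulr0 //=; field.
have z5 : \sum_(n <- N) n.1 *: part_minus n.2 = 0.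
  apply: (part_eq0 char0 (fam_psi_canon K2 (fam_minus H Ey Oz)) bN expand_minus).
  apply: (entry value_minus i1 i2 (-4)) => [|[T cs ss sh] t p q bn].
    by rewrite -[4%N]/(2 * 2)%N natrM oppr_eq0 mulf_neq0.
  rewrite /value_minus total_valueE; have [_ _ _ _ ->] := generic_tval K2 t p q ss sh bn.
  by case: sh {bn} => *; rewrite ?mulr0 // /deg /=; field.
under eq_bigr => n _ do rewrite tval_parts !scalerDr.
by rewrite !big_split /= z1 z2 z3 z4 z5 !addr0.
Qed.

End TypedPart.

(** * Every identity lies in the generated ideal *)

Section Reduction.
Variable K : fieldType.
Hypothesis char0 : [pchar K] =i pred0.
Local Notation F := (free_algebra K).
Local Notation I0 := (MS_ideal char0).
Local Notation gy := (fun i => gen K (inl i)).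
Local Notation gz := (fun i => gen K (inr i)).
Local Notation y := (qpi I0 \o gy).
Local Notation z := (qpi I0 \o gz).

Lemma image_even i : lie_image false (y i : quot_alg I0).
Proof. by exists (gen K (inl i)) => //; exact: (free_lie_gen K (inl i)). Qed.

Lemma image_odd i : lie_image true (z i : quot_alg I0).
Proof. by exists (gen K (inr i)) => //; exact: (free_lie_gen K (inr i)). Qed.

Lemma quotient_word (w : seq variable) : exists N W,
  [/\ all (fun n : K * term => basic_term n.2) N, all (fun w : K * seq nat => sorted leq w.2) W &
    qpi I0 (\prod_(x <- w) gen K x) = lin y z N W :> quot_alg I0].
Proof.
have [ns hns e] := word_normal (MS_weak_rel char0) image_even image_odd w.
exists [seq (n.1%:~R, n.2) | n <- ns],
  (if evens_of w == [::] then [:: (1, sort leq (odds_of w))] else [::]); split.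
- by rewrite all_map.
- by case: ifP => //= _; rewrite sort_sorted //; exact: leq_total.
have -> : qpi I0 (\prod_(x <- w) gen K x) = \prod_(x <- w) letter y z x.
  by rewrite rmorph_prod; apply: eq_bigr => -[i|i].
rewrite e /lin; congr (_ + _).
  by rewrite /comb big_map; apply: eq_bigr => n _; rewrite scaler_int.
by case: ifP => _; rewrite ?big_nil // big_seq1 scale1r.
Qed.

Lemma quotient_normal (f : F) : exists N W,
  [/\ all (fun n : K * term => basic_term n.2) N, all (fun w : K * seq nat => sorted leq w.2) W &
    qpi I0 f = lin y z N W :> quot_alg I0].
Proof.
have comb_lin (r : seq {fmonom variable}) : exists N W,
  [/\ all (fun n : K * term => basic_term n.2) N, all (fun w : K * seq nat => sorted leq w.2) W &
    \sum_(w <- r) f@_w *: qpi I0 (\prod_(x <- w) gen K x) = lin y z N W :> quot_alg I0].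
  elim: r => [|w r [N [W [hN hW e]]]].
    by exists [::], [::]; split=> //; rewrite /lin !big_nil addr0.
  have [N' [W' [hN' hW' e']]] := quotient_word w.
  exists (scale_fst f@_w N' ++ N), (scale_fst f@_w W' ++ W); split.
  - by rewrite all_cat all_map hN andbT.
  - by rewrite all_cat all_map hW andbT.
  by rewrite big_cons e e' linP.
have [N [W [hN hW e]]] := comb_lin (msupp f); exists N, W; split=> //.
rewrite -e {1}[f]free_expansion raddf_sum /=; apply: eq_bigr => w _; exact: linearZ_LR.
Qed.

Lemma T2_generated (f : F) : T2 (pair_MS K) f -> weak_T2_ideal_generated (@MS_basis K) f.
Proof.
move=> hf; have [N [W [hN hW e]]] := quotient_normal f.
have elin : qpi I0 (lin gy gz N W) = lin y z N W :> quot_alg I0.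
  by apply: (lrmorph_lin (e := qpi I0)).
(* The difference of f and its normal form lies in the ideal, hence is an identity; so the normal
   form is one too and may be evaluated on generic matrices. *)
have hg : T2 (pair_MS K) (lin gy gz N W).
  have hd : T2 (pair_MS K) (f - lin gy gz N W).
    by apply: (generated_T2 char0); apply/(qpi_eq I0); rewrite elin.
  have [[[_ hD] _] _] := T2_ideal (pair_MS K).
  have := hD (-1) _ _ hd hf; rewrite scaleN1r opprB subrK; exact.
have values t p q : lin (generic_y t) (generic_z p q) N W = 0 :> 'M[K]_3.
  pose v : variable -> pair_MS K := letter (generic_y t) (generic_z p q).
  have hv x : gp_lie_comp (odd_variable x) (v x).
    have sub d (a m n : K) : M_comp d (ad_sl2 a m n) -> @gp_lie_comp K (pair_MS K) d (ad_sl2 a m n).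
      by move=> c; split=> //; exists a, m, n.
    case: x => i; apply: sub => j k.
      by rewrite mxE; case: j => [[|[|[|//]]] ?]; case: k => [[|[|[|//]]] ?] //=; rewrite ?mulr0 ?oppr0.
    by rewrite mxE; case: j => [[|[|[|//]]] ?]; case: k => [[|[|[|//]]] ?] //=; rewrite ?mulr0 ?oppr0.
  apply: (etrans _ (hg v hv)); apply/esym.
  by apply: (lrmorph_lin (e := eval v)) => i; exact: eval_gen.
(* Stated for every algebra because it is used twice: to discard the odd words from the matrix
   values and from the quotient. *)
have words (V : algType K) zz : \sum_(w <- W) w.1 *: \prod_(i <- w.2) zz i = 0 :> V.
  apply: (odd_words_eq0 char0 zz hW) => x.
  have := values (fun=> 0) x x; rewrite /lin; set s := \sum_(n <- N) _.
  have -> : s = 0; last by rewrite add0r.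
  rewrite /s; elim: (N) hN => [|n N' IH] /=; first by rewrite big_nil.
  move=> /andP[bn /IH e0]; rewrite big_cons e0 generic_tval0 ?scaler0 ?addr0 //.
  exact: two_neq0.
have typed0 t p q : \sum_(n <- N) n.1 *: tval (generic_y t) (generic_z p q) n.2 = 0 :> 'M[K]_3.
  by have := values t p q; rewrite /lin words addr0.
have f0 : qpi I0 f = 0.
  rewrite e /lin words addr0.
  exact: (typed_part_eq0 char0 (MS_weak_rel char0) image_even image_odd hN typed0).
by rewrite -(subr0 f); apply/(qpi_eq I0); rewrite f0 rmorph0.
Qed.

End Reduction.

Theorem theorem3p13 (K : fieldType) (char0 : [pchar K]%R =i pred0)
    (f : free_algebra K) :
  T2 (pair_MS K) f <-> weak_T2_ideal_generated (@MS_basis K) f.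
Proof. by split; [exact: T2_generated | exact: generated_T2]. Qed.
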